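(* Let $p$ and $q$ be distinct prime numbers and let $N(p,q)$ be the number of isomorphism classes of left braces of size $p^2q$. Then: (1) if $p\equiv 1\pmod q$ and $q>2$, then $N(p,q)=\frac{q+15}{2}$; (2) if $p\equiv 1\pmod q$ and $q=2$, then $N(p,q)=8$; (3) if $p,q$ are odd and $p\equiv -1\pmod q$, then $N(p,q)=5$; (4) if $p$ is odd, $q\equiv 1\pmod p$ and $q\not\equiv 1\pmod{p^2}$, then $N(p,q)=p+8$; (5) if $p$ is odd and $q\equiv 1\pmod{p^2}$, then $N(p,q)=2p+8$; (6) if $p=2$, $q>3$ and $q\not\equiv 1\pmod 4$, then $N(p,q)=9$; (7) if $p=2$ and $q\equiv 1\pmod 4$, then $N(p,q)=11$; (8) if none of the congruences $p\equiv 1\pmod q$, $p\equiv -1\pmod q$, $q\equiv 1\pmod p$ holds, then $N(p,q)=4$.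
   Context: A skew (left) brace is a triple $(B,+,\circ)$ where $(B,+)$ and $(B,\circ)$ are groups (not necessarily abelian) such that $a\circ(b+c)=a\circ b-a+a\circ c$ for all $a,b,c\in B$. A left brace is a skew brace whose additive group $(B,+)$ is abelian. Its size is $|B|$. An isomorphism of skew braces is a bijection that is a homomorphism for both operations. *)

(* Defs.v *)
From HB Require Import structures.
From mathcomp Require Import all_boot ssralg.

Set Implicit Arguments.
Unset Strict Implicit.
Unset Printing Implicit Defensive.

Local Open Scope ring_scope.

(* A left brace is a skew brace whose additive group is abelian: (B, +) is    *)
(* the [zmodType] structure and the circle group (B, o) is the [groupType]    *)
(* structure, with [a o b] written [(a * b)%g]. Beware that [finalg] also     *)
(* views every [finZmodType] as a [finGroupType] through its addition.        *)
HB.mixin Record ZmoduleGroup_isLeftBrace B of GRing.Zmodule B & Group B := {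
  brace_mulD : forall a b c : B,
    (a * (b + c)%R)%g = (a * b)%g - a + (a * c)%g
}.

#[short(type="leftBraceType")]
HB.structure Definition LeftBrace :=
  {B of ZmoduleGroup_isLeftBrace B & GRing.Zmodule B & Group B}.

Definition brace_iso (B C : leftBraceType) : Prop :=
  exists f : B -> C,
    [/\ bijective f,
        {morph f : x y / x + y} &
        {morph f : x y / (x * y)%g}].

Definition has_size (T : Type) (n : nat) : Prop :=
  exists f : 'I_n -> T, bijective f.

(* There are exactly N isomorphism classes of left braces of size n: some     *)
(* family F of N such braces represents every class exactly once.             *)
Definition num_left_braces (n N : nat) : Prop :=
  exists F : 'I_N -> leftBraceType,
    [/\ forall i, has_size (F i) n,
        forall i j, brace_iso (F i) (F j) -> i = j &
        forall B : leftBraceType, has_size B n -> exists i, brace_iso B (F i)].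

Lemma brace_iso_sym (B C : leftBraceType) : brace_iso B C -> brace_iso C B.
Proof.
case=> f [[g fK gK] fD fM]; exists g; split; first by exists f.
- by move=> x y; rewrite -[x + y](congr2 +%R (gK x) (gK y)) -fD fK.
- by move=> x y; rewrite -[(x * y)%g](congr2 *%g (gK x) (gK y)) -fM fK.
Qed.

Lemma brace_iso_trans (B C D : leftBraceType) :
  brace_iso B C -> brace_iso C D -> brace_iso B D.
Proof.
case=> f [bf fD fM] [g [bg gD gM]]; exists (g \o f); split.
- exact: bij_comp.
- by move=> x y /=; rewrite fD gD.
- by move=> x y /=; rewrite fM gM.
Qed.

Lemma num_left_braces_unique n N M :
  num_left_braces n N -> num_left_braces n M -> N = M.
Proof.
suff le K L : num_left_braces n K -> num_left_braces n L -> (K <= L)%N.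
  by move=> hN hM; apply/eqP; rewrite eqn_leq !le.
case=> F [Fn Finj _] [G [_ _ Gsurj]].
have /fin_all_exists[h hP] (i : 'I_K) : exists j, brace_iso (F i) (G j).
  exact/Gsurj/Fn.
suff /leq_card : injective h by rewrite !card_ord.
move=> i j eq_h; apply: Finj; apply: brace_iso_trans (hP i) _.
by rewrite eq_h; apply: brace_iso_sym.
Qed.

(* Main.v *)
(* A left brace is an abelian group B with a map lam : (B, o) -> Aut (B, +)
   such that lam_(a + lam_a b) = lam_a lam_b. For |B| = p^2 q the Sylow subgroups
   P and Q of (B, +) are lam-invariant. Comparing orders, Q acts trivially on
   itself, and, unless (p, q) = (2, 3), one of the actions Q -> Aut P and
   P -> Aut Q is trivial. Hence B is a semidirect product of a brace P of size p^2
   and F_q, given either by a character P -> F_q^* or by a brace automorphism of P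
   whose order divides q.

   There are four braces of size p^2: since p-groups act unipotently and groups of
   order p^2 are abelian, lam_x y = y + k (p x y) on Z/p^2, or
   lam_x y = y + k x_1 y_1 e_0 on F_p^2, with k = 0 or 1.

   Isomorphism of semidirect products amounts to equivalence of the characters
   under Aut P, resp. conjugacy in Aut P of the cyclic groups generated by the
   automorphisms, so four small orbit problems remain. Summing the numbers of
   orbits over the four braces P gives the total. *)

From HB Require Import structures.
Require Import Defs.
From mathcomp Require Import all_boot all_algebra all_fingroup all_solvable all_field.
From mathcomp Require Import zify ring.

Set Implicit Arguments.
Unset Strict Implicit.
Unset Printing Implicit Defensive.
Import GRing.Theory.
Local Open Scope ring_scope.

(** * Counting classes *)

(** Both actions can be nontrivial only if q divides p^2 - 1 and p divides q - 1, which forces q = p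
    + 1; hence the exception (2, 3). Counting characters requires the circle group of P. For odd p a
    quadratic correction with coefficient 1/2 identifies it with the additive group, and characters
    become roots of unity or column vectors. For p = 2 there is no 1/2, and the nontrivial braces of
    size 4 exchange types: the one on Z/4 has a Klein circle group, the one on F_2^2 a cyclic one.
    The contributions, in the order cyclic trivial, cyclic nontrivial, elementary trivial,
    elementary nontrivial, are: 2 + 1 + ((q - 1)/2 + 3) + 2 if q divides p - 1; 1 + 1 + 2 + 1 in
    case (3); for odd p dividing q - 1, 2 + p + 2 + 4, or 3 + (2p - 1) + 2 + 4 if p^2 divides q - 1;
    for p = 2, 2 + 3 + 2 + 2, or 3 + 3 + 2 + 3 if 4 divides q - 1; 1 + 1 + 1 + 1 in case (8). Braces
    form a type without a quotient, so every count is a system of representatives moved along a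
    relation. *)

Definition num_classes (T : Type) (V : T -> Prop) (R : T -> T -> Prop) (N : nat) :=
  exists F : 'I_N -> T,
    [/\ forall i, V (F i),
        forall i j, R (F i) (F j) -> i = j &
        forall t, V t -> exists i, R t (F i)].

Lemma num_classes_fin (I : finType) (T : Type) (V : T -> Prop) (R : T -> T -> Prop)
    (F : I -> T) :
  (forall i, V (F i)) -> (forall i j, R (F i) (F j) -> i = j) ->
  (forall t, V t -> exists i, R t (F i)) ->
  num_classes V R #|I|.
Proof.
move=> FV Finj Fsurj; exists (F \o enum_val); split=> [i|i j /=|t /Fsurj[i Ri]].
- exact: FV.
- by move=> /Finj /enum_val_inj.
- by exists (enum_rank i); rewrite /= enum_rankK.
Qed.

Lemma num_classes1 (T : Type) (V : T -> Prop) (R : T -> T -> Prop) (t0 : T) :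
  V t0 -> (forall t, V t -> R t t0) -> num_classes V R 1.
Proof.
move=> Vt0 Rt0; rewrite -card_unit.
by apply: (@num_classes_fin _ _ _ _ (fun=> t0)) => // [[] []|t /Rt0] //; exists tt.
Qed.

Lemma num_classes0 (T : Type) (V : T -> Prop) (R : T -> T -> Prop) :
  (forall t, ~ V t) -> num_classes V R 0.
Proof.
move=> V0; rewrite -card_void.
by apply: (@num_classes_fin _ _ _ _ (of_void T)) => [[]|[]|t /V0].
Qed.

Lemma num_classes_sum (I : finType) (T : Type) (V : T -> Prop)
    (W : I -> T -> Prop) (R : T -> T -> Prop) (N : I -> nat) :
  (forall t, V t <-> exists i, W i t) ->
  (forall i j t u, W i t -> W j u -> R t u -> i = j) ->
  (forall i, num_classes (W i) R (N i)) ->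
  num_classes V R (\sum_i N i).
Proof.
move=> VW Wdisj /fin_all_exists[F FP].
have -> : (\sum_i N i)%N = #|{: {i : I & 'I_(N i)}}|.
  by rewrite card_tagged sumnE big_map big_enum; apply: eq_bigr => i; rewrite card_ord.
apply: (@num_classes_fin _ _ _ _ (fun s => F (tag s) (tagged s))).
- by move=> [i s] /=; apply/VW; exists i; case: (FP i).
- move=> [i s] [j t] /= Rst.
  have [Fs Finj _] := FP i; have [Ft _ _] := FP j.
  have eij := Wdisj _ _ _ _ (Fs s) (Ft t) Rst; subst j.
  by rewrite (Finj _ _ Rst).
- move=> t /VW[i Wit]; have [_ _ /(_ t Wit)[s Rs]] := FP i.
  by exists (Tagged (fun i => 'I_(N i)) s).
Qed.

(** A boolean invariant [C] of the relation cuts the problem in two. The orbit counts below peel off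
    one class after another in this way. *)
Lemma num_classesU (T : Type) (V : T -> Prop) (C : T -> bool) (R : T -> T -> Prop) (m n : nat) :
  (forall t u, V t -> V u -> R t u -> C t = C u) ->
  num_classes (fun t => V t /\ C t) R m ->
  num_classes (fun t => V t /\ ~~ C t) R n ->
  num_classes V R (m + n).
Proof.
move=> RC Vm Vn.
have -> : (m + n)%N = (\sum_(b : bool) if b then m else n)%N by rewrite big_bool.
apply: (@num_classes_sum _ _ _ (fun b t => V t /\ C t = b)).
- by move=> t; split=> [Vt|[b []] //]; exists (C t).
- by move=> b c t u [Vt <-] [Vu <-]; apply: RC.
- case=> //; case: Vn => F [FV Finj Fsurj]; exists F; split=> // [i|t [Vt Ct]].
    by have [? /negbTE ->] := FV i.
  by apply: Fsurj; rewrite Ct.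
Qed.

(** A relation [G] replaces a bijection between data and parameters: automorphisms and characters
    are functions compared pointwise, so a parameter does not determine them as terms. *)
Lemma num_classes_graph (T U : Type) (V : T -> Prop) (R : T -> T -> Prop)
    (W : U -> Prop) (S : U -> U -> Prop) (G : T -> U -> Prop) (N : nat) :
  (forall t, V t -> exists2 u, W u & G t u) ->
  (forall u, W u -> exists2 t, V t & G t u) ->
  (forall t t' u u', G t u -> G t' u' -> (S u u' <-> R t t')) ->
  num_classes V R N -> num_classes W S N.
Proof.
move=> VW WV SR [F [FV Finj Fsurj]].
have /fin_all_exists2[H HW HG] (i : 'I_N) : exists2 u, W u & G (F i) u by apply/VW/FV.
exists H; split=> // [i j /SR-/(_ _ _ (HG i) (HG j))/Finj //|u /WV[t Vt Gt]].
by have [i Ri] := Fsurj t Vt; exists i; apply/(SR _ _ _ _ Gt (HG i)).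
Qed.

Lemma num_classes_iff (T : Type) (V W : T -> Prop) (R : T -> T -> Prop) (N : nat) :
  (forall t, V t <-> W t) -> num_classes V R N -> num_classes W R N.
Proof.
move=> VW; apply: (num_classes_graph (G := fun t u => t = u)) => [t Vt|u Wu|t t' _ _ <- <- //].
- by exists t; first exact/VW.
- by exists u; first exact/VW.
Qed.

Lemma has_size_fin (T : finType) : has_size T #|T|.
Proof. by exists enum_val; apply: enum_val_bij. Qed.

(** * Braces and their lambda maps *)

Definition lam (B : leftBraceType) (a b : B) : B := (a * b)%g - a.

Section LamTheory.
Variable B : leftBraceType.
Implicit Types a b c : B.

Lemma brace_mulE a b : (a * b)%g = a + lam a b.
Proof. by rewrite /lam addrC subrK. Qed.

Lemma lamD a : {morph lam a : b c / b + c}.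
Proof. by move=> b c; rewrite /lam brace_mulD addrA. Qed.

Lemma brace_one : 1%g = 0 :> B.
Proof.
have := brace_mulD (1%g : B) 0 0.
by rewrite !mul1g !addr0 add0r => /esym/eqP; rewrite oppr_eq0 => /eqP.
Qed.

Lemma lam1 b : lam 0 b = b.
Proof. by rewrite /lam -brace_one mul1g brace_one subr0. Qed.

Lemma lamr0 a : lam a 0 = 0.
Proof. by rewrite /lam -{1}brace_one mulg1 subrr. Qed.

Lemma lamM a b c : lam (a * b)%g c = lam a (lam b c).
Proof.
apply: (addrI (a * b)%g); rewrite -brace_mulE -mulgA !brace_mulE.
by rewrite lamD addrA.
Qed.

End LamTheory.

Lemma brace_isoP (B C : leftBraceType) :
  brace_iso B C <->
  exists f : B -> C,
    [/\ bijective f, {morph f : x y / x + y} &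
        forall x y, f (lam x y) = lam (f x) (f y)].
Proof.
split=> -[f [bf fD fM]]; exists f; split=> // x y.
  by apply: (addrI (f x)); rewrite -fD -!brace_mulE fM.
by rewrite !brace_mulE fD fM.
Qed.

Lemma brace_iso_refl (B : leftBraceType) : brace_iso B B.
Proof. by exists id; split=> //; exists id. Qed.

(** With circle operation [a + l a b], [is_lamM] makes [l] a homomorphism and [is_lamV] gives right
    inverses; its boolean equation lets [xchoose] pick the inverse. *)
Record is_lam (A : zmodType) (l : A -> A -> A) : Prop := IsLam {
  is_lamD : forall a, {morph l a : b c / b + c};
  is_lamM : forall a b c, l (a + l a b) c = l a (l b c);
  is_lam0 : forall b, l 0 b = b;
  is_lamV : forall a, exists b, a + l a b == 0
}.

(** A copy of [A] indexed by the proof, so that one additive group can carry many circle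
    structures. *)
Definition lbrace (A : zmodType) (l : A -> A -> A) (H : is_lam l) : Type := A.

Section LBrace.
Variables (A : zmodType) (l : A -> A -> A) (H : is_lam l).

HB.instance Definition _ := GRing.Zmodule.on (lbrace H).

Let mul (a b : A) : A := a + l a b.
Let inv (a : A) : A := xchoose (is_lamV H a).

Let mulA : associative mul.
Proof. by move=> a b c; rewrite /mul (is_lamM H) (is_lamD H) addrA. Qed.
Let mul1 : left_id 0 mul.
Proof. by move=> a; rewrite /mul (is_lam0 H) add0r. Qed.
Let mulr1 : right_id 0 mul.
Proof.
move=> a; rewrite /mul; suff -> : l a 0 = 0 by rewrite addr0.
by apply: (addrI (l a 0)); rewrite -(is_lamD H) !addr0.
Qed.
Let mulrV : right_inverse 0 inv mul.
Proof. by move=> a; apply/eqP; apply: (xchooseP (is_lamV H a)). Qed.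
Let mulVr : left_inverse 0 inv mul.
Proof.
move=> a; rewrite -[LHS]mulr1 -{1}(mulrV (inv a)) mulA -(mulA (inv a)) mulrV.
by rewrite mulr1 mulrV.
Qed.

HB.instance Definition _ :=
  isGroup.Build (lbrace H) mulA mul1 mulr1 mulVr mulrV.

Let mulD (a b c : lbrace H) : (a * (b + c)%R)%g = (a * b)%g - a + (a * c)%g.
Proof.
change (a + l a (b + c) = a + l a b - a + (a + l a c)).
by rewrite (is_lamD H) [a + l a b]addrC addrK addrCA.
Qed.

HB.instance Definition _ := ZmoduleGroup_isLeftBrace.Build (lbrace H) mulD.

Lemma lbrace_lam (a b : lbrace H) : lam a b = l a b.
Proof. by rewrite /lam; change (a + l a b - a = l a b); rewrite addrC addKr. Qed.

End LBrace.

(** * Finite groups given by a bijection with an ordinal *)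

(** [has_size] supplies a bare bijection. On this copy of [G] it induces a finite structure, which
    opens finite group theory to the given group law. *)
Definition fin_carrier (G : groupType) (n : nat) (f : 'I_n -> G) (g : G -> 'I_n)
  (fK : cancel g f) : Type := G.

Section FinCarrier.
Variables (G : groupType) (n : nat) (f : 'I_n -> G) (g : G -> 'I_n) (fK : cancel g f).
HB.instance Definition _ := Group.on (fin_carrier fK).
HB.instance Definition _ : isCountable (fin_carrier fK) := CanIsCountable fK.
HB.instance Definition _ : isFinite (fin_carrier fK) := 
  @CanIsFinite (fin_carrier fK) _ _ _ fK.
End FinCarrier.

Lemma bij_card (T : finType) (n : nat) (f : 'I_n -> T) : bijective f -> #|T| = n.
Proof. by move/bij_eq_card => <-; rewrite card_ord. Qed.

Section FiniteGroupType.
Variables (G : groupType) (n : nat).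
Hypothesis Gn : has_size G n.

Lemma has_size_expg (x : G) : (x ^+ n)%g = 1%g.
Proof.
have [f [g gK fK]] := Gn; pose H : finGroupType := fin_carrier fK.
have cardH : #|[set: H]%G| = n by rewrite cardsT; apply: (@bij_card H _ f); exists g.
by have := @expg_cardG H [set: H]%G x (in_setT _); rewrite cardH.
Qed.

Lemma has_size_p2_commute (p : nat) (x y : G) :
  prime p -> n = (p ^ 2)%N -> (x * y = y * x)%g.
Proof.
move=> pp np; have [f [g gK fK]] := Gn; pose H : finGroupType := fin_carrier fK.
have cardH : #|[set: H]%G| = (p ^ 2)%N.
  by rewrite -np cardsT; apply: (@bij_card H _ f); exists g.
have /centsP := card_p2group_abelian pp cardH.
by move=> /(_ x (in_setT _) y (in_setT _)).
Qed.

End FiniteGroupType.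

Lemma has_size_inj_bij (T U : Type) (n : nat) (f : T -> U) :
  has_size T n -> has_size U n -> injective f -> bijective f.
Proof.
move=> [g [g' gK g'K]] [h [h' hK h'K]] finj.
have /injF_bij [k kK Kk] : injective (h' \o f \o g).
  apply: inj_comp; last exact: can_inj gK.
  by apply: inj_comp finj; apply: can_inj h'K.
exists (g \o k \o h') => x /=.
  by rewrite -{1}(g'K x) -[k _]/(k ((h' \o f \o g) (g' x))) kK g'K.
by apply: (can_inj h'K); rewrite -[LHS]/((h' \o f \o g) (k (h' x))) Kk.
Qed.

Lemma has_size_bij (T U : Type) (n : nat) (f : T -> U) :
  bijective f -> has_size T n -> has_size U n.
Proof. by move=> fb [g gb]; exists (f \o g); apply: bij_comp. Qed.

(** An alias on which addition is the group law, so that Cauchy and Sylow apply to (A, +). *)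
Definition add_group (A : zmodType) : Type := A.
HB.instance Definition _ (A : zmodType) := Choice.on (add_group A).
HB.instance Definition _ (A : zmodType) :=
  isGroup.Build (add_group A) (@addrA A) (@add0r A) (@addr0 A) (@addNr A) (@addrN A).

Lemma add_group_expg (A : zmodType) (x : A) n : ((x : add_group A) ^+ n)%g = x *+ n.
Proof. by elim: n => // n IH; rewrite expgS mulrS IH. Qed.

Lemma expg_eq1_dvdn (H : finGroupType) (x : H) n : (x ^+ n == 1)%g = (#[x]%g %| n)%N.
Proof. by rewrite order_dvdn. Qed.

(** The divisibility equivalences express exact orders and, for [u1] and [u2], independence at once;
    they later make the map from the standard group injective. *)
Lemma zmod_p2q_generators (A : zmodType) (p q : nat) :
  prime p -> prime q -> p <> q -> has_size A (p ^ 2 * q) ->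
  (exists v : A, forall n, (v *+ n == 0) = (q %| n)%N) /\
  ((exists u : A, forall n, (u *+ n == 0) = (p ^ 2 %| n)%N) \/
   (exists u1 u2 : A, forall a b, (u1 *+ a + u2 *+ b == 0) = (p %| a)%N && (p %| b)%N)).
Proof.
move=> pp pq npq [f [g gK fK]].
pose f' : 'I_(p ^ 2 * q) -> add_group A := f.
pose H : finGroupType := @fin_carrier _ _ f' g fK.
have cardH : #|[set: H]%G| = (p ^ 2 * q)%N.
  by rewrite cardsT; apply: (@bij_card H _ f); exists g.
have XE (x : H) n : (x ^+ n)%g = (x : A) *+ n by rewrite -add_group_expg.
split.
  have [|v _ ov] := @Cauchy H q [set: H]%G pq; first by rewrite cardH dvdn_mull.
  by exists v => n; rewrite -ov -expg_eq1_dvdn XE.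
have [S sylS] := Sylow_exists p [set: H]%G.
have cardS : #|S| = (p ^ 2)%N.
  rewrite (card_Hall sylS) cardH partnM ?expn_gt0 ?prime_gt0 //.
  rewrite part_pnat_id ?pnatX ?pnat_id // part_p'nat ?muln1 //.
  by rewrite p'natE //; apply/negP; rewrite dvdn_prime2 // => /eqP.
(* The Sylow subgroup [S] has order p^2: either some element has order p^2 or [S] has exponent p. *)
case: (boolP [exists x in S, (x ^+ p != 1)%g]) => [/exists_inP[u uS up]|].
  left; exists u => n; rewrite -XE.
  have : (#[u]%g %| p ^ 2)%N by rewrite -cardS order_dvdG.
  move=> /(dvdn_pfactor _ _ pp)[[|[|[|m]]] // _ ou].
  - by move: up; rewrite expg_eq1_dvdn ou expn0 dvd1n.
  - by move: up; rewrite expg_eq1_dvdn ou expn1 dvdnn.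
  - by rewrite -ou -expg_eq1_dvdn.
rewrite negb_exists_in => /forall_inP Sp.
have {}Sp x : x \in S -> (x ^+ p = 1)%g by move/Sp; rewrite negbK => /eqP.
right.
have [|u1 u1S ou1] := @Cauchy H p S pp; first by rewrite cardS dvdn_exp.
have [u2 u2S u2u1] : exists2 x, x \in S & x \notin <[u1]>%g.
  apply/subsetPn; apply/negP => /subset_leq_card.
  rewrite cardS -[#|<[_]>%g|]/(#[u1]%g) ou1 leqNgt.
  by rewrite -{1}(expn1 p) ltn_exp2l ?prime_gt1.
have ou2 : #[u2]%g = p.
  have : (#[u2]%g %| p)%N by rewrite -expg_eq1_dvdn Sp.
  move: pp => /primeP[_ /[apply]] /orP[|/eqP//]; rewrite order_eq1 => /eqP u21.
  by move: u2u1; rewrite u21 group1.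
exists u1, u2 => a b.
have comm (x y : H) : (x * y = y * x)%g by apply: addrC.
rewrite -!XE; apply/idP/andP; last first.
  move=> [pa pb]; rewrite -[_ == _]/((u1 ^+ a * u2 ^+ b == 1)%g).
  have /eqP-> : (u1 ^+ a == 1)%g by rewrite expg_eq1_dvdn ou1.
  have /eqP-> : (u2 ^+ b == 1)%g by rewrite expg_eq1_dvdn ou2.
  by rewrite mulg1.
rewrite -[_ == _]/((u1 ^+ a * u2 ^+ b == 1)%g) => /eqP e.
(* Otherwise [u2] is a power of [u2 ^+ b], which lies in the group generated by [u1]. *)
have pb : (p %| b)%N.
  apply: contraR u2u1; rewrite -prime_coprime // => cpb.
  have : (u2 ^+ b)%g \in <[u1]>%g.
    by rewrite -[X in X \in _](mulKg (u1 ^+ a)%g) e mulg1 groupV mem_cycle.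
  move=> /(groupX (expg_invn <[u2]>%g b)).
  by rewrite expgK ?cycle_id // -[#|_|]/(#[u2]%g) ou2.
split=> //; rewrite -ou1 -expg_eq1_dvdn -e.
suff /eqP-> : (u2 ^+ b == 1)%g by rewrite mulg1.
by rewrite expg_eq1_dvdn ou2.
Qed.

(** * Semidirect products with a group of prime order *)

Lemma Fp_natr_eq0 (q n : nat) : prime q -> (n%:R == 0 :> 'F_q) = (q %| n)%N.
Proof. by move=> pq; rewrite (dvdn_pcharf (pchar_Fp pq)). Qed.

Lemma iter_modn (T : Type) (q : nat) (f : T -> T) (n : nat) (x : T) :
  (forall x, iter q f x = x) -> iter (n %% q) f x = iter n f x.
Proof.
move=> fq; rewrite {2}(divn_eq n q) addnC iterD; congr (iter _ _ _).
by elim: (n %/ q)%N => // m IH; rewrite mulSn iterD -IH fq.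
Qed.

(** Elements of ['F_q] serve as iteration counts through their representatives below q; a map whose
    q-th iterate is the identity does not see the choice. *)
Lemma iter_Fp (T : Type) (q : nat) (f : T -> T) (n : nat) (x : T) :
  prime q -> (forall x, iter q f x = x) -> iter (n%:R : 'F_q) f x = iter n f x.
Proof. by move=> pq fq; rewrite val_Fp_nat // iter_modn. Qed.

Lemma mulrn_coprime_eq0 (A : zmodType) (m n : nat) (x : A) :
  coprime m n -> x *+ m = 0 -> x *+ n = 0 -> x = 0.
Proof.
case: m => [|m]; first by rewrite /coprime gcd0n => /eqP->.
move=> /eqP; case: (@egcdnP m.+1 n) => // u v e _ + xm xn => g1.
have : x *+ (u * m.+1) = x *+ (v * n + 1) by rewrite e g1.
by rewrite mulnC mulrnA xm mul0rn mulrnDr mulnC mulrnA xn mul0rn add0r.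
Qed.

(** [al] is the action of the generator 1 of F_q on P and [chi] the action of P on F_q; one formula
    covers both kinds of semidirect product. *)
Definition semi_lam (q : nat) (P : leftBraceType) (al : P -> P) (chi : P -> 'F_q)
    (a b : P * 'F_q) : P * 'F_q :=
  (lam a.1 (iter a.2 al b.1), chi a.1 * b.2).

Lemma semi_lamE (q : nat) (P : leftBraceType) (al : P -> P) (chi : P -> 'F_q) x y x' y' :
  semi_lam al chi (x, y) (x', y') = (lam x (iter y al x'), chi x * y').
Proof. by []. Qed.

Lemma pair_addE (A B : zmodType) (x x' : A) (y y' : B) :
  (x, y) + (x', y') = (x + x', y + y').
Proof. by []. Qed.

(* [sd_triv], one of the two mutual actions is trivial, is what makes [semi_lam]
   a lambda map. *)
Record semi_data (q : nat) (P : leftBraceType) (al : P -> P) (chi : P -> 'F_q) : Prop :=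
  SemiData {
  sd_alD : {morph al : x y / x + y};
  sd_al_lam : forall x y, al (lam x y) = lam (al x) (al y);
  sd_alq : forall x, iter q al x = x;
  sd_chiM : forall x y, chi (x * y)%g = chi x * chi y;
  sd_chi_neq0 : forall x, chi x != 0;
  sd_triv : (forall x, al x = x) \/ (forall x, chi x = 1)
}.

Section Semi.
Variables (q : nat) (P : leftBraceType) (al : P -> P) (chi : P -> 'F_q).
Hypotheses (pq : prime q) (H : semi_data al chi).

Lemma sd_iterD n : {morph iter n al : x y / x + y}.
Proof. by elim: n => // n IH x y; rewrite !iterS IH (sd_alD H). Qed.

Lemma sd_iter_lam n x y : iter n al (lam x y) = lam (iter n al x) (iter n al y).
Proof. by elim: n => // n IH; rewrite !iterS IH (sd_al_lam H). Qed.

Lemma sd_chi0 : chi 0 = 1.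
Proof.
apply: (mulfI (sd_chi_neq0 H 0)).
by rewrite -(sd_chiM H) -{2}(@brace_one P) mulg1 mulr1.
Qed.

Lemma sd_iter_id n x : (forall x, al x = x) -> iter n al x = x.
Proof. by move=> al1; elim: n => //= n ->. Qed.

Lemma sd_chi_iter n x : chi (iter n al x) = chi x.
Proof. by have [al1|chi1] := sd_triv H; [rewrite sd_iter_id | rewrite !chi1]. Qed.

Lemma sd_iterK (y : 'F_q) : cancel (iter (- y) al) (iter y al).
Proof.
move=> x; have := iter_Fp (y + (- y)%R : nat) x pq (sd_alq H).
by rewrite natrD !natr_Zp subrr iterD.
Qed.

Lemma semi_is_lam : is_lam (semi_lam al chi).
Proof.
split.
- move=> [x y] [x1 y1] [x2 y2].
  by rewrite pair_addE !semi_lamE pair_addE sd_iterD lamD mulrDr.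
- move=> [x y] [x1 y1] [x2 y2].
  rewrite [semi_lam al chi (x, y) (x1, y1)]semi_lamE pair_addE !semi_lamE.
  rewrite -brace_mulE lamM (sd_chiM H) sd_chi_iter mulrA.
  congr (lam _ _, _); rewrite sd_iter_lam; congr (lam _ _).
  have [al1|->] := sd_triv H; first by rewrite !sd_iter_id.
  by rewrite mul1r -iterD -[RHS](iter_Fp _ _ pq (sd_alq H)) natrD !natr_Zp.
- by move=> [x y]; rewrite /semi_lam /= lam1 sd_chi0 mul1r.
(* The inverse comes from solving [x + lam x (iter y al x') = 0] and [y + chi x * y' = 0]. *)
- move=> [x y]; exists (iter (- y) al (x^-1)%g, - (y / chi x)).
  rewrite /semi_lam /= sd_iterK; apply/eqP.
  rewrite -[LHS]/(x + lam x x^-1%g, y + chi x * - (y / chi x)).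
  by rewrite -brace_mulE mulgV brace_one mulrN mulrCA mulfV ?(sd_chi_neq0 H) // mulr1 subrr.
Qed.

Definition semi : leftBraceType := lbrace semi_is_lam.

End Semi.

Section SemiIso.
Variables (p q : nat) (P P' : leftBraceType).
Variables (al : P -> P) (chi : P -> 'F_q) (al' : P' -> P') (chi' : P' -> 'F_q).
Hypotheses (pp : prime p) (pq : prime q) (npq : p <> q).
Hypotheses (Pp : forall x : P, x *+ p ^ 2 = 0) (P'p : forall x : P', x *+ p ^ 2 = 0).
Hypotheses (H : semi_data al chi) (H' : semi_data al' chi').

Lemma coprime_p2q : coprime (p ^ 2) q.
Proof. by rewrite coprimeXl // prime_coprime // dvdn_prime2 //; apply/eqP. Qed.

Lemma Fq_p2_eq0 (y : 'F_q) : y *+ p ^ 2 = 0 -> y = 0.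
Proof.
move=> yp; apply: mulrn_coprime_eq0 coprime_p2q yp _.
by rewrite -mulr_natr pchar_Fp_0 // mulr0.
Qed.

Lemma pair_mulrn (A B : zmodType) (x : A) (y : B) n : (x, y) *+ n = (x *+ n, y *+ n).
Proof. by elim: n => // n IH; rewrite !mulrS IH. Qed.

(** Since p^2 and q are coprime, an additive bijection respects both components: it is [f] on P and
    multiplication by some [c] on F_q. As 1 goes to [c], [al] corresponds to the [c]-th iterate of
    [al']. *)
Lemma semi_isoP :
  brace_iso (semi pq H) (semi pq H') <->
  exists f : P -> P',
    [/\ bijective f, {morph f : x y / x + y},
        forall x y, f (lam x y) = lam (f x) (f y) &
        (forall x, chi x = chi' (f x)) /\
        exists2 c : nat, ~~ (q %| c)%N & forall x, f (al x) = iter c al' (f x)].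
Proof.
rewrite brace_isoP; split=> [[F [[G FK GK] FD FL]]|[f [bf fD fL [fchi [c cq fal]]]]].
- have {}FD : {morph (F : P * 'F_q -> P' * 'F_q) : x y / x + y} by [].
  have {}FL (x y : P * 'F_q) : F (semi_lam al chi x y) = semi_lam al' chi' (F x) (F y).
    by have := FL x y; rewrite !lbrace_lam.
  have GD : {morph (G : P' * 'F_q -> P * 'F_q) : x y / x + y}.
    by move=> x y; apply: (can_inj FK); rewrite FD !GK.
  have addn (A B : zmodType) (h : A -> B) (hD : {morph h : x y / x + y}) n x :
      h (x *+ n) = h x *+ n.
    elim: n => [|n IH]; last by rewrite !mulrS hD IH.
    by apply: (addrI (h 0)); rewrite -hD !addr0.
  have FP x : (F (x, 0)).2 = 0.
    apply: Fq_p2_eq0; have := addn _ _ F FD (p ^ 2)%N (x, 0).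
    rewrite pair_mulrn Pp mul0rn (addn _ _ F FD 0 (0, 0)) mulr0n => /(congr1 snd).
    by case: (F _) => u v; rewrite pair_mulrn.
  have GP x : (G (x, 0)).2 = 0.
    apply: Fq_p2_eq0; have := addn _ _ G GD (p ^ 2)%N (x, 0).
    rewrite pair_mulrn P'p mul0rn (addn _ _ G GD 0 (0, 0)) mulr0n => /(congr1 snd).
    by case: (G _) => u v; rewrite pair_mulrn.
  have FQ y : (F (0, y)).1 = 0.
    apply: mulrn_coprime_eq0 coprime_p2q (P'p _) _.
    have := addn _ _ F FD q (0, y).
    rewrite pair_mulrn mul0rn -[y *+ q]mulr_natr pchar_Fp_0 // mulr0.
    rewrite (addn _ _ F FD 0 (0, 0)) mulr0n => /(congr1 fst).
    by case: (F _) => u v; rewrite pair_mulrn.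
  pose c := (F (0, 1)).2.
  have F01 : F (0, 1) = (0, c) by rewrite [LHS]surjective_pairing FQ.
  have Fx0 x : F (x, 0) = ((F (x, 0)).1, 0) by rewrite {1}[F _]surjective_pairing FP.
  have F00 : F (0, 0) = (0, 0) by exact: (addn _ _ F FD 0 (0, 0)).
  have lam0l (b : P * 'F_q) : semi_lam al chi (0, 1) b = (al b.1, b.2).
    by case: b => u v; rewrite semi_lamE lam1 (sd_chi0 H) mul1r (iter_Fp 1 u pq (sd_alq H)).
  exists (fun x => (F (x, 0)).1); split.
  + exists (fun x => (G (x, 0)).1) => x.
      by rewrite -Fx0 FK.
    by rewrite -[X in F (_, X)](GP x) -surjective_pairing GK.
  + move=> x y; have -> : (x + y, 0 : 'F_q) = (x, 0) + (y, 0) by rewrite pair_addE addr0.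
    by rewrite FD.
  + move=> x y; have := FL (x, 0) (y, 0).
    rewrite {1}/semi_lam /= mulr0 => ->.
    by rewrite (Fx0 x).
  + split=> [x|].
      (* Comparing the actions on (0, 1) gives [chi x * c = chi' (f x) * c], and injectivity of [F]
         makes [c] nonzero. *)
      have := FL (x, 0) (0, 1); rewrite F01 {1}/semi_lam /= lamr0 mulr1 (Fx0 x).
      rewrite -[X in (0, X)]mulr1 -{1}[chi x]natr_Zp mulr_natl.
      have -> : (0 : P, 1 *+ chi x) = (0, 1 : 'F_q) *+ chi x by rewrite pair_mulrn mul0rn.
      rewrite (addn _ _ F FD) F01 pair_mulrn => /(congr1 snd) /=.
      rewrite -mulr_natl natr_Zp; apply: mulIf.
      apply/negP => /eqP c0; have : F (0, 1) = F (0, 0) by rewrite F01 F00 c0.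
      by move/(can_inj FK) => /(congr1 snd)/eqP; rewrite oner_eq0.
    exists c.
      rewrite -Fp_natr_eq0 // natr_Zp; apply/negP => /eqP c0.
      have : F (0, 1) = F (0, 0) by rewrite F01 F00 c0.
      by move/(can_inj FK) => /(congr1 snd)/eqP; rewrite oner_eq0.
    move=> x; have := FL (0, 1) (x, 0); rewrite lam0l /= => ->.
    by rewrite F01 /= lam1.
- have fi n x : f (iter n al x) = iter (c * n) al' (f x).
    by elim: n x => [|n IH] x; rewrite ?muln0 // iterS fal IH -iterD mulnS.
  have c0 : c%:R != 0 :> 'F_q by rewrite Fp_natr_eq0.
  exists (fun a : P * 'F_q => (f a.1, c%:R * a.2) : P' * 'F_q); split.
  + have [g fK gK] := bf.
    by exists (fun a : P' * 'F_q => (g a.1, c%:R^-1 * a.2) : P * 'F_q) => -[x y] /=;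
      rewrite ?fK ?gK ?mulKf ?mulVKf.
  + by move=> [x y] [x1 y1]; rewrite pair_addE /= fD mulrDr.
  + move=> [x y] [x1 y1]; rewrite !lbrace_lam.
    change ((f (lam x (iter y al x1)), c%:R * (chi x * y1)) =
      (lam (f x) (iter (c%:R * y)%R al' (f x1)), chi' (f x) * (c%:R * y1))).
    rewrite fL fi fchi mulrCA; congr (lam _ _, _).
    by rewrite -[in RHS](natr_Zp y) -natrM (iter_Fp _ _ pq (sd_alq H')).
Qed.

End SemiIso.

(** This lets the factor P found in a decomposition be replaced by its standard form. *)
Lemma semi_transport (q : nat) (pq : prime q) (P P' : leftBraceType)
    (al : P -> P) (chi : P -> 'F_q) (H : semi_data al chi) :
  brace_iso P P' ->
  exists (al' : P' -> P') (chi' : P' -> 'F_q) (H' : semi_data al' chi'),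
    brace_iso (semi pq H) (semi pq H').
Proof.
move=> /brace_isoP[f [[g fK gK] fD fL]].
have gD : {morph g : x y / x + y} by move=> x y; apply: (can_inj fK); rewrite fD !gK.
have gL x y : g (lam x y) = lam (g x) (g y) by apply: (can_inj fK); rewrite fL !gK.
have fi n x : f (iter n al x) = iter n (f \o al \o g) (f x).
  by elim: n => // n IH; rewrite !iterS -IH /= fK.
have H' : semi_data (f \o al \o g) (chi \o g).
  split=> /=.
  - by move=> x y /=; rewrite gD (sd_alD H) fD.
  - by move=> x y /=; rewrite gL (sd_al_lam H) fL.
  - by move=> x; rewrite -(gK x) -fi (sd_alq H).
  - by move=> x y; rewrite brace_mulE gD gL -brace_mulE (sd_chiM H).
  - by move=> x; apply: sd_chi_neq0 H _.
  - by case: (sd_triv H) => h; [left => x; rewrite h gK | right].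
exists (f \o al \o g), (chi \o g), H'; apply/brace_isoP.
exists (fun a : P * 'F_q => (f a.1, a.2) : P' * 'F_q); split.
- by exists (fun a : P' * 'F_q => (g a.1, a.2) : P * 'F_q) => -[x y] /=; rewrite ?fK ?gK.
- by move=> [x y] [x1 y1]; rewrite pair_addE /= fD.
- by move=> [x y] [x1 y1]; rewrite !lbrace_lam /semi_lam /= fL fi fK.
Qed.

(** * Decomposition of a brace of size p^2 q *)

Lemma expr_gcd_eq1 (R : pzRingType) (m n : nat) (x : R) :
  x ^+ m = 1 -> x ^+ n = 1 -> x ^+ gcdn m n = 1.
Proof.
case: m => [|m]; first by rewrite gcd0n.
move=> xm xn; case: (@egcdnP m.+1 n) => // u v e _.
have : x ^+ (u * m.+1) = x ^+ (v * n + gcdn m.+1 n) by rewrite e.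
by rewrite mulnC exprM xm expr1n exprD mulnC exprM xn expr1n mul1r.
Qed.

Lemma expr_coprime_eq1 (R : pzRingType) (m n : nat) (x : R) :
  coprime m n -> x ^+ m = 1 -> x ^+ n = 1 -> x = 1.
Proof. by move=> /eqP g1 xm xn; rewrite -[x]expr1 -g1 expr_gcd_eq1. Qed.

Lemma Fp_expr_pred (q : nat) (x : 'F_q) : prime q -> x != 0 -> x ^+ q.-1 = 1.
Proof.
move=> pq x0; apply: (mulIf x0); rewrite -exprSr mul1r prednK ?prime_gt0 //.
by have := expf_card x; rewrite (card_Fp pq).
Qed.

(** If p divides q - 1, then q > p, so q divides p + 1 and q = p + 1; the only consecutive primes
    are 2 and 3. Coprimality then kills every character of a group of order p^2 into F_q^*. *)
Lemma pm1_or_coprime (p q : nat) :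
  prime p -> prime q -> p <> q -> ~ (p = 2 /\ q = 3)%N -> (q %| p ^ 2 - 1)%N ->
  coprime (p ^ 2) q.-1.
Proof.
move=> pp pq npq n23 qp; rewrite coprimeXl // prime_coprime //; apply/negP => pq1.
have p1 := prime_gt1 pp; have q1 := prime_gt1 pq.
have pleq : (p <= q.-1)%N by apply: dvdn_leq => //; lia.
have : (q %| (p - 1) * (p + 1))%N by rewrite -[(_ * _)%N]subn_sqr exp1n.
rewrite Euclid_dvdM // => /orP[/dvdn_leq|/dvdn_leq]; first by lia.
move=> /(_ ltac:(lia)) qle; have qE : q = p.+1 by lia.
apply: n23; case: (even_prime pp) => [p2|op]; first by rewrite qE p2.
case: (even_prime pq) => [q2|]; first by lia.
by rewrite qE /= op.
Qed.

Section Decomposition.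
Variables (p q : nat) (P0 : zmodType).
Hypotheses (pp : prime p) (pq : prime q) (npq : p <> q) (n23 : ~ (p = 2 /\ q = 3)%N).
Hypotheses (P0n : has_size P0 (p ^ 2)) (P0p : forall x : P0, x *+ p ^ 2 = 0).
Hypothesis P0aut : ~~ (q %| p ^ 2 - 1)%N -> forall f : P0 -> P0,
  {morph f : x y / x + y} -> (forall x, iter q f x = x) -> forall x, f x = x.

Variables (L : P0 * 'F_q -> P0 * 'F_q -> P0 * 'F_q) (HL : is_lam L).

Notation D := (lbrace HL).

Let morph_mulrn (A A' : zmodType) (h : A -> A') (hD : {morph h : x y / x + y}) n x :
  h (x *+ n) = h x *+ n.
Proof.
elim: n => [|n IH]; last by rewrite !mulrS hD IH.
by apply: (addrI (h 0)); rewrite -hD !addr0.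
Qed.

Let u (a : D) (x : P0) : P0 := (L a (x, 0)).1.
Let k (a : D) : 'F_q := (L a (0, 1)).2.

Let L0 a : L a (0, 0) = (0, 0).
Proof. exact: (morph_mulrn (is_lamD HL a) 0 0). Qed.

Let LP a x : L a (x, 0) = (u a x, 0).
Proof.
rewrite [LHS]surjective_pairing; congr (_, _); apply: (Fq_p2_eq0 pp pq npq).
have := morph_mulrn (is_lamD HL a) (p ^ 2)%N (x, 0).
rewrite pair_mulrn P0p mul0rn L0 => /(congr1 snd).
by case: (L _ _) => v w; rewrite pair_mulrn.
Qed.

Let LQ1 a : L a (0, 1) = (0, k a).
Proof.
rewrite [LHS]surjective_pairing; congr (_, _).
apply: mulrn_coprime_eq0 (coprime_p2q pp pq npq) (P0p _) _.
have := morph_mulrn (is_lamD HL a) q (0, 1).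
rewrite pair_mulrn mul0rn pchar_Fp_0 // L0 => /(congr1 fst).
by case: (L _ _) => v w; rewrite pair_mulrn.
Qed.

Let LE a x y : L a (x, y) = (u a x, k a * y).
Proof.
have -> : (x, y) = (x, 0) + (0, 1) *+ y.
  by rewrite pair_mulrn mul0rn natr_Zp pair_addE addr0 add0r.
rewrite (is_lamD HL) (morph_mulrn (is_lamD HL a)) LP LQ1 pair_mulrn mul0rn pair_addE.
by rewrite addr0 add0r -mulr_natr natr_Zp.
Qed.

Let uD a : {morph u a : x y / x + y}.
Proof.
move=> x y; rewrite /u; have -> : (x + y, 0 : 'F_q) = (x, 0) + (y, 0) by rewrite pair_addE addr0.
by rewrite (is_lamD HL).
Qed.

Let mulE (a b : D) : (a * b)%g = a + L a b :> D.
Proof. by []. Qed.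

Let uM (a b : D) x : u (a * b)%g x = u a (u b x).
Proof. by rewrite /u mulE (is_lamM HL) LP LP. Qed.

Let kM (a b : D) : k (a * b)%g = k a * k b.
Proof. by rewrite /k mulE (is_lamM HL) LQ1 LE. Qed.

Let u0 x : u 0 x = x. Proof. by rewrite /u (is_lam0 HL). Qed.
Let k0 : k 0 = 1. Proof. by rewrite /k (is_lam0 HL). Qed.

Let k_neq0 a : k a != 0.
Proof.
apply/eqP => ka; have := kM a a^-1%g.
by rewrite mulgV brace_one k0 ka mul0r => /eqP; rewrite oner_eq0.
Qed.

Let u_0 a : u a 0 = 0. Proof. by rewrite /u L0. Qed.

Let mulQ y y' : (((0, y) : D) * ((0, y') : D))%g = (0, y + k (0, y) * y') :> D.
Proof. by rewrite mulE LE u_0 pair_addE addr0. Qed.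

Let lQ (y y' : 'F_q) := k (0, y) * y'.

(** The restriction to F_q is a brace of size q, so Lagrange's theorem applies to its circle
    group. *)
Let lQ_is_lam : is_lam lQ.
Proof.
split=> [y y1 y2|y y1 y2|y|y]; rewrite /lQ.
- by rewrite mulrDr.
- by rewrite -mulQ kM mulrA.
- by rewrite k0 mul1r.
- by exists (- (y / k (0, y))); rewrite mulrN mulrCA mulfV // mulr1 subrr.
Qed.

(** Lagrange gives [k (0, y) ^+ q = 1], while every element of F_q is its own q-th power. *)
Let kQ y : k (0, y) = 1.
Proof.
have Fqn : has_size (lbrace lQ_is_lam) q by have := has_size_fin 'F_q; rewrite card_Fp.
have kX n : k (0, (((y : lbrace lQ_is_lam) ^+ n)%g : 'F_q)) = k (0, y) ^+ n.
  elim: n => [|n IH]; first by rewrite expg0 brace_one k0.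
  by rewrite expgS exprS -IH -kM mulQ.
have kq : k (0, y) ^+ q = 1 by rewrite -kX (has_size_expg Fqn) brace_one k0.
by have := expf_card (k (0, y)); rewrite card_Fp // kq.
Qed.

Let uQD y y' x : u (0, y + y') x = u (0, y) (u (0, y') x).
Proof. by rewrite -uM mulQ kQ mul1r. Qed.

Let al := u (0, 1).

Let uN n x : u (0, n%:R) x = iter n al x.
Proof. by elim: n => [|n IH]; [rewrite u0 | rewrite mulrS uQD IH]. Qed.

Let uQ (y : 'F_q) x : u (0, y) x = iter y al x.
Proof. by rewrite -uN natr_Zp. Qed.

Let alq x : iter q al x = x.
Proof. by rewrite -uN pchar_Fp_0 // u0. Qed.

Let lP x x' := u (x, 0) x'.

Let mulP x x' : (((x, 0) : D) * ((x', 0) : D))%g = (x + lP x x', 0) :> D.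
Proof. by rewrite mulE LP pair_addE addr0. Qed.

Let lP_is_lam : is_lam lP.
Proof.
split=> [x x1 x2|x x1 x2|x|x]; rewrite /lP.
- exact: uD.
- by rewrite -mulP uM.
- exact: u0.
- have [[x' y'] /eqP] := is_lamV HL (x, 0); rewrite LE pair_addE => e.
  by exists x'; have /(congr1 fst) /= -> := e.
Qed.

Notation P := (lbrace lP_is_lam).

Let chi (x : P) := k (x, 0).

Let chiM (x y : P) : chi (x * y)%g = chi x * chi y.
Proof. by rewrite /chi -kM mulP. Qed.

(** Each element is a circle product of one of P and one of F_q, so [L] is known once it is known on
    these two. *)
Let mul_xy (x : P0) (y : 'F_q) :
  (((x, 0) : D) * ((0, (y / k (x, 0))%R) : D))%g = (x, y) :> D.
Proof.
rewrite mulE LE u_0 pair_addE addr0 add0r mulrCA mulfV; last exact: k_neq0.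
by rewrite mulr1.
Qed.

(** If q does not divide p^2 - 1, an additive map of order dividing q is trivial on P. Otherwise the
    values of [chi] have order dividing the coprime numbers p^2 and q - 1. *)
Let al_triv : (forall x, al x = x) \/ (forall x, chi x = 1).
Proof.
have [qp|nqp] := boolP (q %| p ^ 2 - 1)%N; last by left; exact: (P0aut nqp (uD (0, 1)) alq).
right=> x; apply: expr_coprime_eq1 (pm1_or_coprime pp pq npq n23 qp) _ _.
  have Pn : has_size P (p ^ 2) by [].
  have chiX n : chi (x ^+ n)%g = chi x ^+ n.
    elim: n => [|n IH]; first by rewrite expg0 brace_one; apply: k0.
    by rewrite expgS exprS -IH chiM.
  by rewrite -chiX (has_size_expg Pn) brace_one; apply: k0.
exact: (Fp_expr_pred pq (k_neq0 _)).
Qed.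

Let al_lam (x y : P) : al (lam x y) = lam (al x : P) (al y : P).
Proof.
rewrite !lbrace_lam /lP /al -uM.
have [al1|chi1] := al_triv.
  rewrite -/al !al1 mulE LE mulr0 pair_addE addr0 add0r -/al al1.
  rewrite -mul_xy uM uQ.
  by have -> : iter (1 / k (x, 0))%R al y = y by elim: (nat_of_ord _) => //= n ->.
(* With trivial [chi], moving 1 past x in the circle group replaces x by [al x]; applying [u] to
   both sides gives the compatibility. *)
have e : (((0, 1%R) : D) * ((x, 0) : D))%g = (((al x, 0) : D) * ((0, 1%R) : D))%g.
  rewrite !mulE !LE mulr0 mulr1 u_0 !pair_addE !addr0 !add0r.
  by rewrite -[k _]/(chi (al x)) chi1.
by rewrite -uM e.
Qed.

Let data : @semi_data q P al chi.
Proof. by split=> //; [exact: uD | move=> x; apply: k_neq0]. Qed.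

Lemma semi_decomposition :
  exists (l : P0 -> P0 -> P0) (Hl : is_lam l) (al : lbrace Hl -> lbrace Hl)
      (chi : lbrace Hl -> 'F_q) (H : semi_data al chi),
    brace_iso (lbrace HL) (semi pq H).
Proof.
exists lP, lP_is_lam, al, chi, data; apply/brace_isoP; exists id.
split=> //; first by exists id.
move=> [x y] [x' y']; rewrite !lbrace_lam LE semi_lamE lbrace_lam.
have -> : k (x, y) = chi x by rewrite -mul_xy kM kQ mulr1.
congr (_, _); rewrite -mul_xy uM uQ; congr (u _ _).
(* The two iteration counts are [y / chi x] and [y]: immaterial for trivial [al], equal for trivial
   [chi]. *)
have [al1|chi1] := al_triv.
  by have i1 n z : iter n al z = z; [elim: n => //= n -> | rewrite !i1].
by rewrite -/(chi x) chi1 divr1.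
Qed.

End Decomposition.

(** * Two by two matrices *)

Definition row2 (R : Type) (a b : R) : 'rV[R]_2 := \row_j (if j == 0 then a else b).
Definition mx2 (R : Type) (a b c d : R) : 'M[R]_2 :=
  \matrix_(i, j) (if i == 0 then (if j == 0 then a else b) else (if j == 0 then c else d)).

Section Matrix2.
Variable R : comNzRingType.
Implicit Types (a b c d : R) (A B : 'M[R]_2) (x y : 'rV[R]_2).

Lemma ord2E (i : 'I_2) : (i = 0) \/ (i = 1).
Proof. by case: i => [[|[|]]] // ?; [left | right]; apply: val_inj. Qed.

Lemma rowP2 x y : x 0 0 = y 0 0 -> x 0 1 = y 0 1 -> x = y.
Proof. by move=> e0 e1; apply/rowP => j; case: (ord2E j) => ->. Qed.

Lemma matrixP2 A B : A 0 0 = B 0 0 -> A 0 1 = B 0 1 -> A 1 0 = B 1 0 -> A 1 1 = B 1 1 -> A = B.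
Proof.
by move=> *; apply/matrixP => i j; case: (ord2E i) => ->; case: (ord2E j) => ->.
Qed.

Lemma row2K x : row2 (x 0 0) (x 0 1) = x.
Proof. by apply: rowP2; rewrite mxE. Qed.

Lemma mx2K A : mx2 (A 0 0) (A 0 1) (A 1 0) (A 1 1) = A.
Proof. by apply: matrixP2; rewrite mxE. Qed.

Lemma mulmx2E m (B : 'M[R]_(m, 2)) n (C : 'M[R]_(2, n)) i j :
  (B *m C) i j = B i 0 * C 0 j + B i 1 * C 1 j.
Proof.
rewrite mxE big_ord_recl big_ord1; congr (_ + B _ _ * C _ _); exact: val_inj.
Qed.

Lemma mul_mx2 a b c d a' b' c' d' :
  mx2 a b c d *m mx2 a' b' c' d' =
  mx2 (a * a' + b * c') (a * b' + b * d') (c * a' + d * c') (c * b' + d * d').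
Proof. by apply: matrixP2; rewrite mulmx2E !mxE. Qed.

Lemma det_mx2E A : \det A = A 0 0 * A 1 1 - A 0 1 * A 1 0.
Proof.
rewrite (expand_det_row _ 0) big_ord_recl big_ord1 /cofactor !det_mx11 !mxE /=.
rewrite expr0 mul1r expr1 mulN1r mulrN; congr (_ * A _ _ - A _ _ * A _ _); exact: val_inj.
Qed.

Lemma det_mx2 a b c d : \det (mx2 a b c d) = a * d - b * c.
Proof. by rewrite det_mx2E !mxE. Qed.

Lemma Cayley_Hamilton2 A : A *m A = \tr A *: A - (\det A)%:M.
Proof.
have trA : \tr A = A 0 0 + A 1 1.
  by rewrite /mxtrace big_ord_recl big_ord1; congr (_ + A _ _); exact: val_inj.
by apply: matrixP2; rewrite mulmx2E trA det_mx2E !mxE /= ?mulr1n ?mulr0n; ring.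
Qed.

End Matrix2.

(** The determinant vanishes, so Cayley-Hamilton gives K^2 = tr(K) K and K^(m+1) = tr(K)^m K;
    nilpotency then kills K or its trace. *)
Lemma nilpotent_mx2 (F : fieldType) (K : 'M[F]_2) n : K ^+ n = 0 -> K *m K = 0.
Proof.
move=> Kn; have detX m : \det (K ^+ m) = \det K ^+ m.
  by elim: m => [|m IH]; [rewrite !expr0 det1 | rewrite !exprS det_mulmx IH].
have /eqP : \det K ^+ n = 0 by rewrite -detX Kn det_mx2E !mxE mul0r subrr.
rewrite expf_eq0 => /andP[_ /eqP det0].
have KK : K *m K = \tr K *: K by rewrite Cayley_Hamilton2 det0 raddf0 subr0.
have KX m : K ^+ m.+1 = \tr K ^+ m *: K.
  elim: m => [|m IH]; first by rewrite !expr1 expr0 scale1r.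
  by rewrite exprS IH -scalerAr -[K * K]/(K *m K) KK scalerA exprSr.
have [->|K0] := eqVneq K 0; first by rewrite mul0mx.
have : K ^+ n.+1 = 0 by rewrite exprS Kn mulr0.
rewrite KX => /eqP; rewrite scaler_eq0 (negbTE K0) orbF expf_eq0 => /andP[_ /eqP t0].
by rewrite KK t0 scale0r.
Qed.

(** * Additive maps *)

Lemma additive_Zp (n : nat) (f : 'Z_n -> 'Z_n) (x : 'Z_n) :
  {morph f : x y / x + y} -> f x = f 1 * x.
Proof.
move=> fD; have f0 : f 0 = 0 by apply: (addrI (f 0)); rewrite -fD !addr0.
have fn m : f m%:R = f 1 * m%:R.
  by elim: m => [|m IH]; [rewrite mulr0 | rewrite mulrS fD IH mulrDr mulr1].
by rewrite -[x]natr_Zp fn.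
Qed.

Lemma additive_Fp_rV (p n : nat) (f : 'rV['F_p]_n -> 'rV['F_p]_n) (x : 'rV['F_p]_n) :
  {morph f : x y / x + y} -> f x = x *m lin1_mx f.
Proof.
move=> fD; have f0 : f 0 = 0 by apply: (addrI (f 0)); rewrite -fD !addr0.
have fn m y : f (y *+ m) = f y *+ m.
  by elim: m => [|m IH]; [rewrite !mulr0n f0 | rewrite !mulrS fD IH].
have fZ (a : 'F_p) y : f (a *: y) = a *: f y.
  by rewrite -[a]natr_Zp !scaler_nat fn.
rewrite {1}[x]row_sum_delta (big_morph f fD f0) mulmx_sum_row.
apply: eq_bigr => i _; rewrite fZ; congr (_ *: _).
by apply/rowP => j; rewrite !mxE.
Qed.

Lemma iter_mulmx (R : pzSemiRingType) n (A : 'M[R]_n.+1) m (x : 'rV[R]_n.+1) :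
  iter m (fun x => x *m A) x = x *m A ^+ m.
Proof.
elim: m => [|m IH]; first by rewrite expr0 mulmx1.
by rewrite iterS IH exprSr mulmxA.
Qed.

Lemma mulmx_rV_inj (R : pzSemiRingType) m n (A B : 'M[R]_(m, n)) :
  (forall x : 'rV_m, x *m A = x *m B) -> A = B.
Proof. by move=> AB; apply/row_matrixP => i; rewrite !rowE. Qed.

Section AutOrder.
Variables (p q : nat).
Hypotheses (pp : prime p) (pq : prime q) (npq : p <> q).

Lemma p2_gt1 : (1 < p ^ 2)%N.
Proof. by rewrite -(exp1n 2) ltn_exp2r // prime_gt1. Qed.

Lemma Zp2_p2 : (p ^ 2)%:R = 0 :> 'Z_(p ^ 2).
Proof. exact: pchar_Zp p2_gt1. Qed.

Lemma Zp2_mulrn (x : 'Z_(p ^ 2)) : x *+ p ^ 2 = 0.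
Proof. by rewrite -mulr_natr Zp2_p2 mulr0. Qed.

Lemma rV_mulrn (x : 'rV['F_p]_2) : x *+ p ^ 2 = 0.
Proof. by rewrite -scaler_nat natrX pchar_Fp_0 // expr0n scale0r. Qed.

Lemma has_size_Zp2 : has_size ('Z_(p ^ 2)) (p ^ 2).
Proof. by have := has_size_fin ('Z_(p ^ 2)); rewrite card_ord Zp_cast // p2_gt1. Qed.

Lemma has_size_rV2 : has_size 'rV['F_p]_2 (p ^ 2).
Proof. by have := has_size_fin 'rV['F_p]_2; rewrite card_mx card_Fp. Qed.

(** The second number is the order of GL_2(F_p). *)
Lemma coprime_pred (n23 : ~~ (q %| p ^ 2 - 1)%N) : coprime q (p * p.-1 ^ 2 * p.+1).
Proof.
have p1 := prime_gt1 pp.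
have : ~~ (q %| (p.-1 * p.+1))%N.
  by rewrite -(subn1 p) -(addn1 p) -subn_sqr exp1n.
rewrite Euclid_dvdM // negb_or => /andP[q1 q2].
rewrite !coprimeMr !prime_coprime // q1 q2 !andbT dvdn_prime2 //.
by rewrite eq_sym; apply/eqP.
Qed.

Lemma Zp2_unit_order (c : 'Z_(p ^ 2)) : c ^+ q = 1 -> ~~ (q %| p.-1)%N -> c = 1.
Proof.
move=> cq q1; have p1 := p2_gt1.
have uc : c \is a GRing.unit by rewrite -(unitrX_pos _ (prime_gt0 pq)) cq unitr1.
apply: (@expr_coprime_eq1 _ q (totient (p ^ 2))) => //.
  rewrite totient_pfactor // coprimeMr expn1 !prime_coprime // q1.
  by rewrite dvdn_prime2 // eq_sym; apply/eqP.
rewrite -[c]natr_Zp -natrX; rewrite -[c]natr_Zp unitZpE // coprime_sym in uc.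
by rewrite -(Zp_nat_mod p1) Euler_exp_totient // Zp_nat_mod.
Qed.

Lemma Zp2_aut : ~~ (q %| p ^ 2 - 1)%N -> forall f : 'Z_(p ^ 2) -> 'Z_(p ^ 2),
  {morph f : x y / x + y} -> (forall x, iter q f x = x) -> forall x, f x = x.
Proof.
move=> n23 f fD fq x; rewrite additive_Zp // [f 1]Zp2_unit_order ?mul1r //.
  suff <- n : iter n f 1 = f 1 ^+ n by apply: fq.
  by elim: n => // n IH; rewrite iterS exprS -IH additive_Zp.
have e : (p ^ 2 - 1 = p.-1 * (p + 1))%N by rewrite -subn1 -subn_sqr exp1n.
by move: n23; rewrite e; apply: contra => /dvdn_mulr->.
Qed.

Lemma rV2_order (M : 'M['F_p]_2) : M ^+ q = 1 -> ~~ (q %| p ^ 2 - 1)%N -> M = 1.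
Proof.
move=> Mq n23.
have uM : M \in unitmx.
  by change (M \is a GRing.unit); rewrite -(unitrX_pos _ (prime_gt0 pq)) Mq unitr1.
apply: (expr_coprime_eq1 (coprime_pred n23) Mq).
pose g : {'GL_2['F_p]} := Sub (M : 'M_2.-1.+1) uM.
have gX n : GLval (g ^+ n)%g = M ^+ n.
  by elim: n => // n IH; rewrite expgS exprS -IH.
have := expg_cardG (in_setT g).
by rewrite card_GL_2 card_Fp // => /(congr1 GLval); rewrite gX.
Qed.

Lemma rV2_aut : ~~ (q %| p ^ 2 - 1)%N -> forall f : 'rV['F_p]_2 -> 'rV['F_p]_2,
  {morph f : x y / x + y} -> (forall x, iter q f x = x) -> forall x, f x = x.
Proof.
move=> n23 f fD fq x; rewrite additive_Fp_rV // (@rV2_order (lin1_mx f)) ?mulmx1 //.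
apply: mulmx_rV_inj => y; rewrite mulmx1 -[RHS]fq -iter_mulmx.
by apply: eq_iter => z; rewrite [RHS]additive_Fp_rV.
Qed.

End AutOrder.

(** * Braces of size p^2 *)

Definition cyc_lam (p : nat) (k : bool) (x y : 'Z_(p ^ 2)) : 'Z_(p ^ 2) :=
  (1 + (p * k)%:R * x) * y.

Definition elem_lam (p : nat) (k : bool) (x y : 'rV['F_p]_2) : 'rV['F_p]_2 :=
  row2 (y 0 0 + k%:R * x 0 1 * y 0 1) (y 0 1).

Section StandardBraces.
Variables (p : nat) (pp : prime p).

Lemma Zp2_sqr_p (k : nat) : (p * k)%:R * (p * k)%:R = 0 :> 'Z_(p ^ 2).
Proof.
by rewrite -natrM mulnACA -[(p * p)%N]/(p ^ 2)%N natrM Zp2_p2 // mul0r.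
Qed.

Lemma cyc_is_lam k : is_lam (@cyc_lam p k).
Proof.
split=> [x y z|x y z|x|x]; rewrite /cyc_lam; try ring.
(* The factor [1 - (p * k)%:R * x] inverts [1 + (p * k)%:R * x], because p^2 = 0. *)
exists (- x * (1 - (p * k)%:R * x)).
have -> : x + (1 + (p * k)%:R * x) * (- x * (1 - (p * k)%:R * x)) =
  x ^+ 3 * ((p * k)%:R * (p * k)%:R) by ring.
by rewrite Zp2_sqr_p mulr0.
Qed.

Lemma elem_is_lam k : is_lam (@elem_lam p k).
Proof.
split=> [x y z|x y z|x|x].
- by apply: rowP2; rewrite !mxE //=; ring.
- by apply: rowP2; rewrite !mxE //=; ring.
- by apply: rowP2; rewrite !mxE //=; ring.
- exists (row2 (k%:R * x 0 1 * x 0 1 - x 0 0) (- x 0 1)); apply/eqP.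
  by apply: rowP2; rewrite !mxE /=; ring.
Qed.

Definition cyc_brace k : leftBraceType := lbrace (cyc_is_lam k).
Definition elem_brace k : leftBraceType := lbrace (elem_is_lam k).

Lemma Fp_expr_p2 (a : 'F_p) : a ^+ (p ^ 2) = a.
Proof.
have := expf_card a; rewrite card_Fp // => ap.
by rewrite -[(p ^ 2)%N]/(p * p)%N exprM !ap.
Qed.

(** Commutativity of the circle group, evaluated at 1 and x, makes the multiplier [c] affine. Its
    value at 1 has p^2-th power 1, hence equals 1 + pm; rescaling by m normalises it unless p
    divides m. *)
Lemma cyc_classification (l : 'Z_(p ^ 2) -> 'Z_(p ^ 2) -> 'Z_(p ^ 2)) (Hl : is_lam l) :
  exists k, brace_iso (lbrace Hl) (cyc_brace k).
Proof.
pose B := lbrace Hl; pose c x := l x 1.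
have p1 := p2_gt1 pp.
have lE x y : l x y = c x * y by apply: additive_Zp; apply: (is_lamD Hl).
have Bn : has_size B (p ^ 2) := has_size_Zp2 pp.
have comm x y : x + l x y = y + l y x.
  exact: (@has_size_p2_commute B _ Bn p x y pp erefl).
have cX (x : B) n : c ((x ^+ n)%g : 'Z_(p ^ 2)) = c x ^+ n.
  elim: n => [|n IH]; first by rewrite expg0 brace_one /c (is_lam0 Hl).
  by rewrite expgS exprS -IH -[(x * _)%g]/(x + l x _) /c (is_lamM Hl) lE.
have cp x : c x ^+ (p ^ 2) = 1.
  by rewrite -(cX x) (has_size_expg Bn) brace_one /c (is_lam0 Hl).
have cE x : c x = 1 + (c 1 - 1) * x.
  by apply: (addrI x); have := comm 1 x; rewrite !lE mulr1 => <-; ring.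
have [m c1] : exists m : nat, c 1 = 1 + (p * m)%:R.
  set n : nat := c 1; have cn : c 1 = n%:R by rewrite natr_Zp.
  have n1 : (n %% p = 1)%N.
    have : n ^ (p ^ 2) = 1 %[mod p ^ 2].
      by rewrite -(val_Zp_nat p1) natrX -cn cp -[1]/(1%:R) val_Zp_nat.
    move/(congr1 (modn^~ p)); rewrite !modn_dvdm ?dvdn_exp //.
    rewrite -!(val_Fp_nat pp) => /val_inj; rewrite natrX Fp_expr_p2 => ->.
    by rewrite val_Fp_nat // modn_small // prime_gt1.
  by exists (n %/ p)%N; rewrite cn {1}(divn_eq n p) n1 natrD addrC mulnC.
have [pm|npm] := boolP (p %| m)%N.
  exists false; apply/brace_isoP; exists id; split=> //; first by exists id.
  move=> x y; rewrite !lbrace_lam lE cE c1 /cyc_lam muln0 mul0r addr0.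
  case/dvdnP: pm => a ->; rewrite mulnCA natrM -[(p * p)%N]/(p ^ 2)%N Zp2_p2 //.
  by rewrite mulr0 addr0 subrr mul0r addr0.
exists true; apply/brace_isoP; exists ( *%R m%:R); split.
- have um : (m%:R : 'Z_(p ^ 2)) \is a GRing.unit.
    by rewrite unitZpE // coprimeXl // prime_coprime.
  by exists ( *%R m%:R^-1); [apply: mulKr | apply: mulVKr].
- by move=> x y; rewrite mulrDr.
- move=> x y; rewrite !lbrace_lam lE cE c1 /cyc_lam muln1 natrM; ring.
Qed.

(** If some [M x0] is not 1, then [K = M x0 - 1] has square 0, and in the basis [e = w *m K], [w]
    each [M x] is unipotent with one unknown coefficient [a x]. Commutativity of the circle group
    makes [a] proportional to the [w]-coordinate. *)
Lemma elem_classification (l : 'rV['F_p]_2 -> 'rV['F_p]_2 -> 'rV['F_p]_2) (Hl : is_lam l) :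
  exists k, brace_iso (lbrace Hl) (elem_brace k).
Proof.
pose B := lbrace Hl; pose M x := lin1_mx (l x).
have lE x y : l x y = y *m M x by apply: additive_Fp_rV; apply: (is_lamD Hl).
have Bn : has_size B (p ^ 2) := has_size_rV2 pp.
have comm x y : x + l x y = y + l y x.
  exact: (@has_size_p2_commute B _ Bn p x y pp erefl).
have MM x y : M (x + l x y) = M y *m M x.
  by apply: mulmx_rV_inj => z; rewrite mulmxA -!lE (is_lamM Hl).
have M0 : M 0 = 1 by apply: mulmx_rV_inj => z; rewrite -lE (is_lam0 Hl) mulmx1.
have MX (x : B) n : M ((x ^+ n)%g : 'rV_2) = M x ^+ n.
  elim: n => [|n IH]; first by rewrite expg0 brace_one M0.
  by rewrite expgS exprSr -IH -[(x * _)%g]/(x + l x _) MM.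
have Mp x : M x ^+ (p ^ 2) = 1.
  by rewrite -(MX x) (has_size_expg Bn) brace_one M0.
have Mcomm x y : M x *m M y = M y *m M x by rewrite -!MM comm.
have [x0 Mx0|M1] := pickP (fun x => M x != 1); last first.
  exists false; apply/brace_isoP; exists id; split=> //; first by exists id.
  move=> x y; rewrite !lbrace_lam lE; have /negbFE/eqP -> := M1 x.
  by apply: rowP2; rewrite mulmx1 !mxE !mul0r ?addr0.
pose K := M x0 - 1.
have pM : p \in [pchar 'M['F_p]_2] by rewrite pchar_lalg pchar_Fp.
(* Frobenius is additive on commuting elements, so [M x0 ^+ (p ^ 2) = 1] turns into nilpotency of
   [K]. *)
have Fr (A : 'M['F_p]_2) : (1 + A) ^+ p = 1 + A ^+ p.
  rewrite -!(pFrobenius_autE pM) pFrobenius_autD_comm ?pFrobenius_aut1 //.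
  exact/commr_sym/commr1.
have KK : K *m K = 0.
  apply: (@nilpotent_mx2 _ _ (p ^ 2)%N); have := Mp x0.
  have -> : M x0 = 1 + K by rewrite addrC subrK.
  rewrite -[(p ^ 2)%N]/(p * p)%N !exprM !Fr => h.
  by apply: (addrI 1); rewrite h addr0.
have wK0 : exists w : 'rV_2, w *m K != 0.
  have [w w0|wK] := pickP (fun w : 'rV_2 => w *m K != 0); first by exists w.
  have K0 : K = 0 by apply: mulmx_rV_inj => w; rewrite mulmx0; have /negbFE/eqP := wK w.
  by move: Mx0; rewrite -subr_eq0 -/K K0 eqxx.
have [w wK] := wK0; pose e := w *m K.
have eK : e *m K = 0 by rewrite -mulmxA KK mulmx0.
pose T := mx2 (e 0 0) (e 0 1) (w 0 0) (w 0 1).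
have TE (v : 'rV_2) : v *m T = v 0 0 *: e + v 0 1 *: w.
  by apply: rowP2; rewrite mulmx2E !mxE.
have uT : T \in unitmx.
  rewrite unitmxE unitfE; apply/negP => /det0P[v v0]; rewrite TE => vT.
  have v1 : v 0 1 = 0.
    have := congr1 (mulmxr K) vT; rewrite /= mulmxDl -!scalemxAl eK scaler0 add0r mul0mx.
    by move/eqP; rewrite scaler_eq0 (negbTE wK) orbF => /eqP.
  move: vT; rewrite v1 scale0r addr0 => /eqP; rewrite scaler_eq0 (negbTE wK) orbF => /eqP v00.
  by case/eqP: v0; apply: rowP2; rewrite mxE.
pose co (v : 'rV_2) := v *m invmx T.
have coE v : v = co v 0 0 *: e + co v 0 1 *: w by rewrite -TE mulmxKV.
pose a x := co (w *m M x) 0 0.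
(* [M x] commutes with [K], so [e] and [w] get the same diagonal entry [b]; and b^(p^2) = 1 forces b
   = 1 in F_p. *)
have eMw x : e *m M x = e /\ w *m M x = a x *: e + w.
  pose b := co (w *m M x) 0 1.
  have wM : w *m M x = a x *: e + b *: w by apply: coE.
  have MK : M x *m K = K *m M x by rewrite mulmxBr mulmxBl Mcomm mulmx1 mul1mx.
  have eM : e *m M x = b *: e.
    by rewrite -mulmxA -MK mulmxA wM mulmxDl -!scalemxAl eK scaler0 add0r.
  have eMX n : e *m M x ^+ n = b ^+ n *: e.
    elim: n => [|n IH]; first by rewrite !expr0 mulmx1 scale1r.
    by rewrite exprSr -[_ * M x]/(_ *m M x) mulmxA IH -scalemxAl eM scalerA exprSr.
  have b1 : b = 1.
    have := eMX (p ^ 2)%N; rewrite Mp mulmx1 Fp_expr_p2 => /eqP.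
    rewrite -[X in X == _]scale1r -subr_eq0 -scalerBl scaler_eq0 (negbTE wK) orbF.
    by rewrite subr_eq0 eq_sym => /eqP.
  split.
    rewrite eM.
 rewrite b1.
 exact: scale1r.
  rewrite wM.
 rewrite b1.
 congr (_ + _).
 exact: scale1r.
pose k := a w.
(* The circle products of x and w in the two orders are compared; the [e]-coordinate carries the
   information. *)
have aE x : a x = co x 0 1 * k.
  move: (coE x); move: (co x 0 0) (co x 0 1) => s t xE.
  have := comm x w; rewrite (lE w x) (lE x w) [in RHS]xE mulmxDl -!scalemxAl.
  have [-> ->] := eMw w; have [_ ->] := eMw x; rewrite -/k => h.
  have : a x *: e = (t * k) *: e.
    apply: (addIr w); apply: (addrI x); rewrite h [in RHS]xE scalerDr scalerA.
    by rewrite [RHS]addrACA [LHS]addrC !addrA.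
  by move/eqP; rewrite -subr_eq0 -scalerBl scaler_eq0 (negbTE wK) orbF subr_eq0 => /eqP.
have k0 : k != 0.
  apply/eqP => k0; have ax0 : a x0 = 0 by rewrite aE k0 mulr0.
  have [_] := eMw x0; rewrite ax0 scale0r add0r => wM.
  by case/eqP: wK; rewrite mulmxBr mulmx1 wM subrr.
have lw x v : l x (v 0 0 *: e + v 0 1 *: w) = (v 0 0 + v 0 1 * a x) *: e + v 0 1 *: w.
  rewrite lE mulmxDl -!scalemxAl; have [-> ->] := eMw x.
  by rewrite scalerDr scalerA addrA -scalerDl.
have coK (v : 'rV_2) : co (v 0 0 *: e + v 0 1 *: w) = v by rewrite -TE /co mulmxK.
exists true; apply: brace_iso_sym; apply/brace_isoP.
(* Scaling the first coordinate by [k = a w] absorbs the constant left in [aE]. *)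
pose dil c (v : 'rV['F_p]_2) := row2 (v 0 0 * c) (v 0 1).
have dilK c : c != 0 -> cancel (dil c) (dil c^-1).
  by move=> c0 v; apply: rowP2; rewrite !mxE //= mulfK.
have dilVK c : c != 0 -> cancel (dil c^-1) (dil c).
  by move=> c0 v; apply: rowP2; rewrite !mxE //= mulfVK.
have dilD c : {morph dil c : x y / x + y}.
  by move=> x y; apply: rowP2; rewrite !mxE //= mulrDl.
exists (fun v => dil k v *m T); split.
- exists (fun v => dil k^-1 (co v)) => v /=.
    by rewrite /co mulmxK // dilK.
  by rewrite dilVK // /co mulmxKV.
- by move=> x y; rewrite dilD mulmxDl.
- move=> x y; rewrite !lbrace_lam /= [dil k y *m T]TE lw aE /co mulmxK // TE !mxE /=.
  by congr (_ *: _ + _); ring.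
Qed.

End StandardBraces.

(** * Reduction of the count to four orbit problems *)

Lemma lbrace_pullback (A : zmodType) (B : leftBraceType) (g : A -> B) :
  bijective g -> {morph g : x y / x + y} ->
  exists (l : A -> A -> A) (Hl : is_lam l), brace_iso B (lbrace Hl).
Proof.
move=> [h gK hK] gD; pose l a b := h (lam (g a) (g b)).
have hD : {morph h : x y / x + y} by move=> x y; apply: (can_inj gK); rewrite gD !hK.
have h0 : h 0 = 0 by apply: (addrI (h 0)); rewrite -hD !addr0.
have Hl : is_lam l.
  split=> [a b c|a b c|b|a]; rewrite /l.
  - by rewrite gD lamD hD.
  - by rewrite gD !hK -brace_mulE lamM.
  - by rewrite -[0]h0 hK lam1 gK.
  - exists (h (g a)^-1%g); rewrite hK -{1}[a]gK -hD -brace_mulE mulgV brace_one h0.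
    exact: eqxx.
exists l, Hl; apply: brace_iso_sym; apply/brace_isoP; exists g; split=> //.
- by exists h.
- by move=> x y; rewrite lbrace_lam /l hK.
Qed.

Lemma additive_inj (A B : zmodType) (f : A -> B) :
  {morph f : x y / x + y} -> (forall x, f x = 0 -> x = 0) -> injective f.
Proof.
move=> fD f0 x y fxy; apply/eqP; rewrite -subr_eq0; apply/eqP/f0.
by apply: (addIr (f y)); rewrite -fD subrK add0r.
Qed.

Lemma mulrn_modn (A : zmodType) (n m : nat) (x : A) : x *+ n = 0 -> x *+ (m %% n) = x *+ m.
Proof. by move=> xn; rewrite {2}(divn_eq m n) mulrnDr mulnC mulrnA xn mul0rn add0r. Qed.

Lemma mulrn_Zp (A : zmodType) (n : nat) (x : A) :
  (1 < n)%N -> x *+ n = 0 -> {morph (fun m : 'Z_n => x *+ m) : a b / a + b}.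
Proof.
move=> n1 xn a b; change (x *+ (a + b)%R = x *+ a + x *+ b).
by rewrite -{1}[a]natr_Zp -{1}[b]natr_Zp -natrD val_Zp_nat // mulrn_modn // mulrnDr.
Qed.

Lemma mulrn_Fp (A : zmodType) (p : nat) (x : A) :
  prime p -> x *+ p = 0 -> {morph (fun m : 'F_p => x *+ m) : a b / a + b}.
Proof.
move=> pp xn a b; change (x *+ (a + b)%R = x *+ a + x *+ b).
by rewrite -{1}[a]natr_Zp -{1}[b]natr_Zp -natrD val_Fp_nat // mulrn_modn // mulrnDr.
Qed.

Lemma Fp_eq0 (p : nat) (a : 'F_p) : prime p -> (a == 0) = (p %| a)%N.
Proof. by move=> pp; rewrite -[in LHS](natr_Zp a) Fp_natr_eq0. Qed.

Definition brace_aut (P : leftBraceType) (f : P -> P) :=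
  [/\ bijective f, {morph f : x y / x + y} &
      forall x y, f (lam x y) = lam (f x) (f y)].

Section Reduction.
Variables (p q : nat).
Hypotheses (pp : prime p) (pq : prime q) (npq : p <> q).

Definition std_brace (s : bool * bool) : leftBraceType :=
  if s.1 then cyc_brace pp s.2 else elem_brace p s.2.

Lemma std_brace_size s : has_size (std_brace s) (p ^ 2).
Proof. by case: s => [[] k]; [apply: has_size_Zp2 | apply: has_size_rV2]. Qed.

Lemma std_brace_mulrn s (x : std_brace s) : x *+ p ^ 2 = 0.
Proof. by case: s x => [[] k] x; [apply: Zp2_mulrn | apply: rV_mulrn]. Qed.

Lemma brace_iso_lam_triv (B C : leftBraceType) : brace_iso B C ->
  (forall x y : B, lam x y = y) -> forall x y : C, lam x y = y.
Proof.
move=> /brace_isoP[f [[g fK gK] fD fL]] triv x y.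
by rewrite -[x]gK -[y]gK -fL triv.
Qed.

Lemma brace_iso_mulrn0 (B C : leftBraceType) n : brace_iso B C ->
  (forall x : B, x *+ n = 0) -> forall x : C, x *+ n = 0.
Proof.
move=> /brace_isoP[f [[g fK gK] fD fL]] triv x.
have f0 : f 0 = 0 by apply: (addrI (f 0)); rewrite -fD !addr0.
rewrite -[x]gK; suff -> : f (g x) *+ n = f (g x *+ n) by rewrite triv.
by elim: n {triv} => [|n IH]; rewrite ?mulr0n ?f0 // !mulrS fD IH.
Qed.

Lemma cyc_brace_mulrnp k : exists x : cyc_brace pp k, x *+ p != 0.
Proof.
exists (1 : 'Z_(p ^ 2)).
have p1 := prime_gt1 pp; have p21 := p2_gt1 pp.
apply/eqP => /(congr1 (@nat_of_ord _)); rewrite val_Zp_nat // modn_small.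
  by move=> p0; rewrite p0 in p1.
by rewrite -{1}(expn1 p) ltn_exp2l.
Qed.

Lemma cyc_brace_trivP k : (forall x y : cyc_brace pp k, lam x y = y) <-> k = false.
Proof.
split=> [triv|-> x y]; last by rewrite lbrace_lam /cyc_lam muln0 mul0r addr0 mul1r.
case: k triv => // triv; have [x /eqP[]] := cyc_brace_mulrnp true.
have := triv x 1; rewrite lbrace_lam /cyc_lam muln1 mulr1 mulrC mulr_natr.
by rewrite -[RHS]addr0 => /addrI.
Qed.

Lemma elem_brace_mulrnp k (x : elem_brace p k) : x *+ p = 0.
Proof.
change ((x : 'rV['F_p]_2) *+ p = 0).
by rewrite -scaler_nat pchar_Fp_0 // scale0r.
Qed.

Lemma elem_brace_trivP k : (forall x y : elem_brace p k, lam x y = y) <-> k = false.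
Proof.
split=> [triv|-> x y]; last first.
  by rewrite lbrace_lam; apply: rowP2; rewrite !mxE //= !mul0r addr0.
case: k triv => // triv; have := triv (row2 0 1) (row2 0 1).
rewrite lbrace_lam => /(congr1 (fun v : 'rV['F_p]_2 => v 0 0)); rewrite !mxE /= !mulr1 add0r.
by move/eqP; rewrite oner_eq0.
Qed.

(** Two invariants separate the four braces: whether p kills the additive group, and whether the
    lambda map is trivial. *)
Lemma std_brace_iso s t : brace_iso (std_brace s) (std_brace t) -> s = t.
Proof.
case: s t => [[] k] [[] l] st; have ts := brace_iso_sym st.
- have : k = false <-> l = false.
    rewrite -cyc_brace_trivP -[l = _]cyc_brace_trivP.
    by split; [apply: brace_iso_lam_triv st | apply: brace_iso_lam_triv ts].
  by case: k l {st ts} => [] [] // [h1 h2]; [have := h2 erefl | have := h1 erefl].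
- have [x /eqP[]] := cyc_brace_mulrnp k.
  exact: (brace_iso_mulrn0 ts (@elem_brace_mulrnp l)).
- have [x /eqP[]] := cyc_brace_mulrnp l.
  exact: (brace_iso_mulrn0 st (@elem_brace_mulrnp k)).
- have : k = false <-> l = false.
    rewrite -elem_brace_trivP -[l = _]elem_brace_trivP.
    by split; [apply: brace_iso_lam_triv st | apply: brace_iso_lam_triv ts].
  by case: k l {st ts} => [] [] // [h1 h2]; [have := h2 erefl | have := h1 erefl].
Qed.

Definition is_semi (s : bool * bool) (B : leftBraceType) :=
  exists (al : std_brace s -> std_brace s) (chi : std_brace s -> 'F_q)
    (H : semi_data al chi), brace_iso B (semi pq H).

Lemma semi_size s al chi (H : @semi_data q (std_brace s) al chi) :
  has_size (semi pq H) (p ^ 2 * q).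
Proof.
have [f [g fK gK]] := std_brace_size s.
have := has_size_fin ('I_(p ^ 2) * 'F_q)%type; rewrite card_prod card_ord card_Fp //.
apply: (@has_size_bij _ (std_brace s * 'F_q)%type _ (fun a => (f a.1, a.2))).
by exists (fun a => (g a.1, a.2)) => -[x y] /=; rewrite ?fK ?gK.
Qed.

Lemma has_size_iso (B C : leftBraceType) n : brace_iso B C -> has_size C n -> has_size B n.
Proof. by move=> /brace_iso_sym [f [fb _ _]]; exact: has_size_bij fb. Qed.

Hypothesis n23 : ~ (p = 2 /\ q = 3)%N.

(** The generators yield an additive bijection from a standard group; the brace is pulled back along
    it and decomposed, and its factor P is put in standard form. *)
Lemma is_semiP (B : leftBraceType) :
  has_size B (p ^ 2 * q) <-> exists s, is_semi s B.
Proof.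
split=> [Bn|[s [al [chi [H BH]]]]]; last exact: has_size_iso BH (semi_size H).
have [[v vn] gens] := zmod_p2q_generators pp pq npq Bn.
have vq : v *+ q = 0 by apply/eqP; rewrite vn.
have cqp : coprime (p ^ 2) q := coprime_p2q pp pq npq.
have sz : has_size 'F_q q by have := has_size_fin 'F_q; rewrite card_Fp.
case: gens => [[u un]|[u1 [u2 un]]].
- have up : u *+ p ^ 2 = 0 by apply/eqP; rewrite un.
  pose g (a : 'Z_(p ^ 2) * 'F_q) := u *+ a.1 + v *+ a.2.
  have gD : {morph g : a b / a + b}.
    move=> [a b] [a' b']; rewrite pair_addE /g [_.1]/(a + a') [_.2]/(b + b').
    by rewrite (mulrn_Zp (p2_gt1 pp) up) (mulrn_Fp pq vq) addrACA.
  have g0 a : g a = 0 -> a = 0.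
    case: a => a b; rewrite /g /= => ab.
    (* Multiplying the relation by q removes the [v] term, and q is invertible modulo p^2. *)
    have : u *+ (a * q) == 0.
      move: (congr1 (fun x => x *+ q) ab); rewrite mulrnDl -!mulrnA mul0rn => <-.
      by rewrite [in X in _ == _ + X]mulnC [in X in _ == _ + X]mulrnA vq mul0rn addr0.
    rewrite un Gauss_dvdl // => ap.
    have a0 : a = 0 by rewrite -[a]natr_Zp; case/dvdnP: ap => m ->; rewrite natrM Zp2_p2 // mulr0.
    move: ab; rewrite a0 mulr0n add0r => /eqP; rewrite vn -Fp_eq0 // => /eqP -> //.
  have gb : bijective g.
    apply: (has_size_inj_bij _ Bn (additive_inj gD g0)).
    have := has_size_fin ('Z_(p ^ 2) * 'F_q)%type.
    have cZ : #|'Z_(p ^ 2)| = (p ^ 2)%N by rewrite card_ord (Zp_cast (p2_gt1 pp)).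
    by rewrite card_prod cZ card_Fp.
  have [l [Hl Biso]] := lbrace_pullback gb gD.
  have [l' [Hl' [al [chi [H iso]]]]] :=
    semi_decomposition pp pq npq n23 (has_size_Zp2 pp) (Zp2_mulrn pp) (Zp2_aut pp pq npq) Hl.
  have [k Piso] := cyc_classification pp Hl'.
  have [al' [chi' [H' iso']]] := semi_transport pq H Piso.
  exists (true, k), al', chi', H'.
  exact: brace_iso_trans Biso (brace_iso_trans iso iso').
- have up1 : u1 *+ p = 0 by apply/eqP; have := un p 0; rewrite mulr0n addr0 dvdnn dvdn0.
  have up2 : u2 *+ p = 0 by apply/eqP; have := un 0 p; rewrite mulr0n add0r dvdnn dvdn0.
  pose g (a : 'rV['F_p]_2 * 'F_q) := u1 *+ a.1 0 0 + u2 *+ a.1 0 1 + v *+ a.2.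
  have gD : {morph g : a b / a + b}.
    move=> [a b] [a' b']; rewrite pair_addE /g [_.1]/(a + a') [_.2]/(b + b') !mxE.
    rewrite (mulrn_Fp pp up1) (mulrn_Fp pp up2) (mulrn_Fp pq vq) /=.
    by rewrite [u1 *+ _ + _ + _]addrACA [LHS]addrACA.
  have g0 a : g a = 0 -> a = 0.
    case: a => a b; rewrite /g /= => ab.
    have : u1 *+ (a 0 0 * q) + u2 *+ (a 0 1 * q) == 0.
      move: (congr1 (fun x => x *+ q) ab); rewrite !mulrnDl -!mulrnA mul0rn => <-.
      by rewrite [in X in _ == _ + X]mulnC [in X in _ == _ + X]mulrnA vq mul0rn addr0.
    have cq : coprime p q by rewrite prime_coprime // dvdn_prime2 //; apply/eqP.
    rewrite un !Gauss_dvdl // -!Fp_eq0 // => /andP[/eqP a0 /eqP a1].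
    have -> : a = 0 by apply: rowP2; rewrite mxE.
    move: ab; rewrite a0 a1 !mulr0n !add0r => /eqP; rewrite vn -Fp_eq0 // => /eqP -> //.
  have gb : bijective g.
    apply: (has_size_inj_bij _ Bn (additive_inj gD g0)).
    have := has_size_fin ('rV['F_p]_2 * 'F_q)%type.
    by rewrite card_prod card_mx !card_Fp.
  have [l [Hl Biso]] := lbrace_pullback gb gD.
  have [l' [Hl' [al [chi [H iso]]]]] :=
    semi_decomposition pp pq npq n23 (has_size_rV2 pp) (@rV_mulrn p pp) (rV2_aut pp pq npq) Hl.
  have [k Piso] := elem_classification pp Hl'.
  have [al' [chi' [H' iso']]] := semi_transport pq H Piso.
  exists (false, k), al', chi', H'.
  exact: brace_iso_trans Biso (brace_iso_trans iso iso').
Qed.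

Definition semi_equiv (P : leftBraceType) (d d' : (P -> P) * (P -> 'F_q)) :=
  exists f, [/\ brace_aut f, forall x, d.2 x = d'.2 (f x) &
    exists2 c : nat, ~~ (q %| c)%N & forall x, f (d.1 x) = iter c d'.1 (f x)].

Lemma num_left_braces_sum (N : bool * bool -> nat) :
  (forall s, num_classes (fun d => @semi_data q (std_brace s) d.1 d.2)
     (@semi_equiv (std_brace s)) (N s)) ->
  num_left_braces (p ^ 2 * q) (\sum_s N s).
Proof.
move=> Ns; apply: (num_classes_sum (W := is_semi)) => [B|s t B C|s].
- exact: is_semiP.
- move=> [al [chi [H BH]]] [al' [chi' [H' CH']]] BC.
  have : brace_iso (semi pq H) (semi pq H').
    exact: brace_iso_trans (brace_iso_sym BH) (brace_iso_trans BC CH').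
  move=> /(semi_isoP pp pq npq (@std_brace_mulrn s) (@std_brace_mulrn t)).
  move=> [f [fb fD fL _]]; apply: std_brace_iso; apply/brace_isoP.
  by exists f.
- pose G d B := exists H : @semi_data q (std_brace s) d.1 d.2, brace_iso B (semi pq H).
  apply: (num_classes_graph (G := G) _ _ _ (Ns s)) => [d H|B|d d' B C [H BH] [H' CH']].
  + by exists (semi pq H); [exists d.1, d.2, H|exists H]; apply: brace_iso_refl.
  + by move=> [al [chi [H BH]]]; exists (al, chi) => //; exists H.
  have e : brace_iso B C <-> brace_iso (semi pq H) (semi pq H').
    split=> [BC|HH'].
      exact: brace_iso_trans (brace_iso_sym BH) (brace_iso_trans BC CH').
    exact: brace_iso_trans BH (brace_iso_trans HH' (brace_iso_sym CH')).
  apply: (iff_trans e).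
  apply: (iff_trans (semi_isoP pp pq npq (@std_brace_mulrn s) (@std_brace_mulrn s) H H')).
  split=> [[f [fb fD fL [fchi fal]]]|[f [[fb fD fL] fchi fal]]]; exists f; split=> //.
Qed.

End Reduction.

(** * Data with one trivial action: characters or automorphisms of P *)

Section TrivialActions.
Variables (p q : nat) (P : leftBraceType).
Hypotheses (pp : prime p) (pq : prime q) (npq : p <> q) (Pn : has_size P (p ^ 2)).

Definition char_data (chi : P -> 'F_q) :=
  (forall x y, chi (x * y)%g = chi x * chi y) /\ (forall x, chi x != 0).

Definition char_equiv (chi chi' : P -> 'F_q) :=
  exists2 f, brace_aut f & forall x, chi x = chi' (f x).

Definition aut_data (al : P -> P) :=
  [/\ {morph al : x y / x + y}, forall x y, al (lam x y) = lam (al x) (al y) &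
      forall x, iter q al x = x].

Definition aut_equiv (al al' : P -> P) :=
  exists2 f, brace_aut f &
    exists2 c : nat, ~~ (q %| c)%N & forall x, f (al x) = iter c al' (f x).

Lemma char_data0 chi : char_data chi -> chi 0 = 1.
Proof.
move=> [chiM chi_neq0]; apply: (mulfI (chi_neq0 0)).
by rewrite -chiM -{2}(@brace_one P) mulg1 mulr1.
Qed.

Lemma char_dataX chi x n : char_data chi -> chi (x ^+ n)%g = chi x ^+ n.
Proof.
move=> chiP; elim: n => [|n IH]; first by rewrite expg0 brace_one char_data0.
by rewrite expgS exprS -IH (proj1 chiP).
Qed.

Lemma char_data_order chi x : char_data chi -> chi x ^+ (p ^ 2) = 1.
Proof. by move=> chiP; rewrite -char_dataX // (has_size_expg Pn) brace_one char_data0. Qed.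

Lemma brace_aut_id : brace_aut (@id P).
Proof. by split=> //; exists id. Qed.

Lemma num_classes_char N :
  (forall f : P -> P, {morph f : x y / x + y} -> (forall x, iter q f x = x) ->
     forall x, f x = x) ->
  num_classes char_data char_equiv N ->
  num_classes (fun d => @semi_data q P d.1 d.2) (@semi_equiv q P) N.
Proof.
move=> autP; pose G chi (d : (P -> P) * (P -> 'F_q)) :=
  (forall x, d.1 x = x) /\ (forall x, d.2 x = chi x).
apply: (num_classes_graph (G := G)) => [chi [chiM chi0]|[al chi] /= H|].
- by exists (id, chi) => //; split=> //= [x|]; [elim: q | left].
- exists chi; first by split; [exact: sd_chiM H | exact: sd_chi_neq0 H].
  by split=> //= x; apply: autP; [exact: sd_alD H | exact: sd_alq H].
move=> chi chi' [al ch] [al' ch'] [/= al1 chE] [/= al'1 ch'E]; split.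
  by move=> [f [/= fa fchi _]]; exists f => // x; rewrite -chE fchi ch'E.
move=> [f fa fchi]; exists f; split=> //= [x|]; first by rewrite chE ch'E fchi.
exists 1%N => [|x /=]; first by rewrite dvdn1 neq_ltn prime_gt1 ?orbT.
by rewrite al1 al'1.
Qed.

(** The values of [chi] have order dividing p^2 and q - 1, so only [al] survives. *)
Lemma num_classes_aut N :
  coprime (p ^ 2) q.-1 ->
  num_classes aut_data aut_equiv N ->
  num_classes (fun d => @semi_data q P d.1 d.2) (@semi_equiv q P) N.
Proof.
move=> cpq; pose G al (d : (P -> P) * (P -> 'F_q)) :=
  (forall x, d.1 x = al x) /\ (forall x, d.2 x = 1).
apply: (num_classes_graph (G := G)) => [al [alD alL alq]|[al chi] /= H|].
- exists (al, fun=> 1) => //; split=> //= [*|]; [by rewrite mulr1 | by right].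
- exists al; first by split; [exact: sd_alD H | exact: sd_al_lam H | exact: sd_alq H].
  have chiP : char_data chi by split; [exact: sd_chiM H | exact: sd_chi_neq0 H].
  split=> //= x; apply: expr_coprime_eq1 cpq (char_data_order x chiP) _.
  exact: (Fp_expr_pred pq (proj2 chiP x)).
move=> al al' [a ch] [a' ch'] [/= aE ch1] [/= a'E ch'1].
have iE n x : iter n a' x = iter n al' x by apply: eq_iter.
split=> [[f [/= fa _ [c qc fal]]]|[f fa [c qc fal]]]; exists f => //.
  by exists c => // x; rewrite -aE fal.
by split=> //= [x|]; [rewrite ch1 ch'1 | exists c => // x; rewrite aE fal iE].
Qed.

End TrivialActions.

(** * The total as a sum over the four braces of size p^2 *)

Section Total.
Variables (p q : nat).
Hypotheses (pp : prime p) (pq : prime q) (npq : p <> q) (n23 : ~ (p = 2 /\ q = 3)%N).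

Lemma num_left_braces_chars (n1 n2 n3 n4 : nat) :
  ~~ (q %| p ^ 2 - 1)%N ->
  num_classes (@char_data q (cyc_brace pp false)) (@char_equiv q _) n1 ->
  num_classes (@char_data q (cyc_brace pp true)) (@char_equiv q _) n2 ->
  num_classes (@char_data q (elem_brace p false)) (@char_equiv q _) n3 ->
  num_classes (@char_data q (elem_brace p true)) (@char_equiv q _) n4 ->
  num_left_braces (p ^ 2 * q) (n1 + n2 + (n3 + n4)).
Proof.
move=> nq N1 N2 N3 N4.
pose N (s : bool * bool) := if s.1 then if s.2 then n2 else n1 else if s.2 then n4 else n3.
have -> : (n1 + n2 + (n3 + n4) = \sum_s N s)%N.
  rewrite -(pair_bigA _ (fun a b => N (a, b))) /= !big_bool /N /=.
  by rewrite [(n2 + _)%N]addnC [(n4 + _)%N]addnC.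
apply: (num_left_braces_sum (pp := pp) pq npq n23 (N := N)) => -[[] []];
  apply: (num_classes_char pq) => //.
- exact: (Zp2_aut pp pq npq nq).
- exact: (Zp2_aut pp pq npq nq).
- exact: (rV2_aut pp pq npq nq).
- exact: (rV2_aut pp pq npq nq).
Qed.

Lemma num_left_braces_auts (n1 n2 n3 n4 : nat) :
  coprime (p ^ 2) q.-1 ->
  num_classes (@aut_data q (cyc_brace pp false)) (@aut_equiv q _) n1 ->
  num_classes (@aut_data q (cyc_brace pp true)) (@aut_equiv q _) n2 ->
  num_classes (@aut_data q (elem_brace p false)) (@aut_equiv q _) n3 ->
  num_classes (@aut_data q (elem_brace p true)) (@aut_equiv q _) n4 ->
  num_left_braces (p ^ 2 * q) (n1 + n2 + (n3 + n4)).
Proof.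
move=> nq N1 N2 N3 N4.
pose N (s : bool * bool) := if s.1 then if s.2 then n2 else n1 else if s.2 then n4 else n3.
have -> : (n1 + n2 + (n3 + n4) = \sum_s N s)%N.
  rewrite -(pair_bigA _ (fun a b => N (a, b))) /= !big_bool /N /=.
  by rewrite [(n2 + _)%N]addnC [(n4 + _)%N]addnC.
apply: (num_left_braces_sum (pp := pp) pq npq n23 (N := N)) => s.
by apply: (num_classes_aut pq (std_brace_size pp s) nq); case: s => [[] []].
Qed.

End Total.

(** * Characters of the braces with cyclic additive group *)

(** Exponents in ['Z_n] are read through their representatives; the power laws hold once z^n = 1. *)
Lemma expr_ZpD (R : pzRingType) (n : nat) (z : R) (a b : 'Z_n) :
  (1 < n)%N -> z ^+ n = 1 -> z ^+ (a + b)%R = z ^+ a * z ^+ b.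
Proof.
by move=> n1 zn; rewrite -{1}[a]natr_Zp -{1}[b]natr_Zp -natrD val_Zp_nat // expr_mod // exprD.
Qed.

Lemma expr_ZpM (R : pzRingType) (n : nat) (z : R) (a b : 'Z_n) :
  (1 < n)%N -> z ^+ n = 1 -> z ^+ (a * b)%R = z ^+ a ^+ b.
Proof.
by move=> n1 zn; rewrite -{1}[a]natr_Zp -{1}[b]natr_Zp -natrM val_Zp_nat // expr_mod // exprM.
Qed.

Lemma expr_Zp_nat (R : pzRingType) (n : nat) (z : R) (m : nat) :
  (1 < n)%N -> z ^+ n = 1 -> z ^+ (m%:R : 'Z_n) = z ^+ m.
Proof. by move=> n1 zn; rewrite val_Zp_nat // expr_mod. Qed.

Lemma Zp_char (R : pzRingType) (n : nat) (f : 'Z_n -> R) :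
  f 0 = 1 -> (forall x y, f (x + y) = f x * f y) -> forall x, f x = f 1 ^+ x.
Proof.
move=> f0 fD x; rewrite -{1}[x]natr_Zp; elim: (x : nat) => [|m IH] //.
by rewrite mulrS fD IH exprS.
Qed.

Lemma Fp_prim_root (q n : nat) :
  prime q -> (n %| q.-1)%N -> exists z : 'F_q, n.-primitive_root z.
Proof.
move=> pq nq; have q1 : (0 < q.-1)%N by rewrite -ltnS prednK ?prime_gt1 ?prime_gt0.
have : has (q.-1).-primitive_root (enum (predC1 (0 : 'F_q))).
  apply: has_prim_root; rewrite ?enum_uniq // -?cardE ?cardC1 ?card_Fp //.
  apply/allP => x; rewrite mem_enum => x0.
  by apply/unity_rootP; apply: Fp_expr_pred.
by move=> /hasP[z _ zp]; exists (z ^+ (q.-1 %/ n)); apply: dvdn_prim_root.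
Qed.

Section CyclicCharacters.
Variables (p q : nat) (k : bool).
Hypotheses (pp : prime p) (pq : prime q) (kp : k -> odd p).

Notation Z := 'Z_(p ^ 2).
Notation P := (cyc_brace pp k).
Notation pk := ((p * k)%:R : Z).

Let p21 : (1 < p ^ 2)%N := p2_gt1 pp.

Lemma cyc_mulE (x y : P) : (x * y)%g = x + (1 + pk * x) * y :> Z.
Proof. by []. Qed.

(** Here u = f(1), and compatibility with the lambda map at (1, 1) leaves [pk * u = pk]: for [k]
    true this says that u is 1 mod p. *)
Lemma cyc_aut (f : P -> P) : brace_aut f ->
  exists2 u : Z, u \is a GRing.unit /\ pk * u = pk & forall x : Z, f x = u * x.
Proof.
move=> [[g fK gK] fD fL]; pose u : Z := f (1 : Z).
have fE x : f x = u * x by apply: additive_Zp.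
have gD : {morph g : x y / x + y} by move=> x y; apply: (can_inj fK); rewrite fD !gK.
have gE x : g x = g (1 : Z) * x by apply: additive_Zp.
have uu : u \is a GRing.unit.
  by apply/unitrP; exists (g (1 : Z)); rewrite -gE fK mulrC -gE fK.
exists u; last exact: fE; split => //.
have := fL (1 : Z) (1 : Z); rewrite !lbrace_lam !fE /cyc_lam !mulr1 mulrC => h.
by have /addrI := mulIr uu h.
Qed.

Lemma cyc_autV (u : Z) : u \is a GRing.unit -> pk * u = pk -> @brace_aut P ( *%R u).
Proof.
move=> uu pu; split.
- by exists ( *%R u^-1); [apply: mulKr | apply: mulVKr].
- by move=> x y; apply: mulrDr.
- move=> x y; rewrite !lbrace_lam /cyc_lam.
  have -> : (1 + pk * (u * x)) * (u * y) = (1 + (pk * u) * x) * u * y by ring.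
  by rewrite pu; ring.
Qed.

(* For [p] odd, [L] is an isomorphism of the circle group onto (Z/p^2, +), with
   inverse [E]. *)
Let h : Z := if k then 2%:R^-1 else 0.
Let L (x : Z) : Z := x - pk * h * x * (x - 1).
Let E (x : Z) : Z := x + pk * h * x * (x - 1).

Let PP : pk * pk = 0. Proof. exact: Zp2_sqr_p. Qed.

Let Ph : pk * (1 - 2%:R * h) = 0.
Proof.
rewrite /h; case: k kp => [/(_ isT) op|]; last by rewrite muln0 mul0r.
by rewrite mulrV ?subrr ?mulr0 // unitZpE // coprimeXl // coprimen2.
Qed.

(** For [k] true, x -> 1 + px turns the circle product into a product, and [L] imitates log(1 +
    px)/p up to its quadratic term, with a linear correction arranging [L 1 = 1]. The error is a
    combination of the two vanishing expressions in [Ph] and [PP]. *)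
Let LM (x y : Z) : L (x + (1 + pk * x) * y) = L x + L y.
Proof.
have -> : L (x + (1 + pk * x) * y) = L x + L y + x * y * (pk * (1 - 2%:R * h))
   - pk * pk * (h * x * y * (2%:R * (x + y) - 1) + pk * h * x ^+ 2 * y ^+ 2).
  by rewrite /L; ring.
by rewrite Ph PP mulr0 mul0r subr0 addr0.
Qed.

Let EM (x y : Z) : E (x + y) = E x + (1 + pk * E x) * E y.
Proof.
have -> : E x + (1 + pk * E x) * E y = E (x + y) + x * y * (pk * (1 - 2%:R * h))
   + pk * pk * (h * (x * (y * (y - 1)) + x * (x - 1) * y)
      + pk * h ^+ 2 * (x * (x - 1)) * (y * (y - 1))).
  by rewrite /E; ring.
by rewrite Ph PP mulr0 mul0r !addr0.
Qed.

Let EL x : E (L x) = x.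
Proof.
have -> : E (L x) = x + pk * pk * (h ^+ 3 * pk * (x * (x - 1)) ^+ 2
    - h ^+ 2 * (x * (x - 1)) * (2%:R * x - 1)).
  by rewrite /E /L; ring.
by rewrite PP mul0r addr0.
Qed.

Definition cyc_char_equiv (z z' : 'F_q) :=
  exists u : Z, [/\ u \is a GRing.unit, pk * u = pk & z = z' ^+ u].

(** [L] commutes with brace automorphisms, so these act on the root of unity of a character by
    powers. *)
Let LZ u x : pk * u = pk -> L (u * x) = u * L x.
Proof.
move=> pu; rewrite /L; have -> : pk * h * (u * x) * (u * x - 1) =
  (pk * u) * u * h * x * x - (pk * u) * h * x by ring.
rewrite !pu; have -> : u * (x - pk * h * x * (x - 1)) =
  u * x - (pk * u) * (h * x * (x - 1)) by ring.
by rewrite pu; ring.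
Qed.

Let E1 : E 1 = 1. Proof. by rewrite /E subrr mulr0 addr0. Qed.
Let L1 : L 1 = 1. Proof. by rewrite /L subrr mulr0 subr0. Qed.

(** Through [L] a character is x -> z^(L x), where z = chi(1) is a p^2-th root of unity. *)
Lemma num_classes_cyc_char N :
  num_classes (fun z : 'F_q => z ^+ (p ^ 2) = 1) cyc_char_equiv N ->
  num_classes (@char_data q P) (@char_equiv q P) N.
Proof.
pose G (z : 'F_q) (chi : P -> 'F_q) := z ^+ (p ^ 2) = 1 /\ forall x : Z, chi x = z ^+ L x.
apply: (num_classes_graph (G := G)) => [z zp|chi chiP|z z' chi chi' [zp chiE] [z'p chi'E]].
- exists (fun x => z ^+ L x) => //; split=> x; first move=> y.
    by rewrite cyc_mulE LM expr_ZpD.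
  apply: expf_neq0; apply/eqP => z0; move: zp; rewrite z0 expr0n expn_eq0 andbT.
  by rewrite eqn0Ngt prime_gt0 // => /eqP; rewrite eq_sym oner_eq0.
- have chi1 := @char_data_order p q P (has_size_Zp2 pp) chi (1 : Z) chiP.
  exists (chi (1 : Z)) => //; split=> //.
  have EX (x y : Z) : chi (E (x + y)) = chi (E x) * chi (E y).
    by rewrite EM -(proj1 chiP).
  have E0 : chi (E 0) = 1 by rewrite /E mulr0 mul0r addr0; exact: (char_data0 chiP).
  by move=> x; rewrite -{1}[x]EL (Zp_char E0 EX) E1.
- split=> [[f fa ff]|[u [uu pu zE]]].
    have [u [uu pu] fE] := cyc_aut fa; exists u; split=> //.
    have Lu : L u = u by rewrite -[in LHS](mulr1 u) LZ // L1 mulr1.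
    have := ff (1 : Z); rewrite fE chiE chi'E mulr1 L1 Lu.
    by rewrite (expr_Zp_nat 1) // expr1.
  exists ( *%R u); first exact: cyc_autV.
  by move=> x; rewrite chiE chi'E LZ // expr_ZpM // zE.
Qed.

End CyclicCharacters.

(** * Orbits of p^2-th roots of unity under units of Z/p^2 *)

Section CountCyclic.
Variables (p q : nat).
Hypotheses (pp : prime p) (pq : prime q) (pq1 : (p %| q.-1)%N).

Notation Z := 'Z_(p ^ 2).
Notation V := (fun z : 'F_q => z ^+ (p ^ 2) = 1).

Let p21 : (1 < p ^ 2)%N := p2_gt1 pp.

Lemma cyc_char_equiv_sym k (z z' : 'F_q) :
  V z -> V z' -> @cyc_char_equiv p q k z z' -> @cyc_char_equiv p q k z' z.
Proof.
move=> zp z'p [u [uu pu zE]]; exists u^-1; split; first by rewrite unitrV.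
  by rewrite -{1}pu mulrK.
by rewrite zE -expr_ZpM // mulrV // (expr_Zp_nat 1) // expr1.
Qed.

Lemma cyc_char_equivX k n (z z' : 'F_q) :
  V z -> V z' -> @cyc_char_equiv p q k z z' -> (z ^+ n == 1) = (z' ^+ n == 1).
Proof.
have imp x y : @cyc_char_equiv p q k x y -> y ^+ n == 1 -> x ^+ n == 1.
  by move=> [u [_ _ ->]] /eqP yn; rewrite -exprM mulnC exprM yn expr1n.
move=> zp z'p zz'; apply/idP/idP; last exact: imp zz'.
exact: imp (cyc_char_equiv_sym zp z'p zz').
Qed.

(** As p divides q - 1 and p^2 does not, gcd(p^2, q - 1) = p. *)
Lemma cyc_char_p_torsion (z : 'F_q) : V z -> ~~ (p ^ 2 %| q.-1)%N -> z ^+ p = 1.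
Proof.
move=> zp nd; have z0 : z != 0.
  by apply/eqP => z0; move: zp; rewrite z0 expr0n expn_eq0 eqn0Ngt prime_gt0 // => /eqP;
     rewrite eq_sym oner_eq0.
have := expr_gcd_eq1 zp (Fp_expr_pred pq z0).
have : (gcdn (p ^ 2) q.-1 %| p ^ 2)%N by apply: dvdn_gcdl.
move=> /(dvdn_pfactor _ _ pp)[[|[|[|m]]] // _ e].
- have : (p %| gcdn (p ^ 2) q.-1)%N by rewrite dvdn_gcd dvdn_exp.
  by rewrite e dvdn1 => /eqP p1; move: pp; rewrite p1.
- by rewrite e expn1.
- by case/negP: nd; rewrite -e dvdn_gcdr.
Qed.

Lemma unit_Zp2_nat n : ~~ (p %| n)%N -> (n%:R : Z) \is a GRing.unit.
Proof. by move=> np; rewrite unitZpE // coprimeXl // prime_coprime. Qed.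

Lemma cyc_char_equiv0 (z : 'F_q) (n : nat) : V z -> ~~ (p %| n)%N ->
  @cyc_char_equiv p q false (z ^+ n) z.
Proof.
move=> zp np; exists n%:R; split; first exact: unit_Zp2_nat.
  by rewrite muln0 mul0r.
by rewrite expr_Zp_nat.
Qed.

(** All units act, so a class is given by the order of z: 1, p, or p^2, the last occurring only if
    p^2 divides q - 1. *)
Lemma count_cyc_triv_char :
  num_classes V (@cyc_char_equiv p q false) (1 + (1 + (p ^ 2 %| q.-1)%N)).
Proof.
have [w wp] := Fp_prim_root pq pq1.
have Vp z : z ^+ p = 1 -> V z.
  by move=> zp; rewrite -[(p ^ 2)%N]/(p * p)%N exprM zp expr1n.
apply: (num_classesU (C := fun z => z ^+ 1 == 1)).
- by move=> z z' Vz Vz'; apply: cyc_char_equivX.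
- apply: (num_classes1 (t0 := 1)) => [|z [Vz]]; first by rewrite !expr1n.
  rewrite expr1 => /eqP->; rewrite -{1}[1](expr1n _ 1).
  by apply: cyc_char_equiv0; rewrite ?expr1n // dvdn1 neq_ltn prime_gt1 ?orbT.
apply: (num_classesU (C := fun z => z ^+ p == 1)).
- by move=> z z' [Vz _] [Vz' _]; apply: cyc_char_equivX.
- apply: (num_classes1 (t0 := w)).
    split; last by rewrite (prim_expr_order wp).
    split; first by apply/Vp/prim_expr_order.
    by rewrite -(prim_order_dvd wp) dvdn1 neq_ltn prime_gt1 ?orbT.
  move=> z [[Vz z1] /eqP zp]; have [i zE] := prim_rootP wp zp.
  rewrite zE; apply: cyc_char_equiv0; first exact/Vp/prim_expr_order.
  by apply: contra z1; rewrite zE expr1 -(prim_order_dvd wp).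
have [p2q|np2q] := boolP (p ^ 2 %| q.-1)%N; last first.
  by apply: num_classes0 => z [[Vz _]]; rewrite cyc_char_p_torsion ?eqxx.
have [e ep] := Fp_prim_root pq p2q.
apply: (num_classes1 (t0 := e)).
  split; first split; first exact: prim_expr_order.
    by rewrite -(prim_order_dvd ep) dvdn1 neq_ltn p21 orbT.
  rewrite -(prim_order_dvd ep); apply/negP => /dvdn_leq; rewrite prime_gt0 // => /(_ isT).
  by rewrite leqNgt -{1}(expn1 p) ltn_exp2l // prime_gt1.
move=> z [[Vz _] zp]; have [i zE] := prim_rootP ep Vz.
rewrite zE; apply: cyc_char_equiv0; first exact: prim_expr_order.
apply: contra zp => /dvdnP[m ie].
by rewrite zE ie -exprM -mulnA mulnn mulnC exprM (prim_expr_order ep) expr1n.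
Qed.

Lemma Zp2_mulp_eq (a b : Z) : (p%:R * a == p%:R * b) = (a == b %[mod p])%N.
Proof.
rewrite -{1}[a]natr_Zp -{1}[b]natr_Zp -!natrM -(inj_eq val_inj) /=.
by rewrite !val_Zp_nat // -[(p ^ 2)%N]/(p * p)%N -!muln_modr eqn_pmul2l ?prime_gt0.
Qed.

Lemma cyc_char_equiv1_fix (z : 'F_q) (u : Z) :
  (p * true)%:R * u = (p * true)%:R :> Z -> z ^+ p = 1 -> z ^+ u = z.
Proof.
rewrite muln1 -[RHS]mulr1 => /eqP; rewrite Zp2_mulp_eq => /eqP up zp.
by rewrite -(expr_mod _ zp) up expr_mod // (expr_Zp_nat 1) ?expr1.
Qed.

(** Only units that are 1 mod p act. They fix the p roots of order dividing p, and identify powers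
    of a primitive p^2-th root exactly when the exponents agree mod p, which leaves p - 1 further
    classes. *)
Lemma count_cyc_nontriv_char :
  num_classes V (@cyc_char_equiv p q true)
    (p + (if (p ^ 2 %| q.-1)%N then p.-1 else 0)).
Proof.
have [w wp] := Fp_prim_root pq pq1.
have p1 := prime_gt1 pp.
apply: (num_classesU (C := fun z => z ^+ p == 1)).
- by move=> z z'; apply: cyc_char_equivX.
- rewrite -[X in num_classes _ _ X](card_ord p).
  apply: (num_classes_fin (F := fun i : 'I_p => w ^+ i)) => [i|i j|z [Vz /eqP zp]].
  + have wi : (w ^+ i) ^+ p = 1 by rewrite -exprM mulnC exprM (prim_expr_order wp) expr1n.
    split; last by rewrite wi.
    by rewrite -[(p ^ 2)%N]/(p * p)%N [LHS]exprM wi expr1n.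
  + move=> [u [_ pu]]; rewrite (cyc_char_equiv1_fix pu).
      by move/eqP; rewrite (eq_prim_root_expr wp) !modn_small // => /eqP/val_inj.
    by rewrite -exprM mulnC exprM (prim_expr_order wp) expr1n.
  + have [i zE] := prim_rootP wp zp; exists i.
    by exists 1; split; rewrite ?unitr1 ?mulr1 // (val_Zp_nat p21 1) modn_small ?expr1.
case: ifPn => [p2q|np2q]; last first.
  by apply: num_classes0 => z [Vz]; rewrite cyc_char_p_torsion ?eqxx.
have [e ep] := Fp_prim_root pq p2q.
rewrite -[X in num_classes _ _ X](card_ord p.-1).
have epp : p.-primitive_root (e ^+ p).
  have -> : p = (p ^ 2 %/ p)%N by rewrite -[(p ^ 2)%N]/(p * p)%N mulnK // ltnW.
  have := dvdn_prim_root ep (dvdn_exp (ltn0Sn 1) (dvdnn p)).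
  by rewrite -[(p ^ 2)%N]/(p * p)%N mulnK // ltnW.
(* The shifted exponents run through the nonzero residues 1, ..., p - 1. *)
apply: (num_classes_fin (F := fun i : 'I_p.-1 => e ^+ i.+1)) => [i|i j|z [Vz zp]].
- split; first by rewrite -exprM mulnC exprM (prim_expr_order ep) expr1n.
  rewrite -exprM mulnC exprM -(prim_order_dvd epp); apply/negP => /dvdn_leq.
  by move=> /(_ isT); rewrite leqNgt -ltn_predRL ltn_ord.
(* On p-th powers the unit acts trivially, so exponents can be compared mod p. *)
- move=> [u [_ pu]] /(congr1 (fun x => x ^+ p)).
  have eX m : e ^+ m.+1 ^+ p = e ^+ p ^+ m.+1 by rewrite -!exprM mulnC.
  rewrite -[in RHS]exprM [(u * p)%N]mulnC exprM !eX (cyc_char_equiv1_fix pu); last first.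
    by rewrite -exprM mulnC exprM (prim_expr_order epp) expr1n.
  move/eqP; rewrite (eq_prim_root_expr epp) !modn_small -?ltn_predRL ?ltn_ord //.
  by rewrite eqSS => /eqP/val_inj.
- have [i zE] := prim_rootP ep Vz.
  have pi : ~~ (p %| i)%N.
    apply: contra zp => /dvdnP[m ie].
    by rewrite zE ie -exprM -mulnA mulnn mulnC exprM (prim_expr_order ep) expr1n.
  have r0 : (0 < i %% p)%N by rewrite lt0n; exact: pi.
  have rp : ((i %% p).-1 < p.-1)%N by rewrite ltn_predRL prednK // ltn_pmod // prime_gt0.
  exists (Ordinal rp); rewrite /= prednK //.
  have ur : ((i %% p)%N%:R : Z) \is a GRing.unit.
    by apply: unit_Zp2_nat; rewrite /dvdn modn_mod -lt0n.
  have ui : (i%:R : Z) \is a GRing.unit by apply: unit_Zp2_nat.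
  (* This quotient is 1 mod p and carries e^(i mod p) to e^i. *)
  exists (i%:R / (i %% p)%N%:R); split.
  + by rewrite unitrM ui unitrV.
  + apply: (mulIr ur); rewrite -mulrA divrK // muln1; apply/eqP.
    by rewrite Zp2_mulp_eq !val_Zp_nat // !modn_dvdm ?dvdn_exp // modn_mod.
  + have er : e ^+ (i %% p) ^+ (p ^ 2) = 1.
      by rewrite -exprM mulnC exprM (prim_expr_order ep) expr1n.
    rewrite zE -[in RHS](expr_Zp_nat (i %% p) p21 (prim_expr_order ep)).
    rewrite -expr_ZpM ?(prim_expr_order ep) // mulrC divrK //.
    by rewrite (expr_Zp_nat _ p21 (prim_expr_order ep)).
Qed.

End CountCyclic.

(** * Characters of the braces with elementary additive group *)

Lemma expr_FpD (R : pzRingType) (p : nat) (z : R) (a b : 'F_p) :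
  prime p -> z ^+ p = 1 -> z ^+ (a + b)%R = z ^+ a * z ^+ b.
Proof.
by move=> pp zp; rewrite -{1}[a]natr_Zp -{1}[b]natr_Zp -natrD val_Fp_nat // expr_mod // exprD.
Qed.

Lemma expr_FpM (R : pzRingType) (p : nat) (z : R) (a b : 'F_p) :
  prime p -> z ^+ p = 1 -> z ^+ (a * b)%R = z ^+ a ^+ b.
Proof.
by move=> pp zp; rewrite -{1}[a]natr_Zp -{1}[b]natr_Zp -natrM val_Fp_nat // expr_mod // exprM.
Qed.

Lemma expr_Fp_nat (R : pzRingType) (p : nat) (z : R) (m : nat) :
  prime p -> z ^+ p = 1 -> z ^+ (m%:R : 'F_p) = z ^+ m.
Proof. by move=> pp zp; rewrite val_Fp_nat // expr_mod. Qed.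

Lemma ltn_Fp (p : nat) (a : 'F_p) : prime p -> (a < p)%N.
Proof. by move=> pp; have := ltn_ord a; rewrite [X in (_ < X)%N -> _]Fp_cast. Qed.

Section ElementaryCharacters.
Variables (p q : nat) (k : bool).
Hypotheses (pp : prime p) (pq : prime q) (pq1 : (p %| q.-1)%N) (kp : k -> odd p).

Notation F := 'F_p.
Notation P := (elem_brace p k).

Let k0 : false%:R = 0 :> F. Proof. by []. Qed.

(** On row vectors, preserving x_1 y_1 e_0 means lower triangular with first diagonal entry the
    square of the second. *)
Definition elem_aut_mx (M : 'M[F]_2) :=
  M \in unitmx /\ (k -> M 0 1 = 0 /\ M 0 0 = M 1 1 ^+ 2).

Lemma elem_aut (f : P -> P) : brace_aut f ->
  exists2 M, elem_aut_mx M & forall x : 'rV[F]_2, f x = x *m M.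
Proof.
move=> [[g fK gK] fD fL]; pose M := @lin1_mx F 2 2 f.
have fE (x : 'rV[F]_2) : f x = x *m M by apply: (additive_Fp_rV _ fD).
clearbody M.
have gD : {morph g : x y / x + y} by move=> x y; apply: (can_inj fK); rewrite fD !gK.
have gE (x : 'rV[F]_2) : g x = x *m @lin1_mx F 2 2 g by apply: (additive_Fp_rV _ gD).
exists M => //; split.
  suff : M *m @lin1_mx F 2 2 g = 1%:M by case/mulmx1_unit.
  by apply: mulmx_rV_inj => x; rewrite mulmxA -gE -fE fK mulmx1.
(* One evaluation at (0, 1), where the lambda map is nontrivial, yields both conditions. *)
move=> kT; have := fL (row2 0 1) (row2 0 1).
rewrite !lbrace_lam !fE /elem_lam kT => e.
have e1 := congr1 (fun v : 'rV[F]_2 => v 0 1) e.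
have e0 := congr1 (fun v : 'rV[F]_2 => v 0 0) e.
move: e0 e1; rewrite /= !(mulmx2E, mxE) /= !(mul0r, mul1r, mulr1, add0r).
rewrite addrC => /addrI -> e1; split=> //.
by apply: (addIr (M 1 1)); rewrite e1 add0r.
Qed.

Lemma elem_autV (M : 'M[F]_2) : elem_aut_mx M -> @brace_aut P (fun x : 'rV[F]_2 => x *m M).
Proof.
move=> [uM Mk]; split.
- by exists (fun x : 'rV[F]_2 => x *m invmx M) => x; rewrite ?mulmxK ?mulmxKV.
- by move=> x y; apply: mulmxDl.
- move=> x y; rewrite !lbrace_lam /elem_lam.
  apply: rowP2; rewrite !mulmx2E !mxE /=;
    case: k Mk => [/(_ isT)[e01 e00]|_]; rewrite ?e01 ?e00 ?k0; ring.
Qed.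

Definition elem_char_equiv (r r' : 'cV[F]_2) := exists2 M, elem_aut_mx M & r = M *m r'.

(** For [k] true and p odd, subtracting half the square of the second coordinate linearises the
    circle group, since x_1 y_1 is the polar form of x_1^2 / 2; [E] inverts [L]. *)
Let h : F := if k then 2%:R^-1 else 0.
Let L (x : 'rV[F]_2) : 'rV[F]_2 := row2 (x 0 0 - k%:R * h * x 0 1 ^+ 2) (x 0 1).
Let E (x : 'rV[F]_2) : 'rV[F]_2 := row2 (x 0 0 + k%:R * h * x 0 1 ^+ 2) (x 0 1).

Let Ph : k%:R * (1 - 2%:R * h) = 0.
Proof.
rewrite /h; case: k kp => [/(_ isT) op|]; last by rewrite mul0r.
rewrite mulfV ?subrr ?mulr0 // Fp_natr_eq0 // dvdn_prime2 //.
by apply/eqP => p2; move: op; rewrite p2.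
Qed.

Lemma elem_mulE (x y : P) : (x * y)%g = x + elem_lam k x y :> 'rV[F]_2.
Proof. by []. Qed.

Let LM (x y : 'rV[F]_2) : L (x + elem_lam k x y) = L x + L y.
Proof.
apply: rowP2; rewrite !mxE //=.
apply/eqP; rewrite -subr_eq0; apply/eqP.
rewrite -[RHS](mul0r (x 0 1 * y 0 1)) -Ph; ring.
Qed.

Let EM (x y : 'rV[F]_2) : E (x + y) = E x + elem_lam k (E x) (E y).
Proof.
apply: rowP2; rewrite !mxE //=.
apply/eqP; rewrite eq_sym -subr_eq0; apply/eqP.
rewrite -[RHS](mul0r (x 0 1 * y 0 1)) -Ph; ring.
Qed.

Let EL x : E (L x) = x.
Proof. by apply: rowP2; rewrite !mxE //= subrK. Qed.

Let LE x : L (E x) = x.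
Proof. by apply: rowP2; rewrite !mxE //= addrK. Qed.

Let LX M x : elem_aut_mx M -> L (x *m M) = L x *m M.
Proof.
move=> [_ Mk]; apply: rowP2; rewrite !(mulmx2E, mxE) /=;
  case: k Mk => [/(_ isT)[e01 e00]|_]; rewrite ?e01 ?e00 ?k0; ring.
Qed.

(** After [L] a character takes p-th roots of unity as values on F_p^2, hence is given by a column
    [r] of exponents of a primitive root; automorphisms act on [r] by matrix multiplication. *)
Lemma num_classes_elem_char N :
  num_classes (fun=> True) elem_char_equiv N ->
  num_classes (@char_data q P) (@char_equiv q P) N.
Proof.
have [w wp] := Fp_prim_root pq pq1; have wp1 := prim_expr_order wp.
have w0 : w != 0 by rewrite -unitfE -(unitrX_pos _ (prime_gt0 pp)) wp1 unitr1.
pose G (r : 'cV[F]_2) (chi : P -> 'F_q) := forall x : 'rV[F]_2, chi x = w ^+ ((L x *m r) 0 0)%R.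
apply: (num_classes_graph (G := G)) => [r _|chi chiP|r r' chi chi' chiE chi'E].
- exists (fun x => w ^+ (L x *m r) 0 0) => //; split=> x; last exact: expf_neq0.
  by move=> y; rewrite elem_mulE LM mulmxDl mxE expr_FpD.
- have EX (x y : 'rV[F]_2) : chi (E (x + y)) = chi (E x) * chi (E y).
    by rewrite EM -(proj1 chiP).
  have E0 : chi (E 0) = 1.
    have -> : E 0 = 0 by apply: rowP2; rewrite !mxE //= expr0n mulr0 addr0.
    exact: (char_data0 chiP).
  have Xn n x : chi (E (x *+ n)) = chi (E x) ^+ n.
    by elim: n => // n IH; rewrite mulrS EX IH exprS.
  have Ep x : chi (E x) ^+ p = 1.
    have xp : x *+ p = 0 by rewrite -scaler_nat pchar_Fp_0 // scale0r.
    by rewrite -Xn xp E0.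
  have [i iE] := prim_rootP wp (Ep (row2 1 0)).
  have [j jE] := prim_rootP wp (Ep (row2 0 1)).
  exists (row2 i%:R j%:R)^T => // x.
  have LxE : L x = row2 1 0 *+ (L x 0 0) + row2 0 1 *+ (L x 0 1).
    rewrite -!scaler_nat !natr_Zp.
    by apply: rowP2; rewrite !mxE /= ?mulr1 ?mulr0 ?add0r ?addr0.
  rewrite -{1}[x]EL {1}LxE EX !Xn iE jE mulmx2E.
  have -> : (row2 i%:R j%:R)^T 0 0 = i%:R :> F by rewrite !mxE.
  have -> : (row2 i%:R j%:R)^T 1 0 = j%:R :> F by rewrite !mxE.
  by rewrite [_ * i%:R]mulrC [_ * j%:R]mulrC expr_FpD // !expr_FpM // !expr_Fp_nat.
- split=> [[f fa ff]|[M Ma rE]].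
    have [M Ma fE] := elem_aut fa; exists M => //.
    (* Evaluation at the preimages of the basis vectors reads off the entries of the columns. *)
    apply/colP => i; pose x := E (delta_mx 0 i : 'rV[F]_2).
    have := ff x; rewrite chiE chi'E fE LX // LE -mulmxA.
    rewrite -!rowE !mxE => /eqP; rewrite (eq_prim_root_expr wp) !modn_small ?ltn_Fp //.
    by move/eqP/val_inj.
  exists (fun x : 'rV[F]_2 => x *m M); first exact: elem_autV.
  by move=> x; rewrite chiE chi'E LX // rE mulmxA.
Qed.

End ElementaryCharacters.

(** * Orbits of matrix groups on column vectors *)

Section CountElementary.
Variables (p : nat).
Hypothesis pp : prime p.
Notation F := 'F_p.

Definition col2 (a b : F) : 'cV[F]_2 := (row2 a b)^T.

Lemma mul_mx2_col2 a b c d x y : mx2 a b c d *m col2 x y = col2 (a * x + b * y) (c * x + d * y).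
Proof.
by apply/colP => i; rewrite mulmx2E; case: (ord2E i) => ->; rewrite !mxE.
Qed.

Lemma col2K (r : 'cV[F]_2) : r = col2 (r 0 0) (r 1 0).
Proof. by apply/colP => i; case: (ord2E i) => ->; rewrite !mxE. Qed.

Lemma col2_inj a b c d : col2 a b = col2 c d -> a = c /\ b = d.
Proof.
move=> e; split; [have := congr1 (fun v : 'cV[F]_2 => v 0 0) e |
  have := congr1 (fun v : 'cV[F]_2 => v 1 0) e]; by rewrite !mxE.
Qed.

Lemma elem_char_equiv_eq0 k (r r' : 'cV[F]_2) :
  elem_char_equiv k r r' -> (r == 0) = (r' == 0).
Proof.
move=> [M [uM _] ->]; apply/eqP/eqP => [Mr|->]; last by rewrite mulmx0.
by rewrite -[r'](mulKmx uM) Mr mulmx0.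
Qed.

Lemma unitmx2 a b c d : (mx2 a b c d \in unitmx) = (a * d - b * c != 0 :> F).
Proof. by rewrite unitmxE unitfE det_mx2. Qed.

(** GL_2 is transitive on nonzero vectors; the witnesses are invertible matrices with first column
    [r]. *)
Lemma count_elem_triv_char : num_classes (fun=> True) (@elem_char_equiv p false) 2.
Proof.
apply: (@num_classesU _ _ (fun r : 'cV[F]_2 => r == 0) _ 1 1) => [r r' _ _||].
- exact: elem_char_equiv_eq0.
- apply: (num_classes1 (t0 := 0)) => // r [_ /eqP->].
  by exists 1%:M; rewrite ?mulmx0 //; split; rewrite ?unitmx1.
- apply: (num_classes1 (t0 := col2 1 0)) => [|r [_ r0]].
    split=> //; apply/eqP => /(congr1 (fun v : 'cV[F]_2 => v 0 0)); rewrite !mxE /=.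
    by move/eqP; rewrite oner_eq0.
  have [r00|r00] := eqVneq (r 0 0) 0.
    have r10 : r 1 0 != 0.
      by apply: contra r0 => /eqP r10; rewrite [r]col2K r00 r10; apply/eqP/colP => i;
        rewrite !mxE; case: ifP.
    exists (mx2 0 1 (r 1 0) 0); first by split; rewrite // unitmx2 mul0r mul1r sub0r oppr_eq0.
    by rewrite mul_mx2_col2 {1}[r]col2K r00; congr col2; ring.
  exists (mx2 (r 0 0) 0 (r 1 0) 1); first by split; rewrite // unitmx2 mulr1 mul0r subr0.
  by rewrite mul_mx2_col2 {1}[r]col2K; congr col2; ring.
Qed.

Lemma elem_char_equivP (a b a' b' : F) :
  elem_char_equiv true (col2 a b) (col2 a' b') <->
  exists v w : F, [/\ v != 0, a = v ^+ 2 * a' & b = w * a' + v * b'].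
Proof.
split=> [[M [uM /(_ isT)[M01 M00]] e]|[v [w [v0 -> ->]]]].
  exists (M 1 1), (M 1 0).
  move: uM; rewrite unitmxE unitfE det_mx2E M01 mul0r subr0 M00 -exprSr expf_eq0 /= => v0.
  move: e; rewrite -[M]mx2K mul_mx2_col2 M01 M00 => /col2_inj[-> ->].
  by rewrite !mxE /=; split=> //; ring.
exists (mx2 (v ^+ 2) 0 w v); last by rewrite mul_mx2_col2; congr col2; ring.
split; last by rewrite !mxE.
by rewrite unitmx2 mul0r subr0 -exprSr expf_eq0.
Qed.

(** A generator of F_p^* serves as [g]: p - 1 is even, so the parity of an exponent is well
    defined. *)
Lemma Fp_nonsquare : odd p -> exists2 g : F, (forall x, x ^+ 2 != g) &
  forall y : F, y != 0 -> (exists x, x ^+ 2 = y) \/ (exists x, x ^+ 2 * g = y).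
Proof.
move=> op; have [g gp] := Fp_prim_root pp (dvdnn p.-1).
have p1 : (0 < p.-1)%N by rewrite -ltnS prednK ?prime_gt1 ?prime_gt0.
have ep : ~~ odd p.-1 by rewrite -oddS prednK ?prime_gt0 // op.
exists g => [x|y y0].
  apply/eqP => xg; have x0 : x != 0.
    apply/eqP => x0; have := prim_expr_order gp; rewrite -xg x0 -exprM expr0n.
    by rewrite muln_eq0 /= eqn0Ngt p1 => /eqP; rewrite eq_sym oner_eq0.
  have [i xE] := prim_rootP gp (Fp_expr_pred pp x0).
  move/eqP: xg; rewrite xE -exprM -{2}[g]expr1 (eq_prim_root_expr gp) => /eqP.
  by move/(congr1 odd); rewrite !odd_mod ?(negbTE ep) // oddM andbF.
have [i yE] := prim_rootP gp (Fp_expr_pred pp y0).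
have [oi|ei] := boolP (odd i).
  right; exists (g ^+ i./2); rewrite yE -exprM -exprSr muln2.
  by congr (_ ^+ _); rewrite -[RHS]odd_double_half oi.
left; exists (g ^+ i./2); rewrite yE -exprM muln2.
by congr (_ ^+ _); rewrite -[RHS]odd_double_half (negbTE ei).
Qed.

(** The group sends (a, b) to (v^2 a, w a + v b). For a = 0 the classes are b = 0 and b nonzero; for
    a nonzero, w clears b and a counts modulo squares. *)
Lemma count_elem_nontriv_char : odd p ->
  num_classes (fun=> True) (@elem_char_equiv p true) 4.
Proof.
move=> op; have [g gns gP] := Fp_nonsquare op.
have g0 : g != 0 by have := gns 0; rewrite expr0n eq_sym.
have eq_col2 (a b : F) : (col2 a b == 0) = (a == 0) && (b == 0).
  apply/eqP/andP => [|[/eqP-> /eqP->]]; last first.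
    by apply/colP => i; rewrite !mxE; case: ifP.
  have -> : 0 = col2 0 0 by apply/colP => i; rewrite !mxE; case: ifP.
  by move/col2_inj => [-> ->].
apply: (@num_classesU _ _ (fun r : 'cV[F]_2 => r 0 0 == 0) _ 2 2) => [r r' _ _||].
- rewrite [r]col2K [r']col2K => /elem_char_equivP[v [w [v0 e _]]].
  by rewrite !mxE /= e mulf_eq0 expf_eq0 (negbTE v0).
- apply: (@num_classesU _ _ (fun r : 'cV[F]_2 => r == 0) _ 1 1) => [r r' _ _||].
  + exact: elem_char_equiv_eq0.
  + apply: (num_classes1 (t0 := 0)) => [|r [_ /eqP->]]; first by rewrite mxE !eqxx.
    by exists 1%:M; rewrite ?mulmx0 //; split; rewrite ?unitmx1 // !mxE /= expr1n.
  + apply: (num_classes1 (t0 := col2 0 1)) => [|r [[_ /eqP r00] r0]].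
      by rewrite eq_col2 !mxE /= eqxx ?oner_eq0.
    rewrite [r]col2K; apply/elem_char_equivP; exists (r 1 0), 0.
    rewrite r00 mulr0 mul0r add0r mulr1; split=> //.
    by apply: contra r0 => /eqP r10; rewrite [r]col2K eq_col2 r00 r10 eqxx.
- apply: (@num_classesU _ _ (fun r : 'cV[F]_2 => [exists x, x ^+ 2 == r 0 0]) _ 1 1) => [r r' _ _||].
  + rewrite [r]col2K [r']col2K => /elem_char_equivP[v [w [v0 e _]]].
    rewrite !mxE /= e; apply/existsP/existsP => -[x /eqP xE].
      exists (x / v); rewrite expr_div_n xE mulrC mulKf // expf_neq0 //.
    by exists (v * x); rewrite exprMn xE.
  + apply: (num_classes1 (t0 := col2 1 0)) => [|r [[_ r0] /existsP[x /eqP xE]]].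
      rewrite !mxE /= ?oner_eq0; split=> //; apply/existsP; exists 1.
      by rewrite expr1n.
    rewrite [r]col2K; apply/elem_char_equivP; exists x, (r 1 0).
    rewrite xE; split; [|ring|ring].
    by apply: contra r0; rewrite -xE => /eqP->; rewrite expr0n.
  + apply: (num_classes1 (t0 := col2 g 0)) => [|r [[_ r0] /existsPn rns]].
      rewrite !mxE /=; split=> //; apply/existsPn => x; exact: gns.
    have [[x xE]|[x xE]] := gP _ r0; first by have := rns x; rewrite xE eqxx.
    rewrite [r]col2K; apply/elem_char_equivP; exists x, (r 1 0 / g).
    rewrite xE divfK // mulr0 addr0; split=> //.
    by apply: contra r0; rewrite -xE => /eqP->; rewrite expr0n mul0r.
Qed.

End CountElementary.

(** * Characters of the nontrivial braces of size 4 *)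

Lemma F2E (a : 'F_2) : a = 0 \/ a = 1.
Proof. by case: a => [[|[|m]]] // i; [left | right]; apply: val_inj. Qed.

Lemma Z4E (a : 'Z_(2 ^ 2)) : [\/ a = 0, a = 1, a = 2%:R | a = 3%:R].
Proof.
by case: a => [[|[|[|[|m]]]]] // i; [constructor 1|constructor 2|constructor 3|constructor 4];
  apply: val_inj.
Qed.

Section Two.
Variables (q : nat) (p2 : prime 2) (pq : prime q).

(** A discrete logarithm: for p = 2 the circle group of the nontrivial elementary brace is cyclic of
    order 4, generated by [w], whose circle square is (1, 0). *)
Let e (x : 'rV['F_2]_2) : nat := (x 0%R 1%R + 2 * x 0%R 0%R)%N.
Let w := row2 0 1 : 'rV['F_2]_2.

Let eM (x y : 'rV['F_2]_2) : e (x + elem_lam true x y) = (e x + e y)%N %[mod 2 ^ 2].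
Proof.
rewrite /e !mxE /=.
by case: (F2E (x 0 0)) => ->; case: (F2E (x 0 1)) => ->;
   case: (F2E (y 0 0)) => ->; case: (F2E (y 0 1)) => ->.
Qed.

Let gen (x : elem_brace 2 true) : x = ((w : elem_brace 2 true) ^+ e x)%g.
Proof.
rewrite -[x in LHS]row2K /e.
case: (F2E (x 0 0)) => ->; case: (F2E (x 0 1)) => ->.
- by rewrite expg0 brace_one; apply: rowP2; rewrite !mxE.
- by rewrite expg1.
- by rewrite expg2 elem_mulE; apply: rowP2; rewrite !mxE //=; apply: val_inj.
- rewrite !expgS expg0 mulg1 !elem_mulE; apply: rowP2; rewrite !mxE //=; exact: val_inj.
Qed.

(** The only free entry of an automorphism is [M 1 0], and it produces the two units 1 and 3 of
    Z/4. *)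
Let e_aut (M : 'M['F_2]_2) (x : 'rV['F_2]_2) : elem_aut_mx true M ->
  e (x *m M) = (e x * (1 + 2 * (M 1%R 0%R : nat)))%N %[mod 2 ^ 2].
Proof.
move=> [uM /(_ isT)[M01 M00]].
have M11 : M 1 1 = 1.
  case: (F2E (M 1 1)) => // M11; move: uM; rewrite unitmxE det_mx2E M01 M11 mulr0 mul0r subr0.
  by rewrite unitr0.
rewrite /e !mulmx2E M00 M11 M01 expr1n.
by case: (F2E (x 0 0)) => ->; case: (F2E (x 0 1)) => ->; case: (F2E (M 1 0)) => ->.
Qed.

(** The problem becomes that of characters of Z/4 under all its units, the one already met for the
    trivial cyclic brace. *)
Lemma num_classes_elem2_char N :
  num_classes (fun z : 'F_q => z ^+ (2 ^ 2) = 1) (@cyc_char_equiv 2 q false) N ->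
  num_classes (@char_data q (elem_brace 2 true)) (@char_equiv q _) N.
Proof.
pose G (z : 'F_q) (chi : elem_brace 2 true -> 'F_q) := z ^+ (2 ^ 2) = 1 /\
  forall x : 'rV['F_2]_2, chi x = z ^+ e x.
have exprm (z : 'F_q) m n : z ^+ (2 ^ 2) = 1 -> m = n %[mod 2 ^ 2] -> z ^+ m = z ^+ n.
  by move=> zp mn; rewrite -(expr_mod _ zp) mn expr_mod.
apply: (num_classes_graph (G := G)) => [z z4|chi chiP|z z' chi chi' [z4 chiE] [z'4 chi'E]].
- have z0 : z != 0 by rewrite -unitfE -(@unitrX_pos _ _ (2 ^ 2)%N) // z4 unitr1.
  exists (fun x => z ^+ e x) => //; split=> x; last exact: expf_neq0.
  by move=> y; rewrite elem_mulE -exprD; apply: exprm.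
- have c4 := @char_data_order 2 q (elem_brace 2 true) (has_size_rV2 p2) chi w chiP.
  by exists (chi w) => //; split=> // x; rewrite {1}[x]gen (char_dataX _ _ chiP).
- split=> [[f fa ff]|[u [uu _ zE]]].
    have [M Ma fE] := elem_aut fa; pose n := (1 + 2 * (M 1%R 0%R : nat))%N.
    exists n%:R; split; last 1 first.
    + have := ff w; rewrite chiE chi'E fE (exprm _ _ _ z'4 (e_aut w Ma)) /e !mxE /=.
      by rewrite mul1n expr1 (expr_Zp_nat _ (p2_gt1 p2) z'4).
    + by rewrite unitZpE // /n; case: (F2E (M 1 0)) => ->.
    + by rewrite muln0 mul0r.
  have [c uE] : exists c : 'F_2, u = (1 + 2 * (c : nat))%N%:R.
    case: (Z4E u) uu => -> //; first by move=> _; exists 0.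
    by move=> _; exists 1.
  have Ma : elem_aut_mx true (mx2 1 0 c 1).
    split; last by rewrite !mxE expr1n.
    by rewrite unitmxE det_mx2 mulr1 mul0r subr0 unitr1.
  exists (fun x : 'rV['F_2]_2 => x *m mx2 1 0 c 1); first exact: elem_autV.
  move=> x; rewrite chiE chi'E (exprm _ _ _ z'4 (e_aut x Ma)) zE uE.
  rewrite (expr_Zp_nat _ (p2_gt1 p2) z'4) -exprM mulnC.
  by rewrite (mxE _ _ 1 0).
Qed.

(** In the nontrivial brace on Z/4 the elements 1 and 3 have circle square 0 and circle product 2,
    so they generate a Klein group; [b1] and [b3] are the exponents of 1 and 3 in x. *)
Let b1 (x : 'Z_(2 ^ 2)) : nat := ((x == 1) || (x == 2%:R)).
Let b3 (x : 'Z_(2 ^ 2)) : nat := ((x == 2%:R) || (x == 3%:R)).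

(** A character is a pair of signs at 1 and 3, and multiplication by 3 swaps them: three unordered
    pairs, distinct because q is odd. *)
Lemma num_classes_cyc2_char : q <> 2%N ->
  num_classes (@char_data q (cyc_brace p2 true)) (@char_equiv q _) 3.
Proof.
move=> q2; pose V (t : 'F_q * 'F_q) := t.1 ^+ 2 = 1 /\ t.2 ^+ 2 = 1.
pose R (t u : 'F_q * 'F_q) := t = u \/ t = (u.2, u.1).
pose G (t : 'F_q * 'F_q) (chi : cyc_brace p2 true -> 'F_q) :=
  V t /\ forall x : 'Z_(2 ^ 2), chi x = t.1 ^+ b1 x * t.2 ^+ b3 x.
have n11 : 1 != -1 :> 'F_q.
  rewrite -subr_eq0 opprK -(natrD _ 1 1) Fp_natr_eq0 // dvdn_prime2 //.
  exact/eqP.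
suff : num_classes V R 3.
  apply: (num_classes_graph (G := G)) => [t Vt|chi chiP|t t' chi chi' [[t1 t2] chiE] [[t'1 t'2] chi'E]].
  - exists (fun x => t.1 ^+ b1 x * t.2 ^+ b3 x) => //.
    have t0 (z : 'F_q) n : z ^+ 2 = 1 -> z ^+ n != 0.
      by move=> z2; rewrite expf_neq0 // -unitfE -(@unitrX_pos _ _ 2%N) // z2 unitr1.
    case: Vt => t1 t2; split=> x; last by rewrite mulf_neq0 // t0.
    move=> y; rewrite cyc_mulE mulrACA -!exprD.
    have exprm (z : 'F_q) m n : z ^+ 2 = 1 -> m = n %[mod 2] -> z ^+ m = z ^+ n.
      by move=> zp mn; rewrite -(expr_mod _ zp) mn expr_mod.
    congr (_ * _); apply: exprm => //; by case: (Z4E x) => ->; case: (Z4E y) => ->.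
  - have chi0 := char_data0 chiP; have [chiM _] := chiP.
    have M (x y : 'Z_(2 ^ 2)) : chi (x + (1 + (2 * true)%:R * x) * y) = chi x * chi y.
      by rewrite -chiM.
    have c1 : chi (1 : 'Z_(2 ^ 2)) ^+ 2 = 1.
      by rewrite expr2 -M -[RHS]chi0; congr chi; apply: val_inj.
    have c3 : chi (3%:R : 'Z_(2 ^ 2)) ^+ 2 = 1.
      by rewrite expr2 -M -[RHS]chi0; congr chi; apply: val_inj.
    exists (chi (1 : 'Z_(2 ^ 2)), chi (3%:R : 'Z_(2 ^ 2))); first by [].
    split=> // x; rewrite /b1 /b3 /=; case: (Z4E x) => -> /=.
    + by rewrite !expr0 mulr1 chi0.
    + by rewrite expr1 expr0 mulr1.
    + by rewrite !expr1 -M; congr chi; apply: val_inj.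
    + by rewrite expr0 expr1 mul1r.
  - have chiEs (s : 'F_q * 'F_q) (ch : cyc_brace p2 true -> 'F_q) :
        (forall x : 'Z_(2 ^ 2), ch x = s.1 ^+ b1 x * s.2 ^+ b3 x) ->
        ch (1 : 'Z_(2 ^ 2)) = s.1 /\ ch (3%:R : 'Z_(2 ^ 2)) = s.2.
      by move=> chE; rewrite !chE /b1 /b3 /= !expr0 !expr1 mulr1 mul1r.
    have [c1 c3] := chiEs _ _ chiE; have [c'1 c'3] := chiEs _ _ chi'E.
    split=> [[f fa ff]|].
      have [u [uu _] fE] := cyc_aut fa.
      have f1 := ff (1 : 'Z_(2 ^ 2)); have f3 := ff (3%:R : 'Z_(2 ^ 2)).
      rewrite c1 fE mulr1 in f1; rewrite c3 fE in f3.
      case: (Z4E u) uu f1 f3 => -> // _.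
        by rewrite c'1 mul1r c'3 => f1 f3; left; rewrite [t]surjective_pairing f1 f3 -surjective_pairing.
      have -> : 3%:R * 3%:R = 1 :> 'Z_(2 ^ 2) by apply: val_inj.
      by rewrite c'1 c'3 => f1 f3; right; rewrite [t]surjective_pairing f1 f3.
    case=> tE.
      by exists id; [apply: brace_aut_id | move=> x; rewrite chiE chi'E tE].
    exists ( *%R (3%:R : 'Z_(2 ^ 2))).
      by apply: cyc_autV; [ | apply: val_inj].
    move=> x; rewrite chiE chi'E tE /= mulrC.
    by case: (Z4E x) => ->.
have sq1 (z : 'F_q) : z ^+ 2 = 1 -> z = 1 \/ z = -1.
  by move/eqP; rewrite -[X in _ == X](expr1n _ 2) eqf_sqr => /orP[] /eqP; [left|right].
apply: (@num_classesU _ _ (fun t => t.1 == t.2) _ 2 1).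
- by move=> t u _ _ [->|->] //=; rewrite eq_sym.
- apply: (@num_classesU _ _ (fun t => t.1 == 1) _ 1 1).
  + by move=> t u [_ /eqP te] [_ /eqP ue] [->|->] //=; rewrite ue.
  + apply: (num_classes1 (t0 := (1, 1))); first by rewrite /V /= !expr1n eqxx.
    by move=> [a b] [[_ /= /eqP <-] /eqP->]; left.
  + apply: (num_classes1 (t0 := (-1, -1))).
      by rewrite /V /= sqrrN expr1n eq_sym n11.
    by move=> [a b] [[[/= a1 _] /= /eqP <-]]; case: (sq1 _ a1) => -> //; left.
- apply: (num_classes1 (t0 := (1, -1))); first by rewrite /V /= sqrrN !expr1n n11.
  move=> [a b] [[/= a1 b1']]; case: (sq1 _ a1) => ->; case: (sq1 _ b1') => -> //=; rewrite ?eqxx // => _.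
    by left.
  by right.
Qed.

End Two.

(** * Brace automorphisms of order q *)

Lemma aut_data_brace_aut (q : nat) (P : leftBraceType) (al : P -> P) :
  prime q -> aut_data q al -> brace_aut al.
Proof.
move=> pq [alD alL alq]; split=> //.
have qE : q = q.-1.+1 by rewrite prednK ?prime_gt0.
by exists (iter q.-1 al) => x; [rewrite -iterSr -qE | rewrite -iterS -qE].
Qed.

Section CyclicAut.
Variables (p q : nat) (k : bool).
Hypotheses (pp : prime p) (pq : prime q) (npq : p <> q).
Notation Z := 'Z_(p ^ 2).
Notation P := (cyc_brace pp k).
Notation pk := ((p * k)%:R : Z).
Let p21 : (1 < p ^ 2)%N := p2_gt1 pp.

Definition pow_equiv (R : pzRingType) (a b : R) := exists2 c : nat, ~~ (q %| c)%N & a = b ^+ c.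

Lemma iter_mulZ (c : Z) n (x : Z) : iter n ( *%R c) x = c ^+ n * x.
Proof. by elim: n => [|n IH]; [rewrite expr0 mul1r | rewrite iterS IH mulrA exprS]. Qed.

(** Automorphisms are multiplications and commute, so conjugation disappears and only the choice of
    a generator remains. *)
Lemma num_classes_cyc_aut N :
  num_classes (fun c : Z => c ^+ q = 1 /\ pk * c = pk) (@pow_equiv Z) N ->
  num_classes (@aut_data q P) (@aut_equiv q P) N.
Proof.
pose G (c : Z) (al : P -> P) := forall x : Z, al x = c * x.
apply: (num_classes_graph (G := G)) => [c [cq pc]|al alP|c c' al al' alE al'E].
- have uc : c \is a GRing.unit by rewrite -(unitrX_pos _ (prime_gt0 pq)) cq unitr1.
  have [_ cD cL] := cyc_autV pp uc pc.
  by exists ( *%R c) => //; split=> // x; rewrite iter_mulZ cq mul1r.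
- have [c [uc pc] alE] := cyc_aut (aut_data_brace_aut pq alP).
  exists c => //; split=> //; have [_ _ alq] := alP.
  have := alq (1 : Z); rewrite (eq_iter (f' := *%R c) alE) iter_mulZ mulr1 //.
split=> [[f fa [n qn fal]]|[n qn cE]].
  have [u [uu _] fE] := cyc_aut fa; exists n => //.
  have := fal (1 : Z); rewrite alE !fE (eq_iter (f' := *%R c') al'E) iter_mulZ !mulr1 mulrC.
  by move/(mulIr uu).
exists id; first exact: brace_aut_id.
by exists n => // x; rewrite alE (eq_iter (f' := *%R c') al'E) iter_mulZ cE.
Qed.

Lemma Zp2_expp (d : Z) : (d = 1 %[mod p])%N -> d ^+ p = 1.
Proof.
move=> d1; have -> : d = 1 + p%:R * (d %/ p)%N%:R.
  rewrite -{1}[d]natr_Zp {1}(divn_eq d p) d1 modn_small ?prime_gt1 //.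
  by rewrite natrD natrM addrC mulrC.
set P := p%:R * _; have PP : P * P = 0.
  by rewrite /P mulrACA -natrM -[(p * p)%N]/(p ^ 2)%N Zp2_p2 // mul0r.
have PX n : (1 + P) ^+ n = 1 + n%:R * P.
  elim: n => [|n IH]; first by rewrite expr0 mul0r addr0.
  rewrite exprS IH -natr1.
  have -> : (1 + P) * (1 + n%:R * P) = 1 + (n%:R + 1) * P + n%:R * (P * P) by ring.
  by rewrite PP mulr0 addr0.
by rewrite PX /P mulrA -natrM -[(p * p)%N]/(p ^ 2)%N Zp2_p2 // mul0r addr0.
Qed.

(** Units that are 1 mod p have order dividing p, which is prime to q; so q-torsion is detected by
    its residue mod p. *)
Lemma Zp2_expq_eq1 (d : Z) : (d = 1 %[mod p])%N -> d ^+ q = 1 -> d = 1.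
Proof.
move=> d1 dq; apply: (@expr_coprime_eq1 _ p q) => //; last exact: Zp2_expp.
by rewrite prime_coprime // dvdn_prime2 //; apply/eqP.
Qed.

Lemma count_cyc_aut1 : k \/ ~~ (q %| p.-1)%N ->
  num_classes (fun c : Z => c ^+ q = 1 /\ pk * c = pk) (@pow_equiv Z) 1.
Proof.
move=> h; apply: (num_classes1 (t0 := 1)) => [|c [cq pc]].
  by rewrite expr1n mulr1.
exists 1%N; first by rewrite dvdn1 neq_ltn prime_gt1 ?orbT.
rewrite expr1; case: h => [kT|nq]; last exact (Zp2_unit_order pp pq npq cq nq).
apply: Zp2_expq_eq1 cq; apply/eqP.
have := Zp2_mulp_eq pp c 1; move: pc; rewrite kT muln1 => ->; rewrite mulr1 eqxx => /esym.
by rewrite (val_Zp_nat p21 1) (modn_small p21).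
Qed.

Let red (x : Z) : 'F_p := (x : nat)%:R.

Let redN n : red n%:R = n%:R.
Proof.
rewrite /red val_Zp_nat //; apply: val_inj => /=.
by rewrite !val_Fp_nat // modn_dvdm // dvdn_exp.
Qed.

Let redM x y : red (x * y) = red x * red y.
Proof. by rewrite -[x in LHS]natr_Zp -[y in LHS]natr_Zp -natrM redN natrM. Qed.

Let redX x n : red (x ^+ n) = red x ^+ n.
Proof. by elim: n => [|n IH]; [exact: (redN 1) | rewrite !exprS redM IH]. Qed.

Let red1 x : red x = 1 -> (x = 1 %[mod p])%N.
Proof.
by move=> x1; rewrite -(val_Fp_nat pp) -/(red x) x1 -[RHS](val_Fp_nat pp).
Qed.

Lemma count_cyc_aut2 : ~~ k -> (q %| p.-1)%N ->
  num_classes (fun c : Z => c ^+ q = 1 /\ pk * c = pk) (@pow_equiv Z) 2.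
Proof.
move=> /negbTE k0 qp; have [w wq] := Fp_prim_root pp qp.
have wq1 := prim_expr_order wq.
have wp : w ^+ p = w by have := expf_card w; rewrite card_Fp.
(* The p-th power of a lift of [w] is a q-th root of unity modulo p^2, and it still reduces to [w]
   because w^p = w. *)
pose e : Z := (w : nat)%:R ^+ p.
have rede : red e = w by rewrite /e redX redN natr_Zp.
have eq1 : e ^+ q = 1.
  rewrite -exprM mulnC exprM; apply/Zp2_expp/red1.
  by rewrite redX redN natr_Zp.
apply: (@num_classesU _ _ (fun c : Z => c == 1) _ 1 1).
- move=> c c' [cq _] [c'q _] [n qn ->]; apply/eqP/eqP => [c'n|->]; last exact: expr1n.
  by apply: (@expr_coprime_eq1 _ q n); rewrite ?prime_coprime.
- apply: (num_classes1 (t0 := 1)) => [|c [_ /eqP->]].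
    by rewrite expr1n k0 muln0 mul0r.
  exists 1%N; last by rewrite expr1n.
  by rewrite dvdn1 neq_ltn prime_gt1 ?orbT.
apply: (num_classes1 (t0 := e)).
  rewrite k0 muln0 mul0r; split=> //; apply/eqP => e1.
  have := prim_order_dvd wq 1; rewrite -rede e1 -[1 : Z]/(1%:R) redN !expr1 eqxx dvdn1.
  by move/eqP => q1; move: pq; rewrite q1.
move=> c [[cq _] c1].
have [i cE] := prim_rootP wq (etrans (esym (redX c q)) (etrans (congr1 red cq) (redN 1))).
(* Both sides reduce to w^i, and their quotient is q-torsion. *)
have ec : c = e ^+ i.
  have d1 : c * e ^+ (q - i) = 1.
    apply: Zp2_expq_eq1; last by rewrite exprMn cq mul1r -exprM mulnC exprM eq1 expr1n.
    apply: red1; rewrite redM redX rede cE -exprD subnKC ?wq1 //; exact: ltnW.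
  by rewrite -[LHS]mulr1 -eq1 -{1}(subnK (ltnW (ltn_ord i))) exprD mulrA d1 mul1r.
exists i => //; apply: contra c1 => /dvdnP[m im].
by rewrite ec im mulnC exprM eq1 expr1n.
Qed.

End CyclicAut.

(** * Automorphisms of elementary braces as matrices of order dividing q *)

Section ElementaryAut.
Variables (p q : nat) (k : bool).
Hypotheses (pp : prime p) (pq : prime q) (npq : p <> q).
Notation F := 'F_p.
Notation P := (elem_brace p k).

Definition mx_data (M : 'M[F]_2) := M ^+ q = 1 /\ elem_aut_mx k M.

Definition mx_equiv (M N : 'M[F]_2) :=
  exists2 U, elem_aut_mx k U & exists2 c : nat, ~~ (q %| c)%N & M *m U = U *m N ^+ c.

Lemma num_classes_elem_aut N :
  num_classes mx_data mx_equiv N ->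
  num_classes (@aut_data q P) (@aut_equiv q P) N.
Proof.
pose G (M : 'M[F]_2) (al : P -> P) := forall x : 'rV[F]_2, al x = x *m M.
have iterE M al n x : G M al -> iter n al x = (x : 'rV[F]_2) *m M ^+ n.
  by move=> alE; rewrite (eq_iter (f' := fun x : 'rV[F]_2 => x *m M) alE) iter_mulmx.
apply: (num_classes_graph (G := G)) => [M [Mq Ma]|al alP|M M' al al' alE al'E].
- have [_ MD ML] := elem_autV Ma.
  exists (fun x : 'rV[F]_2 => x *m M) => //; split=> // x.
  by rewrite (iterE M) // Mq mulmx1.
- have [M Ma alE] := elem_aut (aut_data_brace_aut pq alP).
  exists M => //; split=> //; have [_ _ alq] := alP.
  by apply: mulmx_rV_inj => x; rewrite -(iterE _ _ q x alE) alq mulmx1.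
split=> [[f fa [n qn fal]]|[U Ua [n qn MU]]].
  have [U Ua fE] := elem_aut fa; exists U => //; exists n => //.
  apply: mulmx_rV_inj => x; have := fal x.
  by rewrite alE fE (iterE M') // fE !mulmxA.
exists (fun x : 'rV[F]_2 => x *m U); first exact: elem_autV.
by exists n => // x; rewrite alE (iterE M') // -!mulmxA MU.
Qed.

Lemma elem_aut_mx1 : elem_aut_mx k (1 : 'M[F]_2).
Proof. by split; rewrite ?unitmx1 // !mxE /= expr1n. Qed.

Lemma mx_equiv_eq1 (M N : 'M[F]_2) : mx_data M -> mx_data N -> mx_equiv M N -> (M == 1) = (N == 1).
Proof.
move=> [Mq _] [Nq _] [U [uU _] [c qc MU]]; apply/eqP/eqP => [M1|N1].
  apply: (@expr_coprime_eq1 _ q c) => //; first by rewrite prime_coprime.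
  by apply: (can_inj (mulKmx uU)); rewrite -MU M1 mul1mx mulmx1.
by apply: (can_inj (mulmxK uU)); rewrite MU N1 expr1n mul1mx mulmx1.
Qed.

Lemma num_classes_mx1 : num_classes (fun M => mx_data M /\ M == 1) mx_equiv 1.
Proof.
apply: (num_classes1 (t0 := 1)) => [|M [_ /eqP->]].
  by split; [split; [rewrite expr1n | exact: elem_aut_mx1] | ].
exists 1; first exact: elem_aut_mx1.
exists 1%N; last by rewrite expr1n.
by rewrite dvdn1 neq_ltn prime_gt1 ?orbT.
Qed.

Lemma num_classes_mx_triv :
  (forall M, mx_data M -> M = 1) -> num_classes mx_data mx_equiv 1.
Proof.
move=> h; apply: (num_classes_iff _ num_classes_mx1) => M.
by split=> [[]|Mq] //; split=> //; apply/eqP/h.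
Qed.

Lemma pow_p_unipotent (K : 'M[F]_2) : K *m K = 0 -> (1 + K) ^+ p = 1.
Proof.
move=> KK; have KX n : (1 + K) ^+ n = 1 + K *+ n.
  elim: n => [|n IH]; first by rewrite expr0 mulr0n addr0.
  rewrite exprSr IH mulrDr mulr1 mulrDl mul1r mulrnAl.
  by rewrite -[K * K]/(K *m K) KK mul0rn addr0 -addrA -mulrSr.
by rewrite KX -scaler_nat pchar_Fp_0 // scale0r addr0.
Qed.

(** Such an M also satisfies M^p = 1, and p is prime to q. *)
Lemma mx_unipotent_order (M : 'M[F]_2) : M ^+ q = 1 -> (M - 1) *m (M - 1) = 0 -> M = 1.
Proof.
move=> Mq KK; apply: (@expr_coprime_eq1 _ p q) => //.
  by rewrite prime_coprime // dvdn_prime2 //; apply/eqP.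
by have := pow_p_unipotent KK; rewrite addrC subrK.
Qed.

End ElementaryAut.

(** * Automorphisms of the nontrivial elementary brace *)

Section CountNontrivial.
Variables (p q : nat).
Hypotheses (pp : prime p) (pq : prime q) (npq : p <> q).
Notation F := 'F_p.

Let low (v w : F) := mx2 (v ^+ 2) 0 w v.

Let lowE (M : 'M[F]_2) : elem_aut_mx true M -> M = low (M 1 1) (M 1 0).
Proof. by move=> [_ /(_ isT)[M01 M00]]; rewrite -[LHS]mx2K M01 M00. Qed.

Let lowX v w n : (low v w ^+ n) 1 1 = v ^+ n.
Proof.
suff : (low v w ^+ n) 0 1 = 0 /\ (low v w ^+ n) 1 1 = v ^+ n by case.
elim: n => [|n [IH0 IH1]]; first by rewrite !expr0 !mxE.
rewrite exprSr; split; rewrite -[_ * low v w]/(_ *m low v w) mulmx2E ?IH1 ?IH0 !mxE /=;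
  rewrite ?exprSr; ring.
Qed.

Let low1 v w : low v w ^+ q = 1 -> v ^+ q = 1.
Proof. by rewrite -(lowX v w) => ->; rewrite mxE. Qed.

Let low_unip w : low 1 w ^+ q = 1 -> low 1 w = 1.
Proof.
move=> Mq; apply: (mx_unipotent_order pp pq npq Mq).
by apply: matrixP2; rewrite mulmx2E !mxE /=; ring.
Qed.

(** The diagonal entry v satisfies v^q = 1, so v = 1 and M is unipotent. *)
Lemma count_elem_nontriv_aut1 : ~~ (q %| p.-1)%N ->
  num_classes (@mx_data p q true) (@mx_equiv p q true) 1.
Proof.
move=> nq; apply: (num_classes_mx_triv pq) => M [Mq Ma].
rewrite (lowE Ma) in Mq *; have vq := low1 Mq.
have v0 : M 1 1 != 0 by rewrite -unitfE -(unitrX_pos _ (prime_gt0 pq)) vq unitr1.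
have v1 : M 1 1 = 1.
  by apply: expr_coprime_eq1 vq (Fp_expr_pred pp v0); rewrite prime_coprime.
by rewrite v1 in Mq *; apply: low_unip.
Qed.

(** A nontrivial solution has v different from 1, so its eigenvalues v^2 and v differ and it is
    diagonalised within the automorphism group. *)
Lemma count_elem_nontriv_aut2 : (q %| p.-1)%N ->
  num_classes (@mx_data p q true) (@mx_equiv p q true) 2.
Proof.
move=> qp; have [w wq] := Fp_prim_root pp qp.
have wq1 := prim_expr_order wq.
have w0 : w != 0 by rewrite -unitfE -(unitrX_pos _ (prime_gt0 pq)) wq1 unitr1.
have lowXd v n : low v 0 ^+ n = low (v ^+ n) 0.
  elim: n => [|n IH]; first by rewrite !expr0; apply: matrixP2; rewrite !mxE //= expr1n.
  rewrite exprS IH -[_ * low _ _]/(_ *m low _ _) mul_mx2 [v ^+ n.+1]exprS /low.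
  by move: (v ^+ n) => y; congr mx2; ring.
apply: (@num_classesU _ _ (fun M : 'M[F]_2 => M == 1) _ 1 1).
- by move=> M N; apply: mx_equiv_eq1.
- exact: num_classes_mx1.
apply: (num_classes1 (t0 := low w 0)) => [|M [[Mq Ma] M1]].
  split.
    split; first by rewrite lowXd wq1; apply: matrixP2; rewrite !mxE //= expr1n.
    split; last by rewrite !mxE.
    by rewrite unitmxE unitfE det_mx2 mul0r subr0 -exprSr expf_neq0.
  apply/eqP => /(congr1 (fun A : 'M[F]_2 => A 1 1)); rewrite !mxE /= => w1.
  have := prim_order_dvd wq 1; rewrite expr1 w1 eqxx dvdn1 => /eqP q1.
  by move: pq; rewrite q1.
rewrite (lowE Ma) in Mq M1 *; have [i vE] := prim_rootP wq (low1 Mq).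
set v := M 1 1 in vE Mq M1 *; set t := M 1 0 in Mq M1 *.
have v1 : v != 1.
  by apply: contra M1 => /eqP v1; rewrite v1 in Mq *; apply/eqP/low_unip.
have v0 : v != 0 by rewrite vE expf_neq0.
have d0 : v ^+ 2 - v != 0.
  have -> : v ^+ 2 - v = v * (v - 1) by ring.
  by rewrite mulf_neq0 // subr_eq0.
(* The lower entry s of the conjugating matrix must satisfy t + v s = s v^2. *)
exists (low 1 (t / (v ^+ 2 - v))).
  split; last by rewrite !mxE.
  by rewrite unitmxE unitfE det_mx2 expr1n mul0r subr0 mulr1 oner_neq0.
exists i.
  by apply: contra v1 => /dvdnP[m im]; rewrite vE im mulnC exprM wq1 expr1n.
rewrite lowXd -vE !mul_mx2 /low; congr mx2; try ring.
by field.
Qed.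

End CountNontrivial.

(** * Diagonalising matrices of order dividing q *)

Section Diagonalization.
Variables (K : fieldType) (q : nat) (z : K).
Hypotheses (zq : q.-primitive_root z).

Lemma mx2_diagX (a b : K) n : mx2 a 0 0 b ^+ n = mx2 (a ^+ n) 0 0 (b ^+ n).
Proof.
elim: n => [|n IH]; first by rewrite !expr0; apply: matrixP2; rewrite !mxE.
by rewrite exprSr IH -[_ * mx2 _ _ _ _]/(_ *m mx2 _ _ _ _) mul_mx2 !exprSr; congr mx2; ring.
Qed.

(** X^q - 1 annihilates M and has the q distinct roots z^i. *)
Lemma mx2_diagonalize (M : 'M[K]_2) : M ^+ q = 1 ->
  exists U (i j : 'I_q), U \in unitmx /\ M *m U = U *m mx2 (z ^+ i) 0 0 (z ^+ j).
Proof.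
move=> Mq; have q0 := prim_order_gt0 zq.
have [_] := mxpoly.diagonalizableP M.
case.
  exists [seq z ^+ i | i <- index_iota 0 q].
    rewrite map_inj_in_uniq ?iota_uniq // => i j; rewrite !mem_index_iota => iq jq.
    by move/eqP; rewrite (eq_prim_root_expr zq) !modn_small // => /eqP.
  rewrite big_map (factor_Xn_sub_1 zq) dvd_mxminpoly rmorphB rmorphXn /= horner_mx_X Mq rmorph1.
  by rewrite subrr.
move=> V uV /mxpoly.diagonalizable_forP-/(_ uV) D.
pose E := V *m M *m invmx V.
have E01 : E 0 1 = 0 by apply: D.
have E10 : E 1 0 = 0 by apply: D.
have EE : E = mx2 (E 0 0) 0 0 (E 1 1) by rewrite -[LHS]mx2K E01 E10.
have EX n : E ^+ n = V *m M ^+ n *m invmx V.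
  elim: n => [|n IH]; first by rewrite !expr0 mulmx1 mulmxV.
  rewrite !exprSr IH -[_ * E]/(_ *m E) /E !mulmxA mulmxKV //.
have Eq : E ^+ q = 1 by rewrite EX Mq mulmx1 mulmxV.
have [i iE] : exists i : 'I_q, E 0 0 = z ^+ i.
  have [|i ->] := @prim_rootP _ _ _ zq (E 0 0); last by exists i.
  by have := congr1 (fun A : 'M[K]_2 => A 0 0) Eq; rewrite EE mx2_diagX !mxE.
have [j jE] : exists j : 'I_q, E 1 1 = z ^+ j.
  have [|j ->] := @prim_rootP _ _ _ zq (E 1 1); last by exists j.
  by have := congr1 (fun A : 'M[K]_2 => A 1 1) Eq; rewrite EE mx2_diagX !mxE.
exists (invmx V), i, j; split; first by rewrite unitmx_inv.
by rewrite -iE -jE -EE /E !mulmxA mulVmx // mul1mx.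
Qed.

End Diagonalization.

(** The sum can only be 0 or n, so both terms are 0 or both are n / 2. This separates
    representatives of exponents mod n up to sign. *)
Lemma half_sum_eq (e f n m : nat) :
  (0 < n)%N -> (e <= n./2)%N -> (f <= n./2)%N -> (e + f = m * n)%N -> e = f.
Proof. by case: m => [|[|m]]; first lia; first lia; nia. Qed.

Lemma half_lt (e n : nat) : (0 < n)%N -> (e <= n./2)%N -> (e < n)%N.
Proof. by lia. Qed.

Lemma half_rev (e n : nat) : (n./2 < e)%N -> (n - e < n./2.+1)%N.
Proof. by lia. Qed.

(** * Automorphisms of the trivial elementary brace, eigenvalues in F_p *)

Section CountTrivial.
Variables (p q : nat).
Hypotheses (pp : prime p) (pq : prime q) (npq : p <> q).
Notation F := 'F_p.

Lemma elem_aut_mx_false (M : 'M[F]_2) : M \in unitmx -> elem_aut_mx false M.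
Proof. by split. Qed.

Lemma unitmx_root (M : 'M[F]_2) : M ^+ q = 1 -> M \in unitmx.
Proof.
by move=> Mq; change (M \is a GRing.unit); rewrite -(unitrX_pos _ (prime_gt0 pq)) Mq unitr1.
Qed.

Lemma count_elem_triv_aut1 : ~~ (q %| p ^ 2 - 1)%N ->
  num_classes (@mx_data p q false) (@mx_equiv p q false) 1.
Proof.
move=> nq; apply: (num_classes_mx_triv pq) => M [Mq _].
exact: (rV2_order pp pq npq Mq nq).
Qed.

Let dg (a b : F) := mx2 a 0 0 b.

Let dgX a b n : dg a b ^+ n = dg (a ^+ n) (b ^+ n).
Proof. exact: mx2_diagX. Qed.

(** An invertible [U] has both diagonal or both off-diagonal entries nonzero, and each nonzero entry
    equates two eigenvalues. *)
Lemma dg_intertwine (a b c d : F) (U : 'M[F]_2) :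
  U \in unitmx -> dg a b *m U = U *m dg c d ->
  (a = c /\ b = d) \/ (a = d /\ b = c).
Proof.
rewrite unitmxE unitfE det_mx2E -[U]mx2K !mul_mx2 !mxE /= => du e.
have e00 := congr1 (fun A : 'M[F]_2 => A 0 0) e.
have e01 := congr1 (fun A : 'M[F]_2 => A 0 1) e.
have e10 := congr1 (fun A : 'M[F]_2 => A 1 0) e.
have e11 := congr1 (fun A : 'M[F]_2 => A 1 1) e.
rewrite !mxE /= !mulr0 !mul0r !addr0 !add0r in e00 e01 e10 e11.
have canc (x y u : F) : x * u = u * y -> u != 0 -> x = y.
  by rewrite mulrC => xy u0; apply: (mulfI u0).
have [u00|u00] := eqVneq (U 0 0) 0.
  right; have : U 0 1 * U 1 0 != 0 by move: du; rewrite u00 mul0r sub0r oppr_eq0.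
  by rewrite mulf_eq0 negb_or => /andP[h1 h2]; split; [apply: canc e01 h1 | apply: canc e10 h2].
have [u11|u11] := eqVneq (U 1 1) 0.
  right; have : U 0 1 * U 1 0 != 0 by move: du; rewrite u11 mulr0 sub0r oppr_eq0.
  by rewrite mulf_eq0 negb_or => /andP[h1 h2]; split; [apply: canc e01 h1 | apply: canc e10 h2].
by left; split; [apply: canc e00 u00 | apply: canc e11 u11].
Qed.

Section Split.
Hypothesis qp : (q %| p.-1)%N.

Let q1 := prime_gt1 pq.
Let swap : 'M[F]_2 := mx2 0 1 1 0.

Let uswap : swap \in unitmx.
Proof. by rewrite unitmxE det_mx2 mul0r mul1r sub0r unitrN1. Qed.

Lemma dg_swap a b : dg a b *m swap = swap *m dg b a.
Proof. by rewrite !mul_mx2; congr mx2; ring. Qed.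

Lemma dg_eq1 a b : (dg a b == 1) = (a == 1) && (b == 1).
Proof.
apply/eqP/andP => [e|[/eqP-> /eqP->]]; last by apply: matrixP2; rewrite !mxE.
have := congr1 (fun A : 'M[F]_2 => A 0 0) e; have := congr1 (fun A : 'M[F]_2 => A 1 1) e.
by rewrite !mxE /= => -> ->; rewrite eqxx.
Qed.

(* An element with eigenvalues w^i, w^j, both nontrivial, is up to powers
   diag(w, w^m) with m = j / i nonzero mod q, and m may be replaced by 1 / m. For
   a generator g of F_q^*, the m = g^e with 2e <= q - 1 represent these classes. *)
Lemma count_elem_triv_aut_split :
  num_classes (@mx_data p q false) (@mx_equiv p q false) (1 + (1 + (q.-1)./2.+1)).
Proof.
have [w wq] := Fp_prim_root pp qp; have wq1 := prim_expr_order wq.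
have [g gq] := Fp_prim_root pq (dvdnn q.-1).
have q10 : (0 < q.-1)%N by rewrite -ltnS prednK // ltnW.
have g0 : g != 0.
  by rewrite -unitfE -(unitrX_pos _ q10) (prim_expr_order gq) unitr1.
have w0 : w != 0 by rewrite -unitfE -(unitrX_pos _ (prime_gt0 pq)) wq1 unitr1.
have w1 : w != 1.
  by rewrite -[w]expr1 -(prim_order_dvd wq) dvdn1 neq_ltn q1 orbT.
have wX (a b : 'F_q) : (w ^+ a == w ^+ b) = (a == b).
  by rewrite (eq_prim_root_expr wq) !modn_small ?ltn_Fp.
have wX1 (a : 'F_q) : (w ^+ a == 1) = (a == 0) by rewrite -(expr0 w) (wX _ 0).
have dataE a b : a ^+ q = 1 -> b ^+ q = 1 -> mx_data q false (dg a b).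
  move=> aq bq; have e : dg a b ^+ q = 1 by rewrite dgX aq bq; apply/eqP; rewrite dg_eq1 !eqxx.
  by split; [exact: e | apply/elem_aut_mx_false/unitmx_root].
have diag (M : 'M[F]_2) : M ^+ q = 1 -> 
    exists U (a b : 'F_q), U \in unitmx /\ M *m U = U *m dg (w ^+ a) (w ^+ b).
  move=> Mq; have [U [i [j [uU MU]]]] := mx2_diagonalize wq Mq.
  by exists U, i%:R, j%:R; rewrite !expr_Fp_nat.
(* Vanishing of det(M - 1) says that 1 is an eigenvalue; this invariant isolates the class of
   diag(w, 1). *)
have detM (M U D : 'M[F]_2) : U \in unitmx -> M *m U = U *m D -> \det (M - 1) = \det (D - 1).
  move=> uU MU; have e : (M - 1) *m U = U *m (D - 1) by rewrite mulmxBl mulmxBr mul1mx mulmx1 MU.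
  have dU : \det U != 0 by move: uU; rewrite unitmxE unitfE.
  by have := congr1 determinant e; rewrite !det_mulmx mulrC => /(mulfI dU).
have detdg a b : \det (dg a b - 1) = (a - 1) * (b - 1).
  by rewrite det_mx2E !mxE /= !subr0 mulr0 subr0.
have q_ndvd (a : 'F_q) : a != 0 -> ~~ (q %| a)%N by rewrite Fp_eq0.
apply: (@num_classesU _ _ (fun M : 'M[F]_2 => M == 1) _ 1 _).
- by move=> M N; apply: mx_equiv_eq1.
- exact: num_classes_mx1.
apply: (@num_classesU _ _ (fun M : 'M[F]_2 => \det (M - 1) == 0) _ 1 _).
- move=> M N [[Mq _] _] [[Nq _] _] [U [uU _] [c qc MU]].
  rewrite (detM _ _ _ uU MU); have [V [a [b [uV NV]]]] := diag _ Nq.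
  have NcV n : N ^+ n *m V = V *m dg (w ^+ a ^+ n) (w ^+ b ^+ n).
    elim: n => [|n IH].
      by rewrite !expr0 mul1mx (eqP (_ : dg 1 1 == 1)) ?mulmx1 // dg_eq1 !eqxx.
    rewrite exprSr -[_ * N]/(_ *m N) -mulmxA NV mulmxA IH -mulmxA -!dgX.
    by rewrite -[dg _ _ ^+ n *m _]/(_ * _) -exprSr.
  rewrite (detM _ _ _ uV NV) (detM _ _ _ uV (NcV c)) !detdg !mulf_eq0 !subr_eq0.
  have x1 (x : F) : x ^+ q = 1 -> (x ^+ c == 1) = (x == 1).
    move=> xq; apply/eqP/eqP => [xc|->]; last exact: expr1n.
    by apply: expr_coprime_eq1 xq xc; rewrite prime_coprime.
  by rewrite !x1 // -exprM mulnC exprM wq1 expr1n.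
- apply: (num_classes1 (t0 := dg w 1)) => [|M [[[Mq Ma] M1] dM]].
    split; last by rewrite detdg subrr mulr0.
    split; last by rewrite dg_eq1 (negbTE w1).
    by apply: dataE; rewrite ?wq1 ?expr1n.
  have [U [a [b [uU MU]]]] := diag _ Mq.
  have nontriv : ~~ ((a == 0) && (b == 0)).
    apply: contra M1 => /andP[/eqP a0 /eqP b0]; apply/eqP.
    apply: (can_inj (mulmxK uU)); rewrite MU a0 b0 !expr0.
    by rewrite (eqP (_ : dg 1 1 == 1)) ?mulmx1 ?mul1mx // dg_eq1 !eqxx.
  move: dM; rewrite (detM _ _ _ uU MU) detdg mulf_eq0 !subr_eq0 !wX1.
  move=> /orP[/eqP a0|/eqP b0].
    rewrite a0 eqxx /= in nontriv; rewrite a0 expr0 in MU.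
    exists (U *m swap); first by apply: elem_aut_mx_false; rewrite unitmx_mul uU.
    exists b; first exact: q_ndvd.
    by rewrite mulmxA MU -!mulmxA dg_swap dgX expr1n.
  rewrite b0 eqxx andbT in nontriv; rewrite b0 expr0 in MU.
  exists U; first exact: elem_aut_mx_false.
  by exists a; [exact: q_ndvd | rewrite MU dgX expr1n].
rewrite -[X in num_classes _ _ X](card_ord (q.-1)./2.+1).
pose D (e : 'I_((q.-1)./2.+1)) := dg w (w ^+ (g ^+ e)%R).
apply: (num_classes_fin (F := D)) => [e|e f|M [[[Mq Ma] M1] dM]].
- have ge0 : g ^+ e != 0 by rewrite expf_neq0.
  have wge : w ^+ (g ^+ e)%R != 1 by rewrite wX1.
  split; last by rewrite detdg mulf_eq0 !subr_eq0 negb_or w1 wge.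
  split; last by rewrite dg_eq1 (negbTE w1).
  by apply: dataE; rewrite ?wq1 // -exprM mulnC exprM wq1 expr1n.
- move=> [U [uU _] [c qc]]; rewrite dgX => /(dg_intertwine uU).
  pose c' : 'F_q := c%:R.
  have eX (m : 'F_q) : w ^+ m ^+ c = w ^+ (c' * m)%R.
    by rewrite mulrC expr_FpM // /c' expr_Fp_nat // -exprM mulnC exprM wq1 expr1n.
  have fE (m n : 'F_q) : w ^+ m = w ^+ n -> m = n by move/eqP; rewrite wX => /eqP.
  have w1E : w = w ^+ (1%R : 'F_q) by rewrite (expr_Fp_nat 1 pq wq1) expr1.
  have wcE : w ^+ c = w ^+ c' by rewrite /c' expr_Fp_nat.
  have := ltn_ord e; have := ltn_ord f; rewrite !ltnS => fle ele.
  rewrite eX wcE => -[[h1 h2]|[h1 h2]].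
    have c1 : 1 = c' by apply: fE; rewrite -w1E.
    move/fE: h2; rewrite -c1 mul1r => /eqP; rewrite (eq_prim_root_expr gq) => /eqP h2.
    by apply: val_inj; rewrite /= -(modn_small (half_lt q10 ele)) h2 (modn_small (half_lt q10 fle)).
  (* Swapped eigenvalues give g^(e + f) = 1, which in the range of e and f forces e = f. *)
  have c1 : 1 = c' * g ^+ f by apply: fE; rewrite -w1E.
  move/fE: h2 => h2; have : g ^+ (e + f) == 1 by rewrite exprD h2 -c1.
  rewrite -(prim_order_dvd gq) => /dvdnP[m mE]; apply: val_inj => /=.
  exact: half_sum_eq q10 ele fle mE.
- have [U [a [b [uU MU]]]] := diag _ Mq.
  move: dM; rewrite (detM _ _ _ uU MU) detdg mulf_eq0 !subr_eq0 !wX1 negb_or => /andP[a0 b0].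
  have b_a0 : b / a != 0 by rewrite mulf_neq0 ?invr_eq0.
  have [i iE] := prim_rootP gq (Fp_expr_pred pq b_a0).
  have expM (m n : 'F_q) : w ^+ m ^+ n = w ^+ (n * m)%R by rewrite mulrC expr_FpM.
  (* Either b / a = g^i has an exponent in range, or a / b does after the eigenvalues are
     exchanged. *)
  have [ile|igt] := leqP i (q.-1)./2.
    have i' : (i < (q.-1)./2.+1)%N by [].
    exists (Ordinal i'); rewrite /D [nat_of_ord (Ordinal _)]/=.
    exists U; first exact: elem_aut_mx_false.
    exists a; first exact: q_ndvd.
    by rewrite MU dgX expM -iE [a * _]mulrC divfK.
  have j' : (q.-1 - i < (q.-1)./2.+1)%N by apply: half_rev.
  exists (Ordinal j'); rewrite /D [nat_of_ord (Ordinal _)]/=; exists (U *m swap).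
    by apply: elem_aut_mx_false; rewrite unitmx_mul uU.
  exists b; first exact: q_ndvd.
  rewrite mulmxA MU -!mulmxA dg_swap dgX expM.
  have -> : g ^+ (q.-1 - i) = a / b; last by rewrite [b * _]mulrC divfK.
  apply: (mulIf b_a0); rewrite {1}iE -exprD subnK ?(prim_expr_order gq); last by apply/ltnW/ltn_ord.
  by rewrite mulrA divfK // mulfV.
Qed.

End Split.
End CountTrivial.

(** * Automorphisms of the trivial elementary brace, eigenvalues outside F_p *)

Section NonSplit.
Variables (p q : nat).
Hypotheses (pp : prime p) (pq : prime q) (npq : p <> q).
Hypotheses (nq : ~~ (q %| p.-1)%N) (qp : (q %| p.+1)%N).
Notation F := 'F_p.

Let Fp_root_eq1 (a : F) : a ^+ q = 1 -> a = 1.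
Proof.
move=> aq; have a0 : a != 0 by rewrite -unitfE -(unitrX_pos _ (prime_gt0 pq)) aq unitr1.
by apply: expr_coprime_eq1 aq (Fp_expr_pred pp a0); rewrite prime_coprime.
Qed.

Let detX (A : 'M[F]_2) n : \det (A ^+ n) = \det A ^+ n.
Proof. by elim: n => [|n IH]; [rewrite !expr0 det1 | rewrite !exprS det_mulmx IH]. Qed.

Let det_root (M : 'M[F]_2) : M ^+ q = 1 -> \det M = 1.
Proof. by move=> Mq; apply: Fp_root_eq1; rewrite -detX Mq det1. Qed.

(** The eigenvalue has order dividing q, hence is 1. Then det(M - 1) = 0, and det M = 1 gives tr(M -
    1) = 0, so M is unipotent. *)
Let no_eigen (M : 'M[F]_2) (v : 'rV[F]_2) (a : F) :
  M ^+ q = 1 -> v != 0 -> v *m M = a *: v -> M = 1.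
Proof.
move=> Mq v0 vM; have vX n : v *m M ^+ n = a ^+ n *: v.
  elim: n => [|n IH]; first by rewrite !expr0 mulmx1 scale1r.
  by rewrite exprSr -[_ * M]/(_ *m M) mulmxA IH -scalemxAl vM scalerA exprSr.
have a1 : a = 1.
  apply: Fp_root_eq1; apply/eqP; rewrite -subr_eq0.
  have : (a ^+ q - 1) *: v == 0 by rewrite scalerBl -vX Mq mulmx1 scale1r subrr.
  by rewrite scaler_eq0 (negbTE v0) orbF.
have detK : \det (M - 1) = 0.
  by apply/eqP/det0P; exists v; rewrite // mulmxBr mulmx1 vM a1 scale1r subrr.
apply: (mx_unipotent_order pp pq npq Mq).
have trK : \tr (M - 1) = 0.
  have detE : \det M = 1 + \tr (M - 1) + \det (M - 1).
    have -> : \tr (M - 1) = (M - 1) 0 0 + (M - 1) 1 1.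
      by rewrite /mxtrace big_ord_recl big_ord1; congr (_ + (M - 1) _ _); exact: val_inj.
    by rewrite !det_mx2E !mxE /=; ring.
  by move: detE; rewrite (det_root Mq) detK addr0 -[LHS]addr0 => /addrI/esym.
by rewrite Cayley_Hamilton2 trK detK scale0r raddf0 subr0.
Qed.

(** The rows are e_0 and e_0 M: the change of basis to the companion matrix of M. *)
Let cyc_mx (M : 'M[F]_2) := mx2 1 0 (M 0 0) (M 0 1).

Let cyc_mx_unit M : M ^+ q = 1 -> M != 1 -> cyc_mx M \in unitmx.
Proof.
move=> Mq M1; rewrite unitmxE unitfE det_mx2 mul1r mul0r subr0; apply: contra M1 => /eqP M01.
apply/eqP; apply: (no_eigen (v := row2 1 0) (a := M 0 0) Mq).
  apply/eqP => /(congr1 (fun v : 'rV[F]_2 => v 0 0))/eqP; rewrite !mxE /=.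
  by rewrite oner_eq0.
by apply: rowP2; rewrite mulmx2E !mxE /= ?M01; ring.
Qed.

(** e_0 is a cyclic vector and det M = 1, so M is similar to the companion matrix of X^2 - tr(M) X +
    1. *)
Let mx_similar (M N : 'M[F]_2) : M ^+ q = 1 -> M != 1 -> N ^+ q = 1 -> N != 1 ->
  \tr M = \tr N -> exists2 U, U \in unitmx & M *m U = U *m N.
Proof.
have comp (A : 'M[F]_2) : A ^+ q = 1 -> cyc_mx A *m A = mx2 0 1 (-1) (\tr A) *m cyc_mx A.
  move=> /det_root; rewrite det_mx2E => detA.
  have trA : \tr A = A 0 0 + A 1 1.
    by rewrite /mxtrace big_ord_recl big_ord1; congr (_ + A _ _); exact: val_inj.
  rewrite trA; apply: matrixP2; rewrite !mulmx2E !mxE /=; try ring.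
  have -> : A 0 1 * A 1 0 = A 0 0 * A 1 1 - 1 by rewrite -detA; ring.
  by ring.
move=> Mq M1 Nq N1 tr_eq.
have uM := cyc_mx_unit Mq M1; have uN := cyc_mx_unit Nq N1.
exists (invmx (cyc_mx M) *m cyc_mx N); first by rewrite unitmx_mul unitmx_inv uM.
apply: (can_inj (mulKmx uM)).
rewrite !mulmxA (mulmxV uM) mul1mx (comp M Mq) -!mulmxA (mulKVmx uM) (comp N Nq) tr_eq.
reflexivity.
Qed.

(** The field of p^2 elements contains the q-th roots of unity, as q divides p + 1. There, by
    determinant 1, M and N have eigenvalues z^i, z^(-i) and z^k, z^(-k); the exponent c = i / k in
    F_q matches them, and equality of traces descends to F_p. *)
Let trace_pow (M N : 'M[F]_2) : M ^+ q = 1 -> M != 1 -> N ^+ q = 1 -> N != 1 ->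
  exists2 c : nat, ~~ (q %| c)%N & \tr M = \tr (N ^+ c).
Proof.
move=> Mq M1 Nq N1.
have [K0 charK cardK] := pPrimePowerField pp (ltn0Sn 1).
pose K : fieldType := pPrimeCharType charK.
pose f : {rmorphism F -> K} := in_alg (pPrimeCharType charK).
have [z zq] : exists z : K, q.-primitive_root z.
  have qp2 : (q %| (p ^ 2).-1)%N.
    by rewrite -subn1 -[1%N in X in (_ %| X)%N](exp1n 2) subn_sqr addn1 dvdn_mull.
  have : has ((p ^ 2).-1).-primitive_root (enum (predC1 (0 : K0))).
    apply: has_prim_root; rewrite ?enum_uniq // -?cardE ?cardC1 ?cardK //.
      by rewrite -ltnS prednK ?(p2_gt1 pp) // ltnW ?(p2_gt1 pp).
    apply/allP => x; rewrite mem_enum => x0; apply/unity_rootP.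
    apply: (mulIf x0); rewrite -exprSr mul1r prednK ?(ltnW (p2_gt1 pp)) //.
    by rewrite -cardK expf_card.
  by move=> /hasP[z _ zp]; exists (z ^+ ((p ^ 2).-1 %/ q)); apply: dvdn_prim_root.
have zq1 := prim_expr_order zq.
pose D i j : 'M[K]_2 := mx2 (z ^+ i) 0 0 (z ^+ j).
have mapX (A : 'M[F]_2) n : map_mx f (A ^+ n) = map_mx f A ^+ n.
  elim: n => [|n IH]; first by rewrite !expr0 map_mx1.
  by rewrite !exprS -IH map_mxM.
have tr_conj (A B U : 'M[K]_2) : U \in unitmx -> A *m U = U *m B -> \tr A = \tr B.
  move=> uU AU; have -> : B = invmx U *m (A *m U) by rewrite AU mulKmx.
  by rewrite mxtrace_mulC mulmxK.
have trD i j : \tr (D i j) = z ^+ i + z ^+ j.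
  by rewrite /mxtrace big_ord_recl big_ord1 !mxE.
have diagK (A : 'M[F]_2) : A ^+ q = 1 -> A != 1 ->
    exists U (i j : 'I_q), [/\ U \in unitmx, map_mx f A *m U = U *m D i j,
      z ^+ (i + j) = 1 & ~~ (q %| i)%N].
  move=> Aq A1; have [|U [i [j [uU AU]]]] := mx2_diagonalize zq (M := map_mx f A).
    by rewrite -mapX Aq map_mx1.
  have zij : z ^+ (i + j) = 1.
    have dU : \det U != 0 by move: uU; rewrite unitmxE unitfE.
    have := congr1 determinant AU; rewrite !det_mulmx mulrC => /(mulfI dU).
    rewrite det_map_mx (det_root Aq) rmorph1 det_mx2 mul0r subr0 -exprD => h.
    exact: esym h.
  exists U, i, j; split => //; apply: contra A1 => qi.
  have zi : z ^+ i = 1 by apply/eqP; rewrite -(prim_order_dvd zq).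
  have zj : z ^+ j = 1 by move: zij; rewrite exprD zi mul1r.
  have AU1 : map_mx f A = 1.
    apply: (can_inj (mulmxK uU)); rewrite AU zi zj mul1mx.
    by have -> : mx2 1 0 0 1 = 1 :> 'M[K]_2 by [apply: matrixP2; rewrite !mxE]; rewrite mulmx1.
  have e : map_mx f A = map_mx f 1 by rewrite AU1 map_mx1.
  apply/eqP/matrixP => a b; apply: (fmorph_inj f).
  by move/matrixP/(_ a b): e; rewrite mxE [map_mx f 1 a b]mxE.
have [U [i [j [uU MU zij qi]]]] := diagK M Mq M1.
have [V [k [l [uV NV zkl qk]]]] := diagK N Nq N1.
pose c' : 'F_q := i%:R / k%:R; exists (c' : nat).
  rewrite -Fp_natr_eq0 // natr_Zp mulf_neq0 ?invr_eq0 // Fp_natr_eq0 //.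
have zkc : z ^+ k ^+ c' = z ^+ i.
  rewrite -[z ^+ k](expr_Fp_nat _ pq zq1) -expr_FpM // mulrC divfK ?Fp_natr_eq0 //.
  by rewrite expr_Fp_nat.
apply: (fmorph_inj f); rewrite -!trace_map_mx mapX.
have NcV n : map_mx f N ^+ n *m V = V *m D (k * n)%N (l * n)%N.
  elim: n => [|n IH].
    rewrite !muln0 expr0 mul1mx.
    by have -> : D 0%N 0%N = 1 by [apply: matrixP2; rewrite !mxE]; rewrite mulmx1.
  rewrite exprS -[map_mx f N * _]/(map_mx f N *m _) -mulmxA IH mulmxA NV -mulmxA mul_mx2.
  congr (V *m mx2 _ _ _ _); rewrite ?mulr0 ?mul0r ?addr0 ?add0r // -exprD mulnS //.
rewrite (tr_conj _ _ _ uU MU) (tr_conj _ _ _ uV (NcV _)) !trD [z ^+ (k * _)%N]exprM zkc.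
congr (_ + _).
have zi0 : z ^+ i != 0.
  by rewrite expf_neq0 // -unitfE -(unitrX_pos _ (prime_gt0 pq)) zq1 unitr1.
apply: (mulfI zi0); rewrite -exprD zij -{1}zkc -exprM -exprD -mulnDl exprM zkl expr1n.
reflexivity.
Qed.

(** Any two nontrivial solutions generate conjugate subgroups: some power of one has the trace of
    the other, and the trace decides similarity. *)
Lemma count_elem_triv_aut_nonsplit :
  num_classes (@mx_data p q false) (@mx_equiv p q false) 2.
Proof.
have [M0 M0q M01] : exists2 M : 'M[F]_2, M ^+ q = 1 & M != 1.
  have [|g _ og] := @Cauchy {'GL_2['F_p]} q [set: {'GL_2['F_p]}]%G pq.
    by rewrite card_GL_2 card_Fp // dvdn_mull.
  have gX n : GLval (g ^+ n)%g = GLval g ^+ n.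
    by elim: n => // n IH; rewrite expgS exprS -IH.
  exists (GLval g); first by rewrite -gX -og expg_order.
  apply/eqP => g1; have : g = 1%g by apply: val_inj.
  by move/eqP; rewrite -order_eq1 og => /eqP q1; move: pq; rewrite q1.
apply: (@num_classesU _ _ (fun M : 'M[F]_2 => M == 1) _ 1 1).
- by move=> M N; apply: mx_equiv_eq1.
- exact: num_classes_mx1.
apply: (num_classes1 (t0 := M0)) => [|M [[Mq _] M1]].
  by split=> //; split=> //; apply/elem_aut_mx_false/(unitmx_root pq M0q).
have [c qc trc] := trace_pow Mq M1 M0q M01.
have Nq : (M0 ^+ c) ^+ q = 1 by rewrite -exprM mulnC exprM M0q expr1n.
have N1 : M0 ^+ c != 1.
  apply: contra M01 => /eqP N1; apply/eqP.
  by apply: expr_coprime_eq1 M0q N1; rewrite prime_coprime.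
have [U uU MU] := mx_similar Mq M1 Nq N1 trc.
by exists U; [exact: elem_aut_mx_false | exists c].
Qed.

End NonSplit.

Local Close Scope ring_scope.

(** * Totals in the arithmetic cases *)

Section Totals.
Variables (p q : nat).
Hypotheses (pp : prime p) (pq : prime q) (npq : p <> q) (n23 : ~ (p = 2 /\ q = 3)).

Lemma num_left_braces_split : q %| p.-1 -> coprime (p ^ 2) q.-1 ->
  num_left_braces (p ^ 2 * q) ((q.-1)./2 + 8).
Proof.
move=> qp cpq.
have -> : (q.-1)./2 + 8 = 2 + 1 + ((1 + (1 + (q.-1)./2.+1)) + 2) by lia.
apply: (@num_left_braces_auts p q pp pq npq n23 _ _ _ _ cpq).
- by apply: num_classes_cyc_aut => //; apply: count_cyc_aut2.
- by apply: num_classes_cyc_aut => //; apply: count_cyc_aut1 => //; left.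
- by apply: num_classes_elem_aut => //; apply: count_elem_triv_aut_split.
- by apply: num_classes_elem_aut => //; apply: count_elem_nontriv_aut2.
Qed.

Lemma num_left_braces_nonsplit : ~~ (q %| p.-1) -> q %| p.+1 -> coprime (p ^ 2) q.-1 ->
  num_left_braces (p ^ 2 * q) 5.
Proof.
move=> nq qp cpq.
apply: (@num_left_braces_auts p q pp pq npq n23 1 1 2 1 cpq).
- by apply: num_classes_cyc_aut => //; apply: count_cyc_aut1 => //; right.
- by apply: num_classes_cyc_aut => //; apply: count_cyc_aut1 => //; left.
- by apply: num_classes_elem_aut => //; apply: count_elem_triv_aut_nonsplit.
- by apply: num_classes_elem_aut => //; apply: count_elem_nontriv_aut1.
Qed.

Lemma num_left_braces_direct : ~~ (q %| p ^ 2 - 1) -> coprime (p ^ 2) q.-1 ->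
  num_left_braces (p ^ 2 * q) 4.
Proof.
move=> nq cpq; have nq1 : ~~ (q %| p.-1).
  have e : p ^ 2 - 1 = p.-1 * (p + 1) by rewrite -subn1 -subn_sqr exp1n.
  by move: nq; rewrite e; apply: contra => /dvdn_mulr->.
apply: (@num_left_braces_auts p q pp pq npq n23 1 1 1 1 cpq).
- by apply: num_classes_cyc_aut => //; apply: count_cyc_aut1 => //; right.
- by apply: num_classes_cyc_aut => //; apply: count_cyc_aut1 => //; left.
- by apply: num_classes_elem_aut => //; apply: count_elem_triv_aut1.
- by apply: num_classes_elem_aut => //; apply: count_elem_nontriv_aut1.
Qed.

Lemma num_left_braces_odd : ~~ (q %| p ^ 2 - 1) -> p %| q.-1 -> odd p ->
  num_left_braces (p ^ 2 * q)
    ((1 + (1 + (p ^ 2 %| q.-1))) + (p + (if p ^ 2 %| q.-1 then p.-1 else 0)) + (2 + 4)).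
Proof.
move=> nq pq1 op; apply: (@num_left_braces_chars p q pp pq npq n23 _ _ _ _ nq).
- by apply: num_classes_cyc_char => //; apply: count_cyc_triv_char.
- by apply: num_classes_cyc_char => //; apply: count_cyc_nontriv_char.
- by apply: (@num_classes_elem_char p q false) => //; apply: count_elem_triv_char.
- by apply: (@num_classes_elem_char p q true) => //; apply: count_elem_nontriv_char.
Qed.

Lemma not_dvdn_p2m1 : p %| q.-1 -> ~~ (q %| p ^ 2 - 1).
Proof.
move=> pq1; apply/negP => qp; have := pm1_or_coprime pp pq npq n23 qp.
rewrite coprime_pexpl // prime_coprime // pq1 //.
Qed.

End Totals.

Lemma num_left_braces_two (q : nat) : prime q -> 3 < q ->
  num_left_braces (2 ^ 2 * q) ((1 + (1 + (2 ^ 2 %| q.-1))) + 3 + (2 + (1 + (1 + (2 ^ 2 %| q.-1))))).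
Proof.
move=> pq q3; have p2 : prime 2 by [].
have oq : odd q by case: (even_prime pq) q3 => // ->.
have npq : 2 <> q by move=> e; move: q3; rewrite -e.
have pq1 : 2 %| q.-1 by rewrite dvdn2; case: q oq pq {q3 npq}.
have n23 : ~ (2 = 2 /\ q = 3) by case=> _ e; move: q3; rewrite e.
apply: (@num_left_braces_chars 2 q p2 pq npq n23).
- exact: not_dvdn_p2m1.
- by apply: num_classes_cyc_char => //; apply: count_cyc_triv_char.
- by apply: num_classes_cyc2_char => // e; apply: npq.
- by apply: (@num_classes_elem_char 2 q false) => //; apply: count_elem_triv_char.
- by apply: num_classes_elem2_char => //; apply: count_cyc_triv_char.
Qed.

Lemma mod1_dvdn_pred (p q : nat) : 0 < p -> (p = 1 %[mod q]) <-> (q %| p.-1).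
Proof.
by move=> p0; rewrite -subn1 -eqn_mod_dvd //; split=> /eqP.
Qed.

Lemma modN1_dvdn_succ (p q : nat) : (Posz p = -1 %[mod Posz q])%Z <-> (q %| p.+1).
Proof.
have -> : (q %| p.+1) = (Posz p == -1 %[mod Posz q])%Z.
  by rewrite eqz_mod_dvd GRing.opprK -PoszD addn1.
by split=> /eqP.
Qed.

Lemma half_add15 (q : nat) : odd q -> (q + 15) %/ 2 = (q.-1)./2 + 8.
Proof. by lia. Qed.

Lemma char_total (p : nat) (b : bool) : 0 < p ->
  (1 + (1 + b)) + (p + (if b then p.-1 else 0)) + (2 + 4) = if b then 2 * p + 8 else p + 8.
Proof. by case: b; lia. Qed.

Unset Implicit Arguments.

Theorem mainTheorem1 (p q : nat) (hp : prime p) (hq : prime q)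
    (hpq : p <> q) :
  (p = 1 %[mod q] -> 2 < q ->
     num_left_braces (p ^ 2 * q) ((q + 15) %/ 2)) /\
  (p = 1 %[mod q] -> q = 2 ->
     num_left_braces (p ^ 2 * q) 8) /\
  (odd p -> odd q -> (Posz p = -1 %[mod Posz q])%Z ->
     num_left_braces (p ^ 2 * q) 5) /\
  (odd p -> q = 1 %[mod p] -> q <> 1 %[mod p ^ 2] ->
     num_left_braces (p ^ 2 * q) (p + 8)) /\
  (odd p -> q = 1 %[mod p ^ 2] ->
     num_left_braces (p ^ 2 * q) (2 * p + 8)) /\
  (p = 2 -> 3 < q -> q <> 1 %[mod 4] ->
     num_left_braces (p ^ 2 * q) 9) /\
  (p = 2 -> q = 1 %[mod 4] ->
     num_left_braces (p ^ 2 * q) 11) /\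
  (p <> 1 %[mod q] -> ~ (Posz p = -1 %[mod Posz q])%Z -> q <> 1 %[mod p] ->
     num_left_braces (p ^ 2 * q) 4).
Proof.
have p1 := prime_gt1 hp; have q1 := prime_gt1 hq.
have p0 := ltnW p1; have q0 := ltnW q1.
(* Here q < p, so p cannot divide q - 1. *)
have coprime_small : q %| p.-1 -> coprime (p ^ 2) q.-1 /\ ~ (p = 2 /\ q = 3).
  move=> /dvdn_leq; rewrite -ltnS prednK // => /(_ p1) qp.
  split; last by case=> p2 q3; move: qp; rewrite p2 q3.
  rewrite coprime_pexpl // prime_coprime //; apply/negP => /dvdn_leq.
  by rewrite -ltnS prednK // => /(_ q1); lia.
have odd23 : odd p -> ~ (p = 2 /\ q = 3) by move=> op [p2]; move: op; rewrite p2.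
have p2q : p ^ 2 %| q.-1 -> p %| q.-1 by apply: dvdn_trans; apply: dvdn_exp.
split; [|split; [|split; [|split; [|split; [|split; [|split]]]]]].
- move=> /(mod1_dvdn_pred q p0) qp q2; have [cpq n23] := coprime_small qp.
  have oq : odd q by case: (even_prime hq) q2 => // ->.
  rewrite (half_add15 oq).
  exact: num_left_braces_split.
- move=> /(mod1_dvdn_pred q p0) qp q2; have [cpq n23] := coprime_small qp.
  by have := num_left_braces_split hp hq hpq n23 qp cpq; rewrite q2.
- move=> op oq /modN1_dvdn_succ qp.
  have nq : ~~ (q %| p.-1).
    (* A common divisor of p - 1 and p + 1 divides 2. *)
    apply/negP => qp1; have : q %| 2 by rewrite -(dvdn_addr 2 qp1) addn2 prednK.
    by rewrite dvdn_prime2 // => /eqP q2; move: oq; rewrite q2.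
  apply: (num_left_braces_nonsplit hp hq hpq (odd23 op) nq qp).
  rewrite coprime_pexpl // prime_coprime //; apply/negP => /dvdn_leq.
  rewrite -ltnS prednK // => /(_ q1); rewrite -ltnS prednK // => pq.
  (* From p < q and q dividing p + 1 follows q = p + 1, which is even. *)
  have e : q = p.+1 by apply/eqP; rewrite eqn_leq (dvdn_leq (ltn0Sn p) qp).
  by move: oq; rewrite e /= op.
- move=> op /(mod1_dvdn_pred p q0) pq nq.
  have np2 : p ^ 2 %| q.-1 = false by apply/negP => /(mod1_dvdn_pred (p ^ 2) q0).
  have nd := not_dvdn_p2m1 hp hq hpq (odd23 op) pq.
  have := num_left_braces_odd hp hq hpq (odd23 op) nd pq op.
  by rewrite char_total // np2.
- move=> op /(mod1_dvdn_pred (p ^ 2) q0) pq.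
  have nd := not_dvdn_p2m1 hp hq hpq (odd23 op) (p2q pq).
  have := num_left_braces_odd hp hq hpq (odd23 op) nd (p2q pq) op.
  by rewrite char_total // pq.
- move=> p2 q3 nq; have := num_left_braces_two hq q3.
  have -> : 2 ^ 2 %| q.-1 = false by apply/negP => /(mod1_dvdn_pred 4 q0).
  by rewrite p2.
- move=> p2 q4; have q4' := q4; move/(mod1_dvdn_pred 4 q0): q4 => q4.
  have q3 : 3 < q.
    by apply: leq_trans (leq_pred q); apply: dvdn_leq q4; rewrite -ltnS prednK.
  have := num_left_braces_two hq q3.
  by have -> : 2 ^ 2 %| q.-1 = true by []; rewrite p2.
- move=> pn1 pnN1 qn1.
  have nq1 : ~~ (q %| p.-1) by apply/negP => /(mod1_dvdn_pred q p0).
  have nq2 : ~~ (q %| p.+1) by apply/negP => /modN1_dvdn_succ.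
  apply: num_left_braces_direct => //.
  (* The pair (2, 3) does not occur, since 3 divides 2 + 1. *)
  + by case=> p2 q3; move: nq2; rewrite p2 q3.
  + have e : p ^ 2 - 1 = p.-1 * p.+1 by rewrite -subn1 -[p.+1]addn1 -subn_sqr exp1n.
    by rewrite e Euclid_dvdM // negb_or nq1.
  + rewrite coprime_pexpl // prime_coprime //; apply/negP => /(mod1_dvdn_pred p q0).
    exact: qn1.
Qed.
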